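(* Let $\lambda^1,\lambda^2,\lambda^3$ be pairwise distinct constants and $H(u_1,u_2,u_3)$ a function with $H_{12},H_{13},H_{23}$ nowhere zero satisfying $$J=0,\quad H_{123}=0,\quad \partial_{u_1}\big((\lambda^3-\lambda^2)H_{11}+R_2+R_3\big)=0,\quad \partial_{u_2}\big((\lambda^1-\lambda^3)H_{22}+R_1+R_3\big)=0,\quad \partial_{u_3}\big((\lambda^2-\lambda^1)H_{33}+R_1+R_2\big)=0.$$ Then the system $(u_i)_T+\lambda^i(u_i)_X+(H_i)_Y=0$, $i=1,2,3$, possesses a dispersionless Lax pair.
   Context: Notation: $H_i,H_{ij},H_{ijk}$ partial derivatives w.r.t. $u_1,u_2,u_3$; $R_1=\frac{H_{12}H_{13}}{H_{23}}(\lambda^2-\lambda^3)$, $R_2=\frac{H_{12}H_{23}}{H_{13}}(\lambda^3-\lambda^1)$, $R_3=\frac{H_{13}H_{23}}{H_{12}}(\lambda^1-\lambda^2)$; $\Delta=(\lambda^2-\lambda^3)H_{11}+(\lambda^3-\lambda^1)H_{22}+(\lambda^1-\lambda^2)H_{33}$; $J=(\lambda^2-\lambda^3)H_{12}^2H_{13}^2+(\lambda^3-\lambda^1)H_{23}^2H_{12}^2+(\lambda^1-\lambda^2)H_{13}^2H_{23}^2-H_{12}H_{23}H_{13}\Delta$. Write the system as $\mathbf u_T+A\mathbf u_X+B\mathbf u_Y=0$ with $A=\mathrm{diag}(\lambda^i)$, $B=(H_{ij})$. A dispersionless Lax pair is a pair of equations $\psi_T=f(\mathbf u,\psi_Y)$,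 $\psi_X=g(\mathbf u,\psi_Y)$ (with $f,g$ depending in general nonlinearly on $p=\psi_Y$) such that the system is recovered from the compatibility condition $\psi_{XT}=\psi_{TX}$; equivalently $\mathrm{grad}_{\mathbf u}f+\mathrm{grad}_{\mathbf u}g\,A=0$ and $\mathrm{grad}_{\mathbf u}g\,[f_pI_3+g_pA+B]=0$, with $\mathrm{grad}_{\mathbf u}g\not\equiv0$. *)

(* Defs.v *)
From HB Require Import structures.
From mathcomp Require Import all_boot all_order all_algebra.
From mathcomp Require Import all_classical all_reals all_analysis.
Set Implicit Arguments. Unset Strict Implicit. Unset Printing Implicit Defensive.
Import Order.TTheory GRing.Theory Num.Theory.
Import numFieldNormedType.Exports.
Local Open Scope classical_set_scope.
Local Open Scope ring_scope.

Definition ebase {R : realType} {n : nat} (i : 'I_n) : 'rV[R]_n := delta_mx 0 i.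

Definition pdiff {R : realType} {n : nat} (i : 'I_n) (F : 'rV[R]_n -> R)
  : 'rV[R]_n -> R := fun x => 'D_(ebase i) F x.

Definition iter_pdiff {R : realType} {n : nat} (l : seq 'I_n) (F : 'rV[R]_n -> R)
  : 'rV[R]_n -> R := foldr pdiff F l.

Definition smooth_on {R : realType} {n : nat} (U : set 'rV[R]_n) (F : 'rV[R]_n -> R) :=
  forall (l : seq 'I_n) (x : 'rV[R]_n), U x ->
    {for x, continuous (iter_pdiff l F)} /\
    forall i : 'I_n, derivable (iter_pdiff l F) x (ebase i).

Definition i1 : 'I_3 := @Ordinal 3 0 isT.
Definition i2 : 'I_3 := @Ordinal 3 1 isT.
Definition i3 : 'I_3 := @Ordinal 3 2 isT.

Section Quantities.
Context {R : realType} (l1 l2 l3 : R) (H : 'rV[R]_3 -> R).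

Definition H11 := pdiff i1 (pdiff i1 H).
Definition H22 := pdiff i2 (pdiff i2 H).
Definition H33 := pdiff i3 (pdiff i3 H).
Definition H12 := pdiff i1 (pdiff i2 H).
Definition H13 := pdiff i1 (pdiff i3 H).
Definition H23 := pdiff i2 (pdiff i3 H).
Definition H123 := pdiff i1 (pdiff i2 (pdiff i3 H)).

Definition R1 (x : 'rV[R]_3) := H12 x * H13 x / H23 x * (l2 - l3).
Definition R2 (x : 'rV[R]_3) := H12 x * H23 x / H13 x * (l3 - l1).
Definition R3 (x : 'rV[R]_3) := H13 x * H23 x / H12 x * (l1 - l2).

Definition Delta (x : 'rV[R]_3) :=
  (l2 - l3) * H11 x + (l3 - l1) * H22 x + (l1 - l2) * H33 x.

Definition Jinv (x : 'rV[R]_3) :=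
  (l2 - l3) * H12 x ^+ 2 * H13 x ^+ 2 + (l3 - l1) * H23 x ^+ 2 * H12 x ^+ 2
  + (l1 - l2) * H13 x ^+ 2 * H23 x ^+ 2 - H12 x * H23 x * H13 x * Delta x.

Definition Amx : 'M[R]_3 := diag_mx (\row_(i < 3) nth 0 [:: l1; l2; l3] i).
Definition Bmx (u : 'rV[R]_3) : 'M[R]_3 :=
  \matrix_(i < 3, j < 3) pdiff i (pdiff j H) u.
End Quantities.

(* Lax pair variables: z = (u1,u2,u3,p) in R^4; u-part and index embeddings *)
Definition ufst {R : realType} (z : 'rV[R]_4) : 'rV[R]_3 :=
  \row_(i < 3) z 0 (widen_ord (leqnSn 3) i).
Definition ip : 'I_4 := @Ordinal 4 3 isT.

Definition gradu {R : realType} (F : 'rV[R]_4 -> R) (z : 'rV[R]_4) : 'rV[R]_3 :=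
  \row_(i < 3) pdiff (widen_ord (leqnSn 3) i) F z.
Definition dp {R : realType} (F : 'rV[R]_4 -> R) (z : 'rV[R]_4) : R := pdiff ip F z.

(* Dispersionless Lax pair psi_T = f(u, psi_Y), psi_X = g(u, psi_Y) for
   u_T + A u_X + B u_Y = 0, on the u-domain U: smooth f, g on a nonempty open set
   W of (u,p)-space lying over U, such that
   grad_u f + grad_u g A = 0,  grad_u g [f_p I + g_p A + B] = 0,  grad_u g =/= 0. *)
Definition has_dispersionless_Lax_pair {R : realType} (l1 l2 l3 : R)
  (H : 'rV[R]_3 -> R) (U : set 'rV[R]_3) :=
  exists (W : set 'rV[R]_4) (f g : 'rV[R]_4 -> R),
    open W /\ W !=set0 /\ (forall z, W z -> U (ufst z)) /\
    smooth_on W f /\ smooth_on W g /\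
    (forall z, W z -> gradu f z + gradu g z *m Amx l1 l2 l3 = 0) /\
    (forall z, W z ->
       gradu g z *m (dp f z *: 1%:M + dp g z *: Amx l1 l2 l3 + Bmx H (ufst z)) = 0) /\
    (exists2 z, W z & gradu g z != 0).

(* Main.v *)
(* Write alpha, beta, gamma for lambda^2 - lambda^3, lambda^3 - lambda^1,
   lambda^1 - lambda^2.  In a Lax pair, a_i = g_{u_i} depends on u_i and p only, and
   f_p + lambda^j g_p = - (sum_i a_i H_ij) / a_j.  Eliminating f_p and g_p gives a
   cubic relation between the a_i; the condition J = 0 says that this cubic splits
   into a line and the conic
     alpha / (H23 a_1) + beta / (H13 a_2) + gamma / (H12 a_3) = 0,
   and the remaining conditions on H make the system for the a_i on the conic
   compatible.  It is solved explicitly, and f, g follow from the Poincare lemma.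

   If H13 / H23 is not constant in u_3, a solution is obtained by evaluating mixed
   derivatives of H at u_3 = s := - p / (alpha beta): a_1 = alpha H13(u_1, s),
   a_2 = - beta H23(u_2, s), and a_3 from the conic; the same holds with the indices
   permuted.  Otherwise all H_ij are products of affine functions of the variables, and
   a_i = alpha_i q / (H_jk c_i(p)) with q = sqrt |H12 H13 H23|, where (c_1, c_2, c_3)
   solves c_1' = kappa c_1 (c_2 - c_3) (and cyclically) on c_1 + c_2 + c_3 = 0. *)

Require Import Defs.
From HB Require Import structures.
From mathcomp Require Import all_boot all_order all_algebra.
From mathcomp Require Import all_classical all_reals all_analysis.
From mathcomp Require Import ring lra.
Import Order.TTheory GRing.Theory Num.Theory.
Import numFieldNormedType.Exports.
Local Open Scope classical_set_scope.
Local Open Scope ring_scope.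
Set Implicit Arguments.
Unset Strict Implicit.
Unset Printing Implicit Defensive.

(** * Smooth functions and partial derivatives *)

(** The definition of smoothness speaks of partial derivatives only, so the chain rule is used only
    for maps that carry coordinate lines to coordinate lines. These suffice because H123 = 0 makes
    each mixed H_ij a function of u_i and u_j alone. Put S_j = f_p + lambda^j g_p. Three functions
    S_j come from two unknowns f_p, g_p exactly when alpha S_1 + beta S_2 + gamma S_3 = 0, and
    closedness of df and dg in the mixed directions u_i, p reads dS_j/du_i = (lambda^j - lambda^i)
    da_i/dp. On the conic the linear relation is a consequence of J = 0, the equation for j = i is a
    consequence of the formula for H_iii, and the linear relation turns one of the two other
    equations into the remaining one. A construction of the a_i therefore owes a single off-diagonal
    equation for each i. The two cases are separated by the determinant of (H13, H23) at two points
    that differ in u_3: it is the denominator of a_3 when the conic is solved for a_3. If it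
    vanishes for all pairs of points and all orderings of the indices, its derivative gives the
    degenerate identities behind the second case. *)

Lemma continuous_near_eq {T U : topologicalType} (f g : T -> U) x :
  (\forall y \near x, f y = g y) -> {for x, continuous f} ->
  {for x, continuous g}.
Proof.
move=> fg cf; rewrite /prop_for /continuous_at -(nbhs_singleton fg).
by apply: cvg_trans cf; apply: near_eq_cvg; apply: filterS fg => y ->.
Qed.

Section DerivativeRules.
Context {R : realType} {V : normedModType R}.
Implicit Types (F G : V -> R) (x v : V).

Lemma is_derive_add F G x v f g : is_derive x v F f -> is_derive x v G g ->
  is_derive x v (fun y => F y + G y) (f + g).
Proof. by move=> dF dG; exact: is_deriveD. Qed.

Lemma is_derive_mul F G x v f g : is_derive x v F f -> is_derive x v G g ->
  is_derive x v (fun y => F y * G y) (f * G x + F x * g).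
Proof.
move=> dF dG; apply: (is_derive_eq (is_deriveM dF dG)).
by rewrite addrC; congr (_ + _); rewrite mulrC.
Qed.

Lemma is_derive_const x v (c : R) : is_derive x v (fun=> c) 0.
Proof. exact: is_derive_cst. Qed.

Lemma is_derive_cmul F x v f (c : R) : is_derive x v F f ->
  is_derive x v (fun y => c * F y) (c * f).
Proof. by move=> dF; exact: is_deriveZ. Qed.

Lemma is_derive_opp F x v f : is_derive x v F f ->
  is_derive x v (fun y => - F y) (- f).
Proof. by move=> dF; exact: is_deriveN. Qed.

Lemma is_derive_inv F x v f : F x != 0 -> is_derive x v F f ->
  is_derive x v (fun y => (F y)^-1) (- f / F x ^+ 2).
Proof.
move=> Fx0 [dF <-]; apply: DeriveDef; first exact: derivableV.
by rewrite deriveV// scaleNr mulNr mulrC.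
Qed.

Lemma is_derive_unique F x v f g :
  is_derive x v F f -> is_derive x v F g -> f = g.
Proof. by move=> [_ <-] [_ <-]. Qed.

End DerivativeRules.

Section SmoothCalculus.
Context {R : realType} {n : nat}.
Implicit Types (W : set 'rV[R]_n) (F G : 'rV[R]_n -> R) (x v : 'rV[R]_n).

Lemma is_derive_eq_on W F G x v f : open W -> W x ->
  (forall y, W y -> F y = G y) -> is_derive x v F f -> is_derive x v G f.
Proof.
move=> oW Wx FG; apply: near_eq_is_derive.
by apply: filterS (open_nbhs_nbhs (conj oW Wx)).
Qed.

Inductive ratfun W (gen : ('rV[R]_n -> R) -> Prop) : ('rV[R]_n -> R) -> Prop :=
| ratfun_gen F : gen F -> ratfun W gen F
| ratfun_cst c : ratfun W gen (fun=> c)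
| ratfunD F G : ratfun W gen F -> ratfun W gen G ->
    ratfun W gen (fun y => F y + G y)
| ratfunM F G : ratfun W gen F -> ratfun W gen G ->
    ratfun W gen (fun y => F y * G y)
| ratfunV F : ratfun W gen F -> (forall y, W y -> F y != 0) ->
    ratfun W gen (fun y => (F y)^-1).

(* The rational expressions in a family of functions whose partial derivatives
   are again such expressions are smooth: this covers products and quotients,
   solutions of polynomial ODEs, and primitives alike. *)
Lemma smooth_ratfun W gen : open W ->
  (forall F, gen F -> (forall y, W y -> {for y, continuous F}) /\
    forall i, exists G, ratfun W gen G /\
      forall y, W y -> is_derive y (ebase i) F (G y)) ->
  forall F, ratfun W gen F -> smooth_on W F.
Proof.
move=> oW genP.
have step F : ratfun W gen F -> (forall y, W y -> {for y, continuous F}) /\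
    forall i, exists G, ratfun W gen G /\
      forall y, W y -> is_derive y (ebase i) F (G y).
  elim=> {F}[F|c|F G rF [cF dF] rG [cG dG]|F G rF [cF dF] rG [cG dG]
    |F rF [cF dF] F0].
  - exact: genP.
  - split=> [y _|i]; first exact: cst_continuous.
    exists (fun=> 0); split; first exact: ratfun_cst.
    by move=> y _; exact: is_derive_const.
  - split=> [y Wy|i]; first by apply: continuousD; [exact: cF|exact: cG].
    have [F' [rF' F'P]] := dF i; have [G' [rG' G'P]] := dG i.
    exists (fun y => F' y + G' y); split; first exact: ratfunD.
    by move=> y Wy; apply: is_derive_add; [exact: F'P|exact: G'P].
  - split=> [y Wy|i]; first by apply: continuousM; [exact: cF|exact: cG].
    have [F' [rF' F'P]] := dF i; have [G' [rG' G'P]] := dG i.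
    exists (fun y => F' y * G y + F y * G' y); split.
      by apply: ratfunD; exact: ratfunM.
    by move=> y Wy; apply: is_derive_mul; [exact: F'P|exact: G'P].
  - split=> [y Wy|i]; first by apply: continuousV; [exact: F0|exact: cF].
    have [F' [rF' F'P]] := dF i.
    exists (fun y => (-1 * F' y) * ((F y)^-1 * (F y)^-1)); split.
      apply: ratfunM; first by apply: ratfunM => //; exact: ratfun_cst.
      by apply: ratfunM; exact: ratfunV.
    move=> y Wy; apply: is_derive_eq.
      by apply: is_derive_inv; [exact: F0|exact: F'P].
    by rewrite mulN1r expr2 invfM.
have iter l F : ratfun W gen F -> exists G, ratfun W gen G /\
    forall y, W y -> iter_pdiff l F y = G y.
  elim: l => [|i l IH] rF; first by exists F.
  have [G [rG GP]] := IH rF; have [_ /(_ i)[G' [rG' G'P]]] := step _ rG.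
  exists G'; split=> // y Wy; rewrite /= /pdiff.
  have := is_derive_eq_on oW Wy (fun z Wz => esym (GP z Wz)) (G'P _ Wy).
  by case.
move=> F rF l x Wx; have [G [rG GP]] := iter l F rF; have [cG dG] := step _ rG.
have nGF : \forall y \near x, G y = iter_pdiff l F y.
  by apply: filterS (open_nbhs_nbhs (conj oW Wx)) => y Wy; rewrite GP.
split=> [|i]; first exact: continuous_near_eq nGF (cG _ Wx).
have [G' [_ /(_ _ Wx)[dGx _]]] := dG i.
exact: (near_eq_derivable nGF dGx).
Qed.

Lemma smooth_continuous W F x : smooth_on W F -> W x -> {for x, continuous F}.
Proof. by move=> sF Wx; have [] := sF [::] x Wx. Qed.

Lemma smooth_is_derive W F x i : smooth_on W F -> W x ->
  is_derive x (ebase i) F (pdiff i F x).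
Proof.
by move=> sF Wx; have [_ dF] := sF [::] x Wx; apply: derivableP; exact: dF.
Qed.

Lemma smooth_pdiff W F i : smooth_on W F -> smooth_on W (pdiff i F).
Proof.
by move=> sF l; have := sF (rcons l i); rewrite /iter_pdiff foldr_rcons.
Qed.

Lemma smooth_subset W W' F : W' `<=` W -> smooth_on W F -> smooth_on W' F.
Proof. by move=> W'W sF l x /W'W; exact: sF. Qed.

Lemma pdiff_eq F x i f : is_derive x (ebase i) F f -> pdiff i F x = f.
Proof. by case. Qed.

(** Smooth functions are themselves a family closed under partial derivatives, so sums, products and
    inverses need no Leibniz formula for iterated derivatives. *)
Lemma smooth_ratfun_smooth W F : open W -> ratfun W (smooth_on W) F ->
  smooth_on W F.
Proof.
move=> oW; apply: smooth_ratfun => // {}F sF.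
split=> [y Wy|i]; first exact: (smooth_continuous sF Wy).
exists (pdiff i F); split; last by move=> y Wy; exact: (smooth_is_derive i sF Wy).
by apply: ratfun_gen; exact: (smooth_pdiff _ sF).
Qed.

Lemma smooth_cst W (c : R) : open W -> smooth_on W (fun=> c).
Proof. by move=> oW; apply: smooth_ratfun_smooth => //; exact: ratfun_cst. Qed.

Lemma smoothD W F G : open W -> smooth_on W F -> smooth_on W G ->
  smooth_on W (fun y => F y + G y).
Proof.
by move=> oW sF sG; apply: smooth_ratfun_smooth => //; apply: ratfunD;
  exact: ratfun_gen.
Qed.

Lemma smoothM W F G : open W -> smooth_on W F -> smooth_on W G ->
  smooth_on W (fun y => F y * G y).
Proof.
by move=> oW sF sG; apply: smooth_ratfun_smooth => //; apply: ratfunM;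
  exact: ratfun_gen.
Qed.

Lemma smoothN W F : open W -> smooth_on W F -> smooth_on W (fun y => - F y).
Proof.
move=> oW sF; have -> : (fun y => - F y) = (fun y => (-1) * F y).
  by apply/funext => y; rewrite mulN1r.
by apply: smoothM => //; exact: smooth_cst.
Qed.

Lemma smoothV W F : open W -> smooth_on W F -> (forall y, W y -> F y != 0) ->
  smooth_on W (fun y => (F y)^-1).
Proof.
move=> oW sF F0; apply: smooth_ratfun_smooth => //.
by apply: ratfunV => //; exact: ratfun_gen.
Qed.

End SmoothCalculus.

(** * Derivatives along lines and the chain rule for coordinate maps *)

Section Lines.
Context {R : realType} {V : normedModType R}.
Implicit Types (F : V -> R) (x v : V).

(** Both sides are limits of the same difference quotient. One-variable results, such as the mean
    value theorem and the chain rule, thereby apply to directional derivatives. *)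
Lemma is_derive_line F x v f t :
  is_derive (x + t *: v) v F f <->
  is_derive t (1 : R) (fun s => F (x + s *: v)) f.
Proof.
have E : (fun h : R => h^-1 *: ((F \o shift (x + t *: v)) (h *: v) - F (x + t *: v)))
  = (fun h : R => h^-1 *: (((fun s => F (x + s *: v)) \o shift t) (h *: (1 : R))
      - F (x + t *: v))).
  apply/funext => h /=; congr (_ *: (F _ - _)).
  by rewrite scalerDl addrCA [h *: 1]mulr1.
by split=> -[dF <-]; apply: DeriveDef;
  rewrite /derivable /derive ?E -?E //; move: dF; rewrite /derivable E.
Qed.

Lemma is_derive_line0 F x v f :
  is_derive x v F f <-> is_derive 0 (1 : R) (fun s => F (x + s *: v)) f.
Proof. by rewrite -is_derive_line scale0r addr0. Qed.

End Lines.

(** As [phi] maps the line through [z] affinely into the line through [phi z], only the scaling by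
    [k] of the real line has to be composed with. The value k = 0 covers directions that [phi]
    forgets. *)
Lemma is_derive_pullback {R : realType} {V U : normedModType R}
    (phi : V -> U) (F : U -> R) z v w k f :
  (forall t, phi (z + t *: v) = phi z + (t * k) *: w) ->
  is_derive (phi z) w F f -> is_derive z v (F \o phi) (k * f).
Proof.
move=> phiE /is_derive_line0 dF; apply/is_derive_line0.
have -> : (fun s => (F \o phi) (z + s *: v)) =
    (fun s => F (phi z + s *: w)) \o (fun s => s * k).
  by apply/funext => s /=; rewrite phiE.
have dk : is_derive (0 : R) (1 : R) (fun s => s * k) k.
  apply: (is_derive_eq (is_deriveM (is_derive_id (0 : R) 1)
    (is_derive_cst k (0 : R) 1))).
  by rewrite scaler0 add0r [LHS]mulr1.
by rewrite mulrC; apply: is_derive1_comp; rewrite mul0r.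
Qed.

Lemma is_derive_scale {R : realType} {V : normedModType R} (F : V -> R) x v k f :
  is_derive x v F f -> is_derive x (k *: v) F (k * f).
Proof.
by apply: (@is_derive_pullback _ _ _ id) => t; rewrite scalerA.
Qed.

Lemma mvt_segment {R : realType} {V : normedModType R} (F d : V -> R) x v :
  (forall t : R, 0 <= t <= 1 -> is_derive (x + t *: v) v F (d (x + t *: v))) ->
  exists2 t : R, 0 <= t <= 1 & F (x + v) - F x = d (x + t *: v).
Proof.
move=> dF; have dg (t : R) : 0 <= t <= 1 ->
    is_derive t (1 : R) (fun s => F (x + s *: v)) (d (x + t *: v)).
  by move=> /dF; rewrite is_derive_line.
have [||t] := @MVT_segment R (fun s => F (x + s *: v))
  (fun s => d (x + s *: v)) 0 1 ler01.
- by move=> t; rewrite in_itv/= => /andP[t0 t1]; apply: dg; rewrite !ltW.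
- apply: continuous_in_subspaceT => t; rewrite inE/= in_itv/= => /dg[D _].
  exact/differentiable_continuous/derivable1_diffP.
by rewrite in_itv/= scale0r scale1r addr0 subr0 mulr1; exists t.
Qed.

(* For such maps the chain rule holds without total differentiability. *)
Definition coord_map {R : realType} {n m : nat} (phi : 'rV[R]_n -> 'rV[R]_m)
    (k : 'I_n -> R) (j : 'I_n -> 'I_m) :=
  forall z t i, phi (z + t *: ebase i) = phi z + (t * k i) *: ebase (j i).

(** The generators are the pullbacks of all smooth functions: the derivative of one is a constant
    times another. *)
Lemma smooth_pullback {R : realType} {n m : nat}
    (phi : 'rV[R]_n -> 'rV[R]_m) k j (W : set 'rV[R]_n) (W' : set 'rV[R]_m)
    (F : 'rV[R]_m -> R) :
  open W -> coord_map phi k j -> continuous phi ->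
  (forall z, W z -> W' (phi z)) ->
  smooth_on W' F -> smooth_on W (F \o phi).
Proof.
move=> oW phiP cphi WW' sF.
apply: (@smooth_ratfun _ _ W (fun G => exists2 F, smooth_on W' F & G = F \o phi)
  ) => //; last by apply: ratfun_gen; exists F.
move=> {F sF} _ [F sF ->]; split=> [y Wy|i].
  apply: continuous_comp; first exact: cphi.
  exact: (smooth_continuous sF (WW' _ Wy)).
exists (fun y => k i * (pdiff (j i) F \o phi) y); split.
  apply: ratfunM; first exact: ratfun_cst.
  by apply: ratfun_gen; exists (pdiff (j i) F) => //; exact: (smooth_pdiff _ sF).
move=> y Wy; apply: is_derive_pullback => //.
exact: (smooth_is_derive _ sF (WW' _ Wy)).
Qed.

Lemma is_derive_shiftr {R : realType} {V : normedModType R} (F : V -> R) x v w f :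
  is_derive (x + w) v F f -> is_derive x v (fun y => F (y + w)) f.
Proof.
move=> dF; rewrite -[f]mul1r.
apply: (@is_derive_pullback _ _ _ (fun y => y + w) _ _ _ v) => // t.
by rewrite mulr1 addrAC.
Qed.

(** Balls are cubes, hence stable under replacing one coordinate by a value close to that of the
    centre; the coordinatewise arguments below rely on this. *)
Lemma ball_rowP {R : realType} {n : nat} (x y : 'rV[R]_n) r :
  ball x r y <-> 0 < r /\ forall i, `|x 0 i - y 0 i| < r.
Proof.
split=> [[r0 xy]|[r0 xy]]; split=> //; first by move=> i; exact: xy.
by move=> i j; rewrite [i]ord1; exact: xy.
Qed.

Lemma addebaseE {R : realType} {n : nat} (x : 'rV[R]_n) t (i j : 'I_n) :
  (x + t *: ebase i) 0 j = x 0 j + t * (j == i)%:R.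
Proof. by rewrite !mxE eqxx. Qed.

(** * Mean values, symmetry of second derivatives, continuity from partial derivatives *)

Section Partials.
Context {R : realType} {n : nat}.
Implicit Types (W : set 'rV[R]_n) (F G : 'rV[R]_n -> R) (x v : 'rV[R]_n).

Lemma ball_convex x0 r x v (t : R) : 0 <= t <= 1 -> ball x0 r x ->
  ball x0 r (x + v) -> ball x0 r (x + t *: v).
Proof.
move=> /andP[t0 t1] /ball_rowP[r0 xr] /ball_rowP[_ xvr].
apply/ball_rowP; split=> // j; have := xvr j; have := xr j; rewrite !mxE.
have -> : x0 0 j - (x 0 j + t * v 0 j) =
    (1 - t) * (x0 0 j - x 0 j) + t * (x0 0 j - (x 0 j + v 0 j)) by ring.
move=> a b; apply: le_lt_trans (ler_normD _ _) _; rewrite !normrM.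
rewrite (ger0_norm t0) ger0_norm ?subr_ge0//.
have t1' : 0 <= 1 - t by rewrite subr_ge0.
have [ab|/ltW ab] := leP `|x0 0 j - x 0 j| `|x0 0 j - (x 0 j + v 0 j)|.
  by have := ler_wpM2l t1' ab; lra.
by have := ler_wpM2l t0 ab; lra.
Qed.

Lemma mvt_ball F (d : 'rV[R]_n -> R) x0 (r : R) x i (h : R) :
  (forall y, ball x0 r y -> is_derive y (ebase i) F (d y)) ->
  ball x0 r x -> ball x0 r (x + h *: ebase i) ->
  exists t : R, [/\ 0 <= t <= 1, ball x0 r (x + (t * h) *: ebase i) &
    F (x + h *: ebase i) - F x = h * d (x + (t * h) *: ebase i)].
Proof.
move=> dF xr xhr.
have inb (t : R) : 0 <= t <= 1 -> ball x0 r (x + t *: (h *: ebase i)).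
  by move=> t01; exact: ball_convex.
have [|t t01 E] := @mvt_segment _ _ F (fun y => h * d y) x (h *: ebase i).
  by move=> t /inb/dF; exact: is_derive_scale.
by exists t; rewrite -scalerA; split=> //; exact: inb.
Qed.

Lemma constant_along F x0 (r : R) x i (h : R) :
  (forall y, ball x0 r y -> is_derive y (ebase i) F 0) ->
  ball x0 r x -> ball x0 r (x + h *: ebase i) -> F (x + h *: ebase i) = F x.
Proof.
move=> dF xr xhr; have [c [_ _]] := mvt_ball dF xr xhr.
by rewrite mulr0 => /eqP; rewrite subr_eq0 => /eqP.
Qed.

(** The mean value theorem is applied in direction j to the increment F (y + h e_i) - F y, then in
    direction i to [pdiff j F]; this order fixes the order of the derivatives in the result. *)
Lemma second_difference F x (r : R) i j (h : R) : i != j -> 0 < h < r ->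
  smooth_on (ball x r) F -> exists2 y, ball x r y &
  F (x + h *: ebase i + h *: ebase j) - F (x + h *: ebase j)
    - F (x + h *: ebase i) + F x = h * (h * pdiff i (pdiff j F) y).
Proof.
move=> ij /andP[h0 hr] sF.
have small (u : R) : 0 <= u -> u <= 1 -> `|u * h| < r.
  move=> u0 u1; rewrite ger0_norm ?mulr_ge0 ?(ltW h0)//.
  by apply: le_lt_trans hr; rewrite ler_piMl ?(ltW h0).
have inb (s t : R) : 0 <= s <= 1 -> 0 <= t <= 1 ->
    ball x r (x + (s * h) *: ebase j + (t * h) *: ebase i).
  move=> /andP[s0 s1] /andP[t0 t1]; apply/ball_rowP.
  split=> [|k]; first exact: lt_trans hr.
  rewrite !addebaseE -!addrA opprD addNKr normrN.
  case: (eqVneq k j) => [kj|_]; case: (eqVneq k i) => [ki|_].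
  - by rewrite -ki kj eqxx in ij.
  - by rewrite mulr0 addr0 mulr1; exact: small.
  - by rewrite mulr0 add0r mulr1; exact: small.
  - by rewrite !mulr0 addr0 normr0; exact: lt_trans hr.
have I1 : (0 : R) <= (1 : R) <= (1 : R) by apply/andP; split; lra.
have I0 : (0 : R) <= (0 : R) <= (1 : R) by apply/andP; split; lra.
have [|s s01 Es] := @mvt_segment _ _ (fun y => F (y + h *: ebase i) - F y)
    (fun y => h * (pdiff j F (y + h *: ebase i) - pdiff j F y)) x (h *: ebase j).
  move=> s s01; apply: is_derive_scale; apply: is_derive_add.
    apply/is_derive_shiftr/(smooth_is_derive _ sF).
    by have := inb _ _ s01 I1; rewrite mul1r -scalerA.
  apply/is_derive_opp/(smooth_is_derive _ sF).
  by have := inb _ _ s01 I0; rewrite mul0r scale0r addr0 -scalerA.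
rewrite scalerA in Es.
have [|t t01 Et] := @mvt_segment _ _ (pdiff j F)
    (fun y => h * pdiff i (pdiff j F) y) (x + (s * h) *: ebase j) (h *: ebase i).
  move=> t t01; apply: is_derive_scale.
  apply: (smooth_is_derive _ (smooth_pdiff _ sF)).
  by rewrite scalerA; exact: inb.
rewrite scalerA in Et.
exists (x + (s * h) *: ebase j + (t * h) *: ebase i); first exact: inb.
rewrite -Et -Es [x + h *: _ + _]addrAC; ring.
Qed.

(** The second difference is symmetric in i and j, so the two mixed derivatives agree at two points
    arbitrarily close to [x]; continuity does the rest. *)
Lemma pdiff_comm W F x i j : open W -> smooth_on W F -> W x ->
  pdiff i (pdiff j F) x = pdiff j (pdiff i F) x.
Proof.
have [->//|ij] := eqVneq i j => oW sF Wx.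
apply/eqP; rewrite -subr_eq0 -normr_le0; apply/ler_addgt0Pr => e e0; rewrite add0r.
have cont k l : \forall y \near x,
    `|pdiff k (pdiff l F) x - pdiff k (pdiff l F) y| < e / 2.
  have := smooth_continuous (smooth_pdiff k (smooth_pdiff l sF)) Wx.
  by move/cvgrPdist_lt => /(_ (e / 2)); apply; rewrite divr_gt0.
have : \forall y \near x, [/\ W y,
    `|pdiff i (pdiff j F) x - pdiff i (pdiff j F) y| < e / 2 &
    `|pdiff j (pdiff i F) x - pdiff j (pdiff i F) y| < e / 2].
  by apply: filterS3 (open_nbhs_nbhs (conj oW Wx)) (cont i j) (cont j i).
move=> /nbhs_ballP[r /= r0 xr].
have sFr : smooth_on (ball x r) F by apply: smooth_subset sF => y /xr[].
have hr : 0 < r / 2 < r by apply/andP; split; lra.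
have [y /xr[_ + _] Ey] := second_difference ij hr sFr.
have [|z /xr[_ _ +] Ez] := second_difference _ hr sFr (i := j) (j := i).
  by rewrite eq_sym.
have E : pdiff i (pdiff j F) y = pdiff j (pdiff i F) z.
  have h0 : r / 2 != 0 by rewrite gt_eqF//; case/andP: hr.
  have Ex : x + (r / 2) *: ebase j + (r / 2) *: ebase i =
    x + (r / 2) *: ebase i + (r / 2) *: ebase j by rewrite addrAC.
  rewrite Ex in Ez; apply: (mulfI h0); apply: (mulfI h0).
  apply: etrans (esym Ey) _; apply: etrans _ Ez; congr (_ + _).
  by rewrite addrAC.
rewrite E; move: (pdiff i (pdiff j F) x) (pdiff j (pdiff i F) x)
  (pdiff j (pdiff i F) z) => a b c ac bc.
have -> : a - b = (a - c) - (b - c) by rewrite opprB addrA subrK.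
apply: le_trans (ler_normB (a - c) (b - c)) _.
by rewrite [leRHS]splitr; apply: lerD; exact: ltW.
Qed.

(** Continuous partial derivatives are locally bounded, and passing from [x] to [y] one coordinate
    at a time (the points [z k]) gives a Lipschitz bound. This is how primitives are seen to be
    continuous. *)
Lemma C1_continuous W F (d : 'I_n -> 'rV[R]_n -> R) x : open W -> W x ->
  (forall y i, W y -> is_derive y (ebase i) F (d i y)) ->
  (forall i, {for x, continuous (d i)}) -> {for x, continuous F}.
Proof.
move=> oW Wx dF cd; pose M := \sum_i (`|d i x| + 1).
have M0 : 0 <= M by apply: sumr_ge0 => i _; rewrite addr_ge0.
have : \forall y \near x, W y /\ forall i, `|d i y| <= M.
  have cd' : \forall y \near x, forall i, `|d i x - d i y| < 1.
    apply: (@filter_forall _ _ (fun i y => `|d i x - d i y| < 1) (nbhs x)) => i.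
    by move/cvgrPdist_lt : (cd i); apply.
  apply: filterS2 (open_nbhs_nbhs (conj oW Wx)) cd' => y Wy yd; split=> // i.
  apply: (@le_trans _ _ (`|d i x| + 1)); last first.
    rewrite /M (bigD1 i)//= lerDl; apply: sumr_ge0 => k _; exact: addr_ge0.
  rewrite -lerBlDl; apply: le_trans (lerB_dist _ _) _; by rewrite distrC ltW.
move=> /nbhs_ballP[r /= r0 xr].
have lip y (e : R) : ball x r y -> 0 <= e -> (forall i, `|x 0 i - y 0 i| <= e) ->
    `|F y - F x| <= n%:R * (e * M).
  move=> /ball_rowP[_ yr] e0 ye.
  pose z k := \row_(i < n) (if (i < k)%N then y 0 i else x 0 i).
  have zr k : ball x r (z k).
    apply/ball_rowP; split=> // i; rewrite !mxE; case: ifP => // _.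
    by rewrite subrr normr0.
  have zn : z n = y by apply/rowP => i; rewrite !mxE ltn_ord.
  have z0 : z 0%N = x by apply/rowP => i; rewrite !mxE.
  rewrite -{1}zn; have : (n <= n)%N by [].
  elim: {1 3 4}n => [_|k IH kn]; first by rewrite z0 subrr normr0 mul0r.
  have zS : z k.+1 = z k + (y 0 (Ordinal kn) - x 0 (Ordinal kn)) *: ebase (Ordinal kn).
    apply/rowP => i; rewrite addebaseE !mxE ltnS leq_eqVlt.
    rewrite -[i == Ordinal kn]/(nat_of_ord i == k).
    have [ik|_] := boolP (nat_of_ord i == k).
      have -> : i = Ordinal kn by exact/val_inj/eqP.
      by rewrite ltnn /= mulr1 addrC subrK.
    by rewrite /= mulr0 addr0.
  have [|t [_ zt E]] := mvt_ball (fun y yr => dF y (Ordinal kn) (xr _ yr).1)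
      (zr k) (h := y 0 (Ordinal kn) - x 0 (Ordinal kn)).
    by rewrite -zS.
  rewrite -zS in E.
  have -> : F (z k.+1) - F x = (F (z k.+1) - F (z k)) + (F (z k) - F x) by ring.
  apply: le_trans (ler_normD _ _) _; rewrite mulrSr mulrDl mul1r addrC.
  apply: lerD; first exact: IH (ltnW kn).
  rewrite E normrM; apply: ler_pM => //; first by rewrite distrC.
  exact: (xr _ zt).2.
apply/(@cvgrPdist_lt _ _ _ (nbhs x) (nbhs_filter x)) => e e0.
(* The summand 1 keeps the divisor positive when n M = 0 and makes the final inequality strict. *)
pose dl := e / (n%:R * M + 1).
have D0 : 0 < n%:R * M + 1 by rewrite ltr_wpDl// mulr_ge0.
have dl0 : 0 < dl by rewrite divr_gt0.
apply/nbhs_ballP; exists (Num.min r dl) => /=; first by rewrite lt_min r0.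
move=> y yb; rewrite distrC.
have yr : ball x r y by apply: le_ball yb; rewrite ge_min lexx.
have yd : ball x dl y by apply: le_ball yb; rewrite ge_min lexx orbT.
apply: (@le_lt_trans _ _ (n%:R * (dl * M))).
  apply: lip => //; first exact: ltW.
  by move/ball_rowP : yd => [_ yd] i; exact: ltW.
rewrite mulrCA /dl mulrAC ltr_pdivrMr//.
by rewrite ltr_pM2l// ltrDl.
Qed.

End Partials.

(** * Primitives and scalar differential equations *)

Lemma primitive_exists {R : realType} (f : R -> R) (c r : R) : 0 < r ->
  (forall t, `|t - c| < r -> {for t, continuous f}) ->
  exists F : R -> R, F c = 0 /\
    forall t, `|t - c| < r / 2 -> is_derive t (1 : R) F (f t).
Proof.
(* The integral starts at the left end [a], so that one formula serves both sides of [c]; halving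
   the radius keeps the closed interval inside the domain of continuity. *)
move=> r0 cf; pose a := c - r / 2; pose u := c + r / 2.
have fi : (@lebesgue_measure R).-integrable `[a, u] (EFin \o f).
  apply: continuous_compact_integrable; first exact: segment_compact.
  apply: continuous_in_subspaceT => t; rewrite inE/= in_itv/= => /andP[ta tu].
  apply: cf; rewrite ltr_norml; rewrite /a in ta; rewrite /u in tu.
  by apply/andP; split; lra.
pose F0 t : R := (\int[@lebesgue_measure R]_(s in `[a, t]) f s)%R.
have dF0 t : `|t - c| < r / 2 -> is_derive t (1 : R) F0 (f t).
  rewrite ltr_norml => /andP[t1 t2].
  have tu : t < u by rewrite /u; lra.
  have at' : a < t by rewrite /a; lra.
  have ct : {for t, continuous f}.
    by apply: cf; rewrite ltr_norml; apply/andP; split; lra.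
  have [D E] := continuous_FTC1_closed tu fi at' ct.
  exact: (DeriveDef D (etrans (esym (derive1E _ _)) E)).
exists (fun t => F0 t - F0 c); split=> [|t /dF0 D]; first by rewrite subrr.
by rewrite -[f t]addr0; apply: is_derive_add => //; exact: is_derive_const.
Qed.

(** Parametrising the segment covers both orders of [x] and [y], as required when integrating to
    either side of a centre. *)
Lemma mvt_real {R : realType} (F d : R -> R) (x y : R) :
  (forall t : R, 0 <= t <= 1 ->
    is_derive (x + t * (y - x)) (1 : R) F (d (x + t * (y - x)))) ->
  exists2 t : R, 0 <= t <= 1 & F y - F x = (y - x) * d (x + t * (y - x)).
Proof.
move=> dF; have [|t t01] := @mvt_segment R R^o F (fun z => (y - x) * d z) x (y - x).
  move=> t t01; rewrite -[X in is_derive _ X]mulr1.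
  exact: (@is_derive_scale _ R^o _ _ (1 : R) (y - x) _ (dF t t01)).
move=> E; exists t => //; apply: etrans E.
by rewrite [x + _]addrC subrK.
Qed.

(* The solution is the inverse function of a primitive of [1 / phi]. *)
Lemma autonomous_ode {R : realType} (phi : R -> R) (z0 r : R) : 0 < r ->
  (forall z, `|z - z0| < r -> {for z, continuous phi} /\ 0 < phi z) ->
  exists (y : R -> R) (d : R), 0 < d /\
    forall p, `|p| < d -> `|y p - z0| < r /\
      is_derive p (1 : R) y (phi (y p)).
Proof.
move=> r0 phiP.
have [|F [F0 dF]] := @primitive_exists R (fun z => (phi z)^-1) z0 r r0.
  move=> t /phiP[ct pt]; apply: continuousV => //; exact: lt0r_neq0.
have r2 : 0 < r / 2 by rewrite divr_gt0.
(* Values of the inverse are kept within [s] of [z0], strictly inside the interval of radius r / 2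
   on which [F] is differentiable and increasing. *)
pose s := r / 4.
have s0 : 0 < s by rewrite divr_gt0.
have sr : s < r / 2 by rewrite /s; lra.
have phi0 z : `|z - z0| < r / 2 -> 0 < phi z.
  by move=> zr; apply: (phiP z _).2; apply: lt_trans zr _; lra.
have Flt x y : `|x - z0| < r / 2 -> `|y - z0| < r / 2 -> x < y -> F x < F y.
  move=> xr yr xy.
  have inr t : 0 <= t <= 1 -> `|x + t * (y - x) - z0| < r / 2.
    move=> /andP[t0 t1].
    have a1 : 0 <= t * (y - x) by rewrite mulr_ge0// subr_ge0 ltW.
    have a2 : t * (y - x) <= y - x by rewrite ler_piMl// subr_ge0 ltW.
    move: xr yr; rewrite !ltr_norml => /andP[x1 x2] /andP[y1 y2].
    by apply/andP; split; lra.
  have [t /inr/dF D|t /inr/phi0 p0 E] := @mvt_real R F (fun z => (phi z)^-1) x y.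
    exact: D.
  by rewrite -subr_gt0 E mulr_gt0 ?invr_gt0// subr_gt0.
have sN : `|z0 - s - z0| < r / 2 by rewrite addrAC subrr sub0r normrN gtr0_norm.
have sP : `|z0 + s - z0| < r / 2 by rewrite addrAC subrr add0r gtr0_norm.
have z0P : `|z0 - z0| < r / 2 by rewrite subrr normr0.
have A0 : F (z0 - s) < 0 by rewrite -F0; apply: Flt => //; rewrite gtrBl.
have B0 : 0 < F (z0 + s) by rewrite -F0; apply: Flt => //; rewrite ltrDl.
pose d := Num.min (- F (z0 - s)) (F (z0 + s)).
have d0 : 0 < d by rewrite lt_min B0 oppr_gt0 A0.
have dP p : `|p| < d -> F (z0 - s) < p < F (z0 + s).
  by rewrite /d lt_min !ltr_norml => /andP[/andP[+ _] /andP[_ ->]];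
    rewrite opprK => ->.
(* The bound on [p] sits under the existential so that [choice] yields a total function; the value 0
   elsewhere is a default. *)
have inv p : exists z, `|p| < d -> F z = p /\ `|z - z0| < s.
  have [/dP/andP[p1 p2]|_] := boolP (`|p| < d); last by exists 0.
  have [|||z] := @IVT R F (z0 - s) (z0 + s) p.
  - by lra.
  - apply: continuous_in_subspaceT => t; rewrite inE/= in_itv/= => /andP[t1 t2].
    have [|D _] := dF t; first by rewrite ltr_norml; apply/andP; split; lra.
    exact/differentiable_continuous/derivable1_diffP.
  - by rewrite ge_min le_max (ltW p1) (ltW p2) orbT.
  rewrite in_itv/= => /andP[z1 z2] Fz; exists z => _; split=> //.
  have z1' : z0 - s != z by apply: contraTneq p1 => ->; rewrite Fz ltxx.
  have z2' : z != z0 + s by apply: contraTneq p2 => <-; rewrite Fz ltxx.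
  have {}z1 : z0 - s < z by rewrite lt_neqAle z1'.
  have {}z2 : z < z0 + s by rewrite lt_neqAle z2'.
  by rewrite ltr_norml; apply/andP; split; lra.
have [y yP] := choice inv.
exists y, d; split=> // p pd; have [Fy ys] := yP p pd.
have ysr : `|y p - z0| < r / 2 by exact: lt_trans ys sr.
split; first by apply: lt_trans ysr _; lra.
have cF z : `|z - z0| < r / 2 -> {for z, continuous F}.
  by move=> /dF[D _]; exact/differentiable_continuous/derivable1_diffP.
have near_s : \forall z \near y p, `|z - z0| < s.
  have : {for y p, continuous (fun z : R => `|z - z0|)}.
    by apply: continuous_comp; [apply: continuousB => //; exact: cst_continuous|
      exact: norm_continuous].
  by move=> /cvgr_lt; apply.
have near_d : \forall z \near y p, `|F z| < d.
  have : {for y p, continuous (fun z : R => `|F z|)}.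
    by apply: continuous_comp; [exact: cF|exact: norm_continuous].
  by move=> /cvgr_lt; apply; rewrite Fy.
rewrite -{1}Fy -[phi _]invrK; apply: is_derive_inverse.
- apply: filterS2 near_s near_d => z zs zd; have [Fyz yz] := yP _ zd.
  have zr := lt_trans zs sr; have yzr := lt_trans yz sr.
  case: (ltgtP (y (F z)) z) => // lt.
  + by have := Flt _ _ yzr zr lt; rewrite Fyz ltxx.
  + by have := Flt _ _ zr yzr lt; rewrite Fyz ltxx.
- by apply: filterS near_s => z zs; apply: cF; exact: lt_trans zs sr.
- exact: dF.
- by rewrite invr_neq0// gt_eqF// phi0.
Qed.

(** * The Poincare lemma *)

(** This replaces differentiation under the integral sign: a quadratic remainder of the integrand
    that is uniform in the integration variable survives integration. *)
Lemma is_derive_quadratic {R : realType} {V : normedModType R} (F : V -> R)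
    x v f (K d : R) : 0 < d ->
  (forall h : R, `|h| < d ->
    `|F (x + h *: v) - F x - h * f| <= K * h ^+ 2) ->
  is_derive x v F f.
Proof.
move=> d0 bound.
have K0 : 0 <= K.
  have d2 : 0 < (d / 2) ^+ 2 by rewrite exprn_gt0// divr_gt0.
  rewrite -(pmulr_lge0 _ d2); apply: le_trans (bound (d / 2) _) => //.
  by rewrite gtr0_norm ?divr_gt0// ltr_pdivrMr// ltr_pMr// ltr1n.
have cv : h^-1 *: ((F \o shift x) (h *: v) - F x) @[h --> 0^'] --> f.
  apply/cvgrPdist_lt => e e0; near=> h.
  have h0 : h != 0 by near: h; exact: nbhs_dnbhs_neq.
  have hd : `|h| < d.
    near: h; apply: dnbhs0_lt; exact: d0.
  have he : `|h| < e / (K + 1).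
    by near: h; apply: dnbhs0_lt; rewrite divr_gt0// ltr_wpDl.
  have -> : f - h^-1 *: ((F \o shift x) (h *: v) - F x) =
     - (h^-1 * (F (x + h *: v) - F x - h * f)).
    by rewrite /= [h *: v + x]addrC mulrBr mulKf// opprB.
  rewrite normrN normrM normfV ltr_pdivrMl ?normr_gt0//.
  apply: le_lt_trans (bound _ hd) _; rewrite -(real_normK (num_real h)) expr2 mulrCA.
  rewrite ltr_pM2l ?normr_gt0//.
  have K1 : 0 < K + 1 by rewrite ltr_wpDl.
  move: he; rewrite ltr_pdivlMr// => he; apply: le_lt_trans he.
  by rewrite mulrC ler_wpM2l// lerDl.
by apply: DeriveDef; [apply/cvg_ex; exists f|exact: cvg_lim cv].
Unshelve. all: by end_near. Qed.

Lemma continuous_rowP {R : realType} {k n : nat} (phi : 'rV[R]_k -> 'rV[R]_n) :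
  (forall i, continuous (fun x => phi x 0 i)) -> continuous phi.
Proof.
move=> cphi x; apply/(@cvg_ballP _ _ _ (nbhs x) (nbhs_filter x)) => e e0.
have H : \forall y \near x, forall i, `|phi x 0 i - phi y 0 i| < e.
  apply: (@filter_forall _ _ (fun i y => `|phi x 0 i - phi y 0 i| < e)
    (nbhs x)) => i.
  by move/cvgrPdist_lt : (cphi i x); apply.
by apply: filterS H => y xy; apply/ball_rowP.
Qed.

Section Poincare.
Context {R : realType} {n : nat}.
Implicit Types (F : 'rV[R]_n -> R) (x y : 'rV[R]_n) (m i j : 'I_n).

(** Written as a displacement along [ebase m], so that the rules for derivatives along lines apply
    to it in the variable [c]. *)
Definition set_coord m (c : R) x := x + (c - x 0 m) *: ebase m.

Lemma set_coordE m c x i : set_coord m c x 0 i = if i == m then c else x 0 i.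
Proof.
rewrite addebaseE; case: eqP => [->|_]; last by rewrite mulr0 addr0.
by rewrite mulr1 addrC subrK.
Qed.

Lemma set_coord_id m x : set_coord m (x 0 m) x = x.
Proof. by rewrite /set_coord subrr scale0r addr0. Qed.

Lemma set_coordK m c c' x : set_coord m c (set_coord m c' x) = set_coord m c x.
Proof. by apply/rowP => i; rewrite !set_coordE; case: (i == m). Qed.

Lemma set_coord_line m c x t : set_coord m c (x + t *: ebase m) = set_coord m c x.
Proof.
apply/rowP => i; rewrite !set_coordE addebaseE.
by case: eqP => // _; rewrite mulr0 addr0.
Qed.

Lemma set_coord_line_neq m c x t i : i != m ->
  set_coord m c (x + t *: ebase i) = set_coord m c x + t *: ebase i.
Proof.
move=> im; apply/rowP => j; rewrite [LHS]set_coordE [RHS]addebaseE set_coordE addebaseE.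
by case: eqP => // ->; rewrite eq_sym (negbTE im) mulr0 addr0.
Qed.

Lemma set_coord_map m c :
  coord_map (set_coord m c) (fun i => (i != m)%:R : R) id.
Proof.
move=> x t i /=; have [->|im] := eqVneq i m.
  by rewrite set_coord_line mulr0 scale0r addr0.
by rewrite set_coord_line_neq// mulr1.
Qed.

Lemma set_coord_continuous m c : continuous (set_coord m c).
Proof.
apply: continuous_rowP => i x; rewrite (_ : (fun x => _) =
    (fun x => if i == m then c else x 0 i)); last first.
  by apply/funext => y; rewrite set_coordE.
by case: eqP => _; [exact: cst_continuous|exact: coord_continuous].
Qed.

Lemma ball_set_coord x0 (r : R) m c x : `|x0 0 m - c| < r -> ball x0 r x ->
  ball x0 r (set_coord m c x).
Proof.
move=> cr /ball_rowP[r0 xr]; apply/ball_rowP; split=> // i.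
by rewrite set_coordE; case: eqP => [->|].
Qed.

Lemma ball_center_coord x0 (r : R) m x : ball x0 r x ->
  ball x0 r (set_coord m (x0 0 m) x).
Proof.
by move=> xr; apply: ball_set_coord => //; rewrite subrr normr0; case: xr.
Qed.

Lemma second_order F x0 (r M : R) x i (h : R) : smooth_on (ball x0 r) F ->
  (forall y, ball x0 r y -> `|pdiff i (pdiff i F) y| <= M) ->
  ball x0 r x -> ball x0 r (x + h *: ebase i) ->
  `|F (x + h *: ebase i) - F x - h * pdiff i F x| <= M * h ^+ 2.
Proof.
move=> sF FM xr xhr.
have [t [/andP[t0 t1] xtr ->]] :=
  mvt_ball (fun y yr => smooth_is_derive i sF yr) xr xhr.
have [s [s01 xsr E]] :=
  mvt_ball (fun y yr => smooth_is_derive i (smooth_pdiff i sF) yr) xr xtr.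
rewrite -mulrBr E; move: (pdiff i (pdiff i F) _) (FM _ xsr) => q qM.
have -> : h * (t * h * q) = t * q * h ^+ 2 by ring.
have h2 : 0 <= h ^+ 2 by exact: sqr_ge0.
rewrite normrM [`|h ^+ 2|]ger0_norm// ler_wpM2r// normrM ger0_norm//.
by apply: le_trans qM; rewrite ler_piMl.
Qed.

Definition closed_form (W : set 'rV[R]_n) (a : 'I_n -> 'rV[R]_n -> R) :=
  (forall i, smooth_on W (a i)) /\
  (forall i j x, W x -> pdiff i (a j) x = pdiff j (a i) x).

(* One step of the Poincare lemma: integrating [a m] in the direction [m] leaves
   a closed form without [m]-component which does not depend on [x_m]. *)
Lemma integrate_coord (a : 'I_n -> 'rV[R]_n -> R) x0 (r : R) m : 0 < r ->
  closed_form (ball x0 r) a ->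
  exists (r' : R) (Q : 'rV[R]_n -> R), [/\ 0 < r', r' <= r &
    forall x i, ball x0 r' x -> is_derive x (ebase i) Q
      (a i x - if i == m then 0 else a i (set_coord m (x0 0 m) x))].
Proof.
move=> r0 [sa ca]; pose c := x0 0 m.
have inr x t : ball x0 r x -> `|t - c| < r -> ball x0 r (set_coord m t x).
  by move=> xr tr; apply: ball_set_coord; rewrite // distrC.
have setd t x : is_derive t (1 : R) (fun s => set_coord m s x 0 m) 1.
  rewrite (_ : (fun s => _) = id); first exact: is_derive_id.
  by apply/funext => s; rewrite set_coordE eqxx.
have ex x : exists P : R -> R, ball x0 r x -> P c = 0 /\ forall t,
    `|t - c| < r / 2 -> is_derive t (1 : R) P (a m (set_coord m t x)).
  have [xr|] := pselect (ball x0 r x); last by exists (fun=> 0).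
  have [|P PP] := @primitive_exists R (fun t => a m (set_coord m t x)) c r r0.
    move=> t tr; have := smooth_is_derive m (sa m) (inr _ _ xr tr).
    rewrite -[set_coord m t x]/(x + (t - x 0 m) *: ebase m).
    move=> /is_derive_line D.
    have : is_derive t (1 : R) (fun s => a m (x + (s - x 0 m) *: ebase m))
      (pdiff m (a m) (set_coord m t x)).
      exact: (@is_derive_shiftr _ R^o (fun s => a m (x + s *: ebase m)) t 1
        (- x 0 m)).
    by move=> [D' _]; exact/differentiable_continuous/derivable1_diffP.
  by exists P.
have [P PP] := choice ex.
(* The remainder estimate below needs one bound on the pure second derivatives of [a m] that is
   valid on a whole ball. *)
have [r1 r10 Mr1] : exists2 r1 : R, 0 < r1 <= r / 2 & exists M : R,
    forall y i, ball x0 r1 y -> `|pdiff i (pdiff i (a m)) y| <= M.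
  pose M := \sum_i (`|pdiff i (pdiff i (a m)) x0| + 1).
  have x0r : ball x0 r x0 by exact: ballxx.
  have H : \forall y \near x0, forall i,
      `|pdiff i (pdiff i (a m)) x0 - pdiff i (pdiff i (a m)) y| < 1.
    apply: (@filter_forall _ _ (fun i y => `|pdiff i (pdiff i (a m)) x0
      - pdiff i (pdiff i (a m)) y| < 1) (nbhs x0)) => i.
    have := smooth_continuous (smooth_pdiff i (smooth_pdiff i (sa m))) x0r.
    by move/cvgrPdist_lt; apply.
  move: H => /nbhs_ballP[r1 /= r10 H].
  exists (Num.min r1 (r / 2)); first by rewrite lt_min r10 divr_gt0//= ge_min lexx orbT.
  exists M => y i yr; apply: (@le_trans _ _ (`|pdiff i (pdiff i (a m)) x0| + 1)).
    rewrite -lerBlDl; apply: le_trans (lerB_dist _ _) _; rewrite distrC ltW//.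
    by apply: H; apply: le_ball yr; rewrite ge_min lexx.
  by rewrite /M (bigD1 i)//= lerDl; apply: sumr_ge0 => k _; exact: addr_ge0.
move: r10 Mr1 => /andP[r10 r1r] [M HM].
have r1r' : r1 <= r by apply: le_trans r1r _; rewrite ler_pdivrMr// ler_pMr// ler1n.
(* The chosen primitives [P x] for different [x] are unrelated. Evaluating [P] at the projection of
   [x] ensures that all points of a line in direction m share the same primitive. *)
exists r1, (fun x => P (set_coord m c x) (x 0 m)); split=> // x i xr1.
have xr : ball x0 r x by exact: le_ball xr1.
pose w := set_coord m c x; have wr : ball x0 r w by exact: ball_center_coord.
have coord1 y : ball x0 r1 y -> `|y 0 m - c| < r1.
  by move=> /ball_rowP[_ /(_ m)]; rewrite distrC.
have coord2 y : ball x0 r1 y -> `|y 0 m - c| < r / 2.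
  by move=> /coord1 yr; exact: lt_le_trans r1r.
have wE : set_coord m (x 0 m) w = x by rewrite /w set_coordK set_coord_id.
have [->|im] := eqVneq i m.
  rewrite subr0; apply/is_derive_line0.
  have [_ /(_ _ (coord2 _ xr1))] := PP w wr; rewrite wE => D.
  rewrite (_ : (fun s : R => _) = (fun s => P w (s + x 0 m))); last first.
    by apply/funext => s; rewrite set_coord_line addebaseE eqxx mulr1 addrC.
  by apply: (@is_derive_shiftr _ R^o (P w) 0 1 (x 0 m)); rewrite add0r.
pose K := M * r1.
have [d d0 xd] : exists2 d : R, 0 < d & forall h : R, `|h| < d ->
    ball x0 r1 (x + h *: ebase i).
  pose d := r1 - `|x0 0 i - x 0 i|.
  move/ball_rowP : (xr1) => [_ xr1i].
  exists d; first by rewrite subr_gt0.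
  move=> h hd; apply/ball_rowP; split=> // k; rewrite addebaseE.
  case: eqP => [->|_]; last by rewrite mulr0 addr0.
  rewrite mulr1 opprD addrA; apply: le_lt_trans (ler_normB _ _) _.
  by rewrite -ltrBrDl.
apply: (@is_derive_quadratic _ _ _ _ _ _ K d d0) => h hd.
have xhr1 := xd h hd.
have xhr : ball x0 r (x + h *: ebase i) by exact: le_ball xhr1.
set wh := set_coord m c (x + h *: ebase i).
have whE : wh = w + h *: ebase i by rewrite /wh set_coord_line_neq.
have whr : ball x0 r wh by exact: ball_center_coord.
have -> : (x + h *: ebase i) 0 m = x 0 m.
  by rewrite addebaseE eq_sym (negbTE im) mulr0 addr0.
rewrite -/w -/c; set t := x 0 m.
(* The error of the first-order expansion in [h] at level [s]. It vanishes at h-order one for s = c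
   up to the correction by [a i w], and by closedness its derivative in [s] is the second-order
   remainder of [a m] in direction i, hence at most M h^2. *)
pose D s := P wh s - P w s - h * a i (set_coord m s w).
have [Pwc dPw] := PP w wr; have [Pwhc dPwh] := PP wh whr.
have dD s : `|s - c| < r / 2 -> is_derive s (1 : R) D
    (a m (set_coord m s w + h *: ebase i) - a m (set_coord m s w)
      - h * pdiff i (a m) (set_coord m s w)).
  move=> sr; have sr' : `|s - c| < r.
    by apply: lt_trans sr _; rewrite ltr_pdivrMr// ltr_pMr// ltr1n.
  apply: is_derive_add; first apply: is_derive_add.
  - by have := dPwh s sr; rewrite whE set_coord_line_neq.
  - by apply: is_derive_opp; exact: dPw.
  - apply: is_derive_opp; apply: is_derive_cmul.
    rewrite ca; last exact: inr.
    have := smooth_is_derive m (sa i) (inr _ _ wr sr').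
    rewrite -[set_coord m s w]/(w + (s - w 0 m) *: ebase m) => /is_derive_line.
    exact: (@is_derive_shiftr _ R^o (fun s => a i (w + s *: ebase m)) s 1
        (- w 0 m)).
have tc := coord1 _ xr1; rewrite -/t in tc.
have seg u : 0 <= u <= 1 -> `|c + u * (t - c) - c| < r1.
  move=> /andP[u0 u1]; rewrite addrAC subrr add0r normrM ger0_norm//.
  by apply: le_lt_trans tc; rewrite ler_piMl.
have [u /seg uc|u u01 E] := @mvt_real R D (fun s =>
    a m (set_coord m s w + h *: ebase i) - a m (set_coord m s w)
      - h * pdiff i (a m) (set_coord m s w)) c t.
  by apply: dD; exact: lt_le_trans r1r.
have DE : D t - D c = P wh t - P w t - h * (a i x - a i w).
  rewrite /D Pwc Pwhc {1}/t wE /w set_coordK -/w subrr sub0r opprK mulrBr.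
  by rewrite opprB addrA [RHS]addrAC.
rewrite -DE E.
set s := c + u * (t - c) in E *.
have inr1 y : ball x0 r1 y -> ball x0 r1 (set_coord m s y).
  by move=> yr; apply: ball_set_coord; rewrite // distrC; exact: seg.
have sw1 : ball x0 r1 (set_coord m s w).
  by rewrite /w set_coordK; exact: inr1.
have sw2 : ball x0 r1 (set_coord m s w + h *: ebase i).
  rewrite -set_coord_line_neq// -whE /wh set_coordK; exact: inr1.
have -> : K * h ^+ 2 = r1 * (M * h ^+ 2) by rewrite /K -mulrA mulrCA.
rewrite normrM; apply: ler_pM => //; first exact: ltW.
have sa1 : smooth_on (ball x0 r1) (a m).
  by apply: smooth_subset (sa m) => y; exact: le_ball.
by apply: second_order sa1 _ sw1 sw2 => y /HM.
Qed.

(** The directions are integrated out one at a time, the ball shrinking at each step. *)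
Lemma poincare (a : 'I_n -> 'rV[R]_n -> R) x0 (r : R) : 0 < r ->
  closed_form (ball x0 r) a ->
  exists (r' : R) (g : 'rV[R]_n -> R), [/\ 0 < r', r' <= r,
    smooth_on (ball x0 r') g &
    forall x i, ball x0 r' x -> pdiff i g x = a i x].
Proof.
move=> r0 ha; suff [r' [g [r'0 r'r dg]]] : exists (r' : R) (g : 'rV[R]_n -> R),
    [/\ 0 < r', r' <= r &
    forall x i, ball x0 r' x -> is_derive x (ebase i) g (a i x)].
  exists r', g; split=> //; last by move=> x i xr; exact: (pdiff_eq (dg x i xr)).
  have oB : open (ball x0 r') by exact: ball_open.
  have sa i : smooth_on (ball x0 r') (a i).
    by apply: smooth_subset (ha.1 i) => y; exact: le_ball.
  (* The partial derivatives of [g] are the smooth functions [a i], so [g] together with the smooth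
     functions is closed under partial derivatives. *)
  apply: (@smooth_ratfun _ _ _ (fun F => F = g \/ smooth_on (ball x0 r') F)) => //;
    last by apply: ratfun_gen; left.
  move=> F [->|sF]; last first.
    split=> [y yr|i]; first exact: (smooth_continuous sF yr).
    exists (pdiff i F); split; last first.
      by move=> y yr; exact: (smooth_is_derive i sF yr).
    by apply: ratfun_gen; right; exact: (smooth_pdiff i sF).
  split=> [y yr|i].
    apply: (C1_continuous oB yr (fun z i => @dg z i)) => i.
    exact: (smooth_continuous (sa i) yr).
  exists (a i); split; last by move=> y; exact: dg.
  by apply: ratfun_gen; right.
(* The claim is generalised to forms whose components outside a list of indices vanish, for
   induction on the list. *)
have : forall i, i \notin enum 'I_n -> forall x, ball x0 r x -> a i x = 0.
  by move=> i; rewrite mem_enum.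
elim: (enum 'I_n) a r r0 ha => [|m l IH] a r r0 [sa ca] al.
  exists r, (fun=> 0); split=> // x i xr; rewrite al//.
  exact: is_derive_const.
have [r1 [Q [r10 r1r dQ]]] := integrate_coord m r0 (conj sa ca).
have sub : ball x0 r1 `<=` ball x0 r by exact: le_ball.
have oB : open (ball x0 r1) by exact: ball_open.
pose c := x0 0 m.
(* The form left after integrating [a m]: a pullback along [set_coord], hence again closed, with one
   more vanishing component. *)
pose a' i x := if i == m then 0 else a i (set_coord m c x).
have da' i j x : ball x0 r1 x -> is_derive x (ebase i) (a' j)
    (if (i == m) || (j == m) then 0 else pdiff i (a j) (set_coord m c x)).
  move=> xr1; rewrite /a'; have [jm|jm] := eqVneq j m.
    by rewrite orbT; exact: is_derive_const.
  have xr : ball x0 r (set_coord m c x).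
    by apply: ball_center_coord; exact: sub.
  rewrite orbF; apply: is_derive_eq.
    apply: (@is_derive_pullback _ _ _ (set_coord m c) (a j)); last first.
      exact: (smooth_is_derive i (sa j) xr).
    by move=> t; exact: set_coord_map.
  by case: eqP => _; rewrite ?mul0r ?mul1r.
have [||r2 [g [r20 r21 dg]]] := IH a' r1 r10.
- split=> [i|i j x xr1].
    rewrite /a'; case: eqP => _; first exact: smooth_cst.
    apply: smooth_pullback (sa i) => //; [exact: set_coord_map
      |exact: set_coord_continuous|].
    by move=> z /sub zr; exact: ball_center_coord.
  rewrite (pdiff_eq (da' _ _ _ xr1)) (pdiff_eq (da' _ _ _ xr1)) orbC.
  case: ifP => // _; apply: ca; apply: ball_center_coord; exact: sub.
- move=> i il x xr1; rewrite /a'; case: eqP => // /eqP im.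
  apply: al; first by rewrite inE negb_or im.
  by apply: ball_center_coord; exact: sub.
exists r2, (fun x => Q x + g x); split=> //; first exact: le_trans r21 r1r.
move=> x i xr2; have xr1 : ball x0 r1 x by exact: le_ball xr2.
apply: is_derive_eq; first exact: is_derive_add (dQ _ i xr1) (dg _ _ xr2).
by rewrite -/c -/(a' i x) subrK.
Qed.

End Poincare.

(** * Lax pairs from derivatives along the u-variables *)

Lemma ord3_distinct (i j k m : 'I_3) : i != j -> i != k -> j != k ->
  [|| m == i, m == j | m == k].
Proof. by move: i j k m => [[|[|[|i]]] //= ?] [[|[|[|j]]] //= ?] [[|[|[|k]]] //= ?]
  [[|[|[|m]]] //= ?]. Qed.

Lemma sum3 {R : realType} (f : 'I_3 -> R) i j k :
  i != j -> i != k -> j != k -> \sum_m f m = f i + f j + f k.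
Proof.
move=> ij ik jk; rewrite (bigD1 i)//= (bigD1 j) /=; last by rewrite eq_sym.
rewrite (bigD1 k) /=; last by rewrite !(eq_sym k) ik.
rewrite big1 ?addr0 ?addrA// => m /andP[/andP[mi mj] mk].
by have := ord3_distinct m ij ik jk; rewrite (negbTE mi) (negbTE mj) (negbTE mk).
Qed.

Section LaxPair.
Context {R : realType}.
Implicit Types (H : 'rV[R]_3 -> R) (z : 'rV[R]_4) (i j k : 'I_3).

Definition uix i : 'I_4 := widen_ord (leqnSn 3) i.

(** In this form [unliftP ip] splits the four directions into the u-directions and p. *)
Lemma uixE i : uix i = lift ip i.
Proof. by apply/val_inj; rewrite /= /bump leqNgt ltn_ord. Qed.

Lemma uix_inj : injective uix.
Proof. by move=> i j; rewrite !uixE; exact: lift_inj. Qed.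

Lemma ufst_line_u z t i : ufst (z + t *: ebase (uix i)) = ufst z + t *: ebase i.
Proof.
apply/rowP => j; rewrite addebaseE mxE addebaseE mxE.
by rewrite -[widen_ord _ j]/(uix j) (inj_eq uix_inj).
Qed.

Lemma ufst_line_p z t : ufst (z + t *: ebase ip) = ufst z.
Proof.
apply/rowP => j; rewrite mxE addebaseE mxE -[widen_ord _ j]/(uix j).
by rewrite uixE eq_sym (negbTE (neq_lift _ _)) mulr0 addr0.
Qed.

(** For the direction p the factor is 0, and the target index [ord0] is a dummy. *)
Lemma ufst_map : coord_map (@ufst R)
  (fun m => if unlift ip m is Some _ then 1 else 0)
  (fun m => if unlift ip m is Some i then i else ord0).
Proof.
move=> z t m; case: unliftP => [i ->|->].
  by rewrite mulr1 -uixE ufst_line_u.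
by rewrite mulr0 scale0r addr0 ufst_line_p.
Qed.

Lemma ufst_continuous : continuous (@ufst R).
Proof.
apply: continuous_rowP => i.
have -> : (fun z => ufst z 0 i) = (fun z : 'rV[R]_4 => z 0 (uix i)).
  by apply/funext => z; rewrite mxE.
exact: coord_continuous.
Qed.

Lemma is_derive_ufst_u (F : 'rV[R]_3 -> R) z i f :
  is_derive (ufst z) (ebase i) F f ->
  is_derive z (ebase (uix i)) (fun y => F (ufst y)) f.
Proof.
move=> dF; rewrite -[f]mul1r; apply: is_derive_pullback dF => t.
by rewrite mulr1 ufst_line_u.
Qed.

Lemma is_derive_ufst_p (F : 'rV[R]_3 -> R) z :
  is_derive z (ebase ip) (fun y => F (ufst y)) 0.
Proof.
apply/is_derive_line0; rewrite (_ : (fun s : R => _) = fun=> F (ufst z)).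
  exact: is_derive_const.
by apply/funext => s; rewrite ufst_line_p.
Qed.

Lemma smooth_ufst (F : 'rV[R]_3 -> R) W U : open W ->
  (forall z, W z -> U (ufst z)) -> smooth_on U F ->
  smooth_on W (fun z => F (ufst z)).
Proof.
move=> oW WU; exact: smooth_pullback oW ufst_map ufst_continuous WU.
Qed.

(* If [a i] are the derivatives of [g] along [u_i], the second half of the Lax
   equations says that [f_p + lambda^j g_p] equals [speed H a j]. *)
Definition speed H (a : 'I_3 -> 'rV[R]_4 -> R) j z :=
  - (\sum_i a i z * pdiff i (pdiff j H) (ufst z)) / a j z.

Definition lam (l1 l2 l3 : R) i := nth 0 [:: l1; l2; l3] i.

Definition u_form (a : 'I_3 -> 'rV[R]_4 -> R) (b : 'rV[R]_4 -> R) (m : 'I_4) :=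
  if unlift ip m is Some i then a i else b.

Lemma u_form_u a b i : u_form a b (uix i) = a i.
Proof. by rewrite /u_form uixE liftK. Qed.

Lemma u_form_p a b : u_form a b ip = b.
Proof. by rewrite /u_form unlift_none. Qed.

Lemma u_form_closed W a b :
  (forall i, smooth_on W (a i)) -> smooth_on W b ->
  (forall i j z, i != j -> W z -> pdiff (uix i) (a j) z = 0) ->
  (forall i z, W z -> pdiff (uix i) b z = pdiff ip (a i) z) ->
  closed_form W (u_form a b).
Proof.
move=> sa sb aij bi; split=> [m|m m' z Wz].
  case: (unliftP ip m) => [i ->|->]; last by rewrite u_form_p.
  by rewrite -uixE u_form_u.
case: (unliftP ip m) => [i ->|->]; case: (unliftP ip m') => [j ->|->] //.
- rewrite -!uixE !u_form_u.
  by have [->//|ij] := eqVneq i j; rewrite !aij// eq_sym.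
- by rewrite -uixE u_form_p u_form_u bi.
- by rewrite -uixE u_form_p u_form_u bi.
Qed.

Lemma speed_smooth H U B (a : 'I_3 -> 'rV[R]_4 -> R) j : open B ->
  smooth_on U H -> (forall z, B z -> U (ufst z)) ->
  (forall i, smooth_on B (a i)) -> (forall i z, B z -> a i z != 0) ->
  smooth_on B (speed H a j).
Proof.
move=> oB sH BU sa a0.
have -> : speed H a j = (fun z =>
  - (a i1 z * pdiff i1 (pdiff j H) (ufst z) + a i2 z * pdiff i2 (pdiff j H) (ufst z)
   + a i3 z * pdiff i3 (pdiff j H) (ufst z)) * (a j z)^-1).
  by apply/funext => z; rewrite /speed (sum3 _ (i := i1) (j := i2) (k := i3)).
have sH2 i : smooth_on B (fun z => pdiff i (pdiff j H) (ufst z)).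
  exact: (smooth_ufst oB BU (smooth_pdiff i (smooth_pdiff j sH))).
apply: (smoothM oB); last exact: (smoothV oB (sa j) (a0 j)).
apply: (smoothN oB); apply: (smoothD oB); last exact: (smoothM oB (sa i3) (sH2 i3)).
exact: (smoothD oB (smoothM oB (sa i1) (sH2 i1)) (smoothM oB (sa i2) (sH2 i2))).
Qed.

(** The linear relation lets the three speeds be written as F + lambda^j G. The hypotheses on the
    derivatives then make the forms with components (a_i; G) and (- lambda^i a_i; F) closed, and
    their primitives are g and f. *)
Lemma lax_pair_of_speeds (l1 l2 l3 : R) H U z0 (r : R)
    (a : 'I_3 -> 'rV[R]_4 -> R) :
  l1 != l2 -> 0 < r -> smooth_on U H ->
  (forall z, ball z0 r z -> U (ufst z)) ->
  (forall i, smooth_on (ball z0 r) (a i)) ->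
  (forall i z, ball z0 r z -> a i z != 0) ->
  (forall i j z, i != j -> ball z0 r z -> pdiff (uix i) (a j) z = 0) ->
  (forall i j z, ball z0 r z -> is_derive z (ebase (uix i)) (speed H a j)
     ((lam l1 l2 l3 j - lam l1 l2 l3 i) * pdiff ip (a i) z)) ->
  (forall z, ball z0 r z ->
     (l2 - l3) * speed H a i1 z + (l3 - l1) * speed H a i2 z
     + (l1 - l2) * speed H a i3 z = 0) ->
  has_dispersionless_Lax_pair l1 l2 l3 H U.
Proof.
move=> l12 r0 sH BU sa a0 aij dS S0; set B := ball z0 r.
have l12' : l1 - l2 != 0 by rewrite subr_eq0.
have oB : open B by exact: ball_open.
have sS j : smooth_on B (speed H a j) by exact: (speed_smooth j oB sH BU sa a0).
(* [F] and [G] solve the equations for the first two speeds; the third is then the linear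
   relation. *)
pose G z := (l1 - l2)^-1 * (speed H a i1 z - speed H a i2 z).
pose F z := speed H a i1 z - l1 * G z.
have sG : smooth_on B G.
  apply: (smoothM oB (smooth_cst _ oB)).
  exact: (smoothD oB (sS i1) (smoothN oB (sS i2))).
have sF : smooth_on B F.
  exact: (smoothD oB (sS i1) (smoothN oB (smoothM oB (smooth_cst l1 oB) sG))).
have dG i z : B z -> is_derive z (ebase (uix i)) G (pdiff ip (a i) z).
  move=> Bz; apply: is_derive_eq.
    apply: is_derive_cmul; apply: is_derive_add; first exact: dS.
    by apply: is_derive_opp; exact: dS.
  by rewrite /lam /=; field.
have dF i z : B z ->
    is_derive z (ebase (uix i)) F (- lam l1 l2 l3 i * pdiff ip (a i) z).
  move=> Bz; apply: is_derive_eq.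
    apply: is_derive_add; first exact: dS.
    by apply: is_derive_opp; apply: is_derive_cmul; exact: dG.
  by rewrite /lam /=; ring.
have SE j z : B z -> speed H a j z = F z + lam l1 l2 l3 j * G z.
  move=> Bz; have := S0 z Bz; rewrite /F /G.
  have /or3P[] := @ord3_distinct i1 i2 i3 j isT isT isT => /eqP->; rewrite /lam /=.
  - by move=> _; ring.
  - by move=> _; field.
  - move=> E; apply: (mulfI l12').
    apply: (addrI ((l2 - l3) * speed H a i1 z + (l3 - l1) * speed H a i2 z)).
    by rewrite E; field.
pose b i z := - lam l1 l2 l3 i * a i z.
have sb i : smooth_on B (b i) by exact: (smoothM oB (smooth_cst _ oB) (sa i)).
have db i m z : B z -> is_derive z (ebase m) (b i) (- lam l1 l2 l3 i * pdiff m (a i) z).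
  by move=> Bz; apply: is_derive_cmul; exact: (smooth_is_derive _ (sa i) Bz).
have [|rg [g [rg0 rgr sg gP]]] := @poincare R 4 (u_form a G) z0 r r0.
  by apply: u_form_closed => // i z Bz; exact: (pdiff_eq (dG i z Bz)).
have [|rf [f [rf0 rfr sf fP]]] := @poincare R 4 (u_form b F) z0 r r0.
  apply: u_form_closed => // [i j z ij Bz|i z Bz].
    by rewrite (pdiff_eq (db j (uix i) z Bz)) aij// mulr0.
  by rewrite (pdiff_eq (dF i z Bz)) (pdiff_eq (db i ip z Bz)).
pose s := Num.min rg rf.
have s0 : 0 < s by rewrite lt_min rg0.
have sg' : ball z0 s `<=` ball z0 rg by apply: le_ball; rewrite ge_min lexx.
have sf' : ball z0 s `<=` ball z0 rf by apply: le_ball; rewrite ge_min lexx orbT.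
have sB : ball z0 s `<=` B by move=> z /sg'; exact: le_ball.
have gradg z : ball z0 s z -> gradu g z = \row_i a i z.
  move=> /sg' zs; apply/rowP => i; rewrite !mxE -[widen_ord _ i]/(uix i) gP//.
  by rewrite u_form_u.
have gradf z : ball z0 s z -> gradu f z = \row_i b i z.
  move=> /sf' zs; apply/rowP => i; rewrite !mxE -[widen_ord _ i]/(uix i) fP//.
  by rewrite u_form_u.
have zs : ball z0 s z0 by exact: ballxx.
exists (ball z0 s), f, g; split; first exact: ball_open.
split; first by exists z0.
split; first by move=> z /sB/BU.
split; first exact: smooth_subset sf.
split; first exact: smooth_subset sg.
split; [|split].
- move=> z Bz; rewrite gradg// gradf//; apply/rowP => i.
  by rewrite mul_mx_diag !mxE /b mulNr mulrC addNr.
- move=> z Bz; rewrite gradg// /dp gP; last exact: sg'.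
  rewrite fP ?u_form_p; last exact: sf'.
  apply/rowP => j; rewrite !mxE.
  have -> : \sum_k (\row_i a i z) 0 k * (F z *: 1%:M + G z *: Amx l1 l2 l3
      + Bmx H (ufst z)) k j = \sum_k ((a k z * (F z + lam l1 l2 l3 j * G z)) *+ (k == j)
      + a k z * pdiff k (pdiff j H) (ufst z)).
    apply: eq_bigr => k _; rewrite !mxE; have [->|_] := eqVneq k j.
      by rewrite !mulr1n /lam; ring.
    by rewrite !mulr0n; ring.
  rewrite big_split /= (bigD1 j)//= eqxx mulr1n big1 ?addr0; last first.
    by move=> k /negbTE->.
  by rewrite -(SE j z (sB _ Bz)) /speed mulrC divfK ?addNr// a0//; exact: sB.
- exists z0 => //; rewrite gradg//; apply/eqP => /rowP/(_ i1).
  by rewrite !mxE => /eqP; rewrite (negbTE (a0 i1 z0 (sB _ zs))).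
Qed.
End LaxPair.

(** * Consequences of the integrability conditions *)

(** A rotation and a transposition generate the symmetric group, so an invariant condition has to be
    checked for one triple only. *)
Lemma distinct3_perm (P : 'I_3 -> 'I_3 -> 'I_3 -> Prop) :
  (forall i j k, P i j k -> P j k i) -> (forall i j k, P i j k -> P i k j) ->
  forall i j k, i != j -> i != k -> j != k -> P i j k ->
  forall i' j' k', i' != j' -> i' != k' -> j' != k' -> P i' j' k'.
Proof.
move=> Prot Pswap i j k ij ik jk Pijk i' j' k' ij' ik' jk'.
move: ij' ik' jk'.
have /or3P[] := ord3_distinct i' ij ik jk => /eqP->;
  have /or3P[] := ord3_distinct j' ij ik jk => /eqP->;
  have /or3P[] := ord3_distinct k' ij ik jk => /eqP->; rewrite ?eqxx // => _ _ _.
- exact: Pswap.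
- exact/Pswap/Prot.
- exact: Prot.
- exact/Prot/Prot.
- exact/Pswap/Prot/Prot.
Qed.

(* A locked copy of [pdiff]: otherwise failing unifications between different
   partial derivatives unfold the definition of the derivative as a limit. *)
HB.lock Definition pd {R : realType} {n : nat} (i : 'I_n) (F : 'rV[R]_n -> R)
  : 'rV[R]_n -> R := pdiff i F.

Section LockedPartials.
Context {R : realType} {n : nat}.
Implicit Types (W : set 'rV[R]_n) (F G : 'rV[R]_n -> R) (x : 'rV[R]_n).

Lemma pdE i F x : pd i F x = pdiff i F x.
Proof. by rewrite pd.unlock. Qed.

Lemma pd_val F x i f : is_derive x (ebase i) F f -> pd i F x = f.
Proof. by rewrite pdE; exact: pdiff_eq. Qed.

Lemma pd_is_derive W F x i : smooth_on W F -> W x ->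
  is_derive x (ebase i) F (pd i F x).
Proof. by rewrite pdE; exact: smooth_is_derive. Qed.

Lemma pd_smooth W F i : smooth_on W F -> smooth_on W (pd i F).
Proof. by rewrite pd.unlock; exact: smooth_pdiff. Qed.

Lemma pd_comm W F x i j : open W -> smooth_on W F -> W x ->
  pd i (pd j F) x = pd j (pd i F) x.
Proof. by rewrite pd.unlock; exact: pdiff_comm. Qed.

Lemma pd_eq_on W F G x i :
  open W -> W x -> (forall y, W y -> F y = G y) -> pd i F x = pd i G x.
Proof.
move=> oW Wx FG; rewrite !pdE; apply: near_eq_derive.
by apply: filterS (open_nbhs_nbhs (conj oW Wx)).
Qed.

End LockedPartials.

Section Integrability.
Context {R : realType}.
Implicit Types (L : 'I_3 -> R) (H : 'rV[R]_3 -> R) (i j k : 'I_3) (x : 'rV[R]_3).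

Definition hess H i j := pd i (pd j H).

(* [ratio H i j k] is [R_k] up to the factor [lambda^i - lambda^j]. *)
Definition ratio H i j k x := hess H i k x * hess H j k x / hess H i j x.

Section Hessian.
Variables (H : 'rV[R]_3 -> R) (U : set 'rV[R]_3).
Hypotheses (oU : open U) (sH : smooth_on U H).

Lemma hess_smooth i j : smooth_on U (hess H i j).
Proof. exact: (pd_smooth i (pd_smooth j sH)). Qed.

Lemma hess_sym i j x : U x -> hess H i j x = hess H j i x.
Proof. exact: (pd_comm i j oU sH). Qed.

Lemma hess_d i j m x : U x ->
  is_derive x (ebase m) (hess H i j) (pd m (hess H i j) x).
Proof. by move=> Ux; exact: (pd_is_derive m (hess_smooth i j) Ux). Qed.

Lemma dhess_sym i j m x : U x ->
  pd m (hess H i j) x = pd m (hess H j i) x.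
Proof. by move=> Ux; apply: pd_eq_on oU Ux _ => y; exact: hess_sym. Qed.

Lemma dhess_comm i j m x : U x ->
  pd m (hess H i j) x = pd i (hess H m j) x.
Proof. exact: (pd_comm m i oU (pd_smooth j sH)). Qed.

Lemma ratio_sym i j k x : U x -> ratio H i j k x = ratio H j i k x.
Proof.
move=> Ux; rewrite /ratio (hess_sym i j Ux).
by move: (hess H i k x) (hess H j k x) => a b; rewrite (mulrC a).
Qed.

Lemma dratio_sym i j k m x : U x ->
  pd m (ratio H i j k) x = pd m (ratio H j i k) x.
Proof. by move=> Ux; apply: pd_eq_on oU Ux _ => y; exact: ratio_sym. Qed.

End Hessian.

(** The hypotheses of the theorem in a form available for every ordering of the indices. Dividing J
    = 0 by H12 H13 H23 gives [itg_J]. *)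
Record integrable L H (U : set 'rV[R]_3) : Prop := Integrable {
  itg_open : open U;
  itg_smooth : smooth_on U H;
  itg_neq0 : forall i j x, i != j -> U x -> hess H i j x != 0;
  itg_123 : forall i j k x, i != j -> i != k -> j != k -> U x ->
    pd i (hess H j k) x = 0;
  itg_J : forall i j k x, i != j -> i != k -> j != k -> U x ->
    (L j - L k) * hess H i i x + (L k - L i) * hess H j j x
      + (L i - L j) * hess H k k x =
    (L j - L k) * ratio H j k i x + (L k - L i) * ratio H k i j x
      + (L i - L j) * ratio H i j k x;
  itg_iii : forall i j k x, i != j -> i != k -> j != k -> U x ->
    (L j - L k) * pd i (hess H i i) x =
    (L k - L i) * pd i (ratio H k i j) x + (L i - L j) * pd i (ratio H i j k) x }.

Section Consequences.
Variables (L : 'I_3 -> R) (H : 'rV[R]_3 -> R) (U : set 'rV[R]_3).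
Hypotheses (iH : integrable L H U).

Let oU : open U := itg_open iH.
Let sH : smooth_on U H := itg_smooth iH.

Lemma ratio_smooth i j k : i != j -> smooth_on U (ratio H i j k).
Proof.
move=> ij; apply: (smoothM oU).
  exact: (smoothM oU (hess_smooth sH i k) (hess_smooth sH j k)).
by apply: (smoothV oU (hess_smooth sH i j)) => x Ux; exact: (itg_neq0 iH ij Ux).
Qed.

Lemma dratio_side i j k x : i != j -> i != k -> j != k -> U x ->
  pd i (ratio H i j k) x = hess H j k x *
  (pd i (hess H i k) x * hess H i j x - hess H i k x * pd i (hess H i j) x)
    / hess H i j x ^+ 2.
Proof.
move=> ij ik jk Ux; have h0 := itg_neq0 iH ij Ux; apply: pd_val.
apply: is_derive_eq.
  apply: is_derive_mul; first by apply: is_derive_mul; exact: (hess_d sH).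
  by apply: is_derive_inv => //; exact: (hess_d sH).
rewrite (itg_123 iH ij ik jk Ux); move: h0.
move: (hess H i j x) (hess H j k x) (hess H i k x) (pd i (hess H i k) x)
  (pd i (hess H i j) x); clear=> a b c d e a0; by field.
Qed.

Lemma dratio_top i j k x : i != j -> i != k -> j != k -> U x ->
  pd k (ratio H i j k) x = (pd k (hess H i k) x * hess H j k x
    + hess H i k x * pd k (hess H j k) x) / hess H i j x.
Proof.
move=> ij ik jk Ux; have h0 := itg_neq0 iH ij Ux; apply: pd_val.
apply: is_derive_eq.
  apply: is_derive_mul; first by apply: is_derive_mul; exact: (hess_d sH).
  by apply: is_derive_inv => //; exact: (hess_d sH).
have -> : pd k (hess H i j) x = 0 by apply: (itg_123 iH) => //; rewrite eq_sym.
move: h0; move: (hess H i j x) (hess H j k x) (hess H i k x)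
  (pd k (hess H i k) x) (pd k (hess H j k) x); clear=> a b c d e a0.
by field.
Qed.

(* Differentiate the condition [J = 0] and use the formula for [H_iii]. *)
Lemma itg_top i j k x : i != j -> i != k -> j != k -> U x ->
  (L j - L k) * pd i (ratio H j k i) x =
  (L k - L i) * pd j (hess H i j) x + (L i - L j) * pd k (hess H i k) x.
Proof.
move=> ij ik jk Ux.
have ki : k != i by rewrite eq_sym.
have E : pd i (fun y => (L j - L k) * hess H i i y + (L k - L i) * hess H j j y
      + (L i - L j) * hess H k k y) x =
    pd i (fun y => (L j - L k) * ratio H j k i y + (L k - L i) * ratio H k i j y
      + (L i - L j) * ratio H i j k y) x.
  by apply: pd_eq_on oU Ux _ => y; exact: (itg_J iH).
have dr a b c : a != b ->
    is_derive x (ebase i) (ratio H a b c) (pd i (ratio H a b c) x).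
  by move=> ab; exact: (pd_is_derive i (ratio_smooth c ab) Ux).
rewrite (pd_val (is_derive_add (is_derive_add
  (is_derive_cmul (L j - L k) (hess_d sH i i i Ux))
  (is_derive_cmul (L k - L i) (hess_d sH j j i Ux)))
  (is_derive_cmul (L i - L j) (hess_d sH k k i Ux)))) in E.
rewrite (pd_val (is_derive_add (is_derive_add
  (is_derive_cmul (L j - L k) (dr _ _ i jk))
  (is_derive_cmul (L k - L i) (dr _ _ j ki)))
  (is_derive_cmul (L i - L j) (dr _ _ k ij)))) in E.
rewrite (itg_iii iH ij ik jk Ux) (dhess_comm oU sH j j i Ux) (dhess_comm oU sH k k i Ux) in E.
move: E; move: (pd i (ratio H j k i) x) (pd i (ratio H k i j) x)
  (pd i (ratio H i j k) x) (pd j (hess H i j) x) (pd k (hess H i k) x).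
clear=> a b c d e E; lra.
Qed.

(** This is [itg_top] with the derivative carried out: H_jk does not depend on u_i, so only the
    numerator of the ratio contributes. *)
Lemma itg_prod_i i j k x : i != j -> i != k -> j != k -> U x ->
  (L j - L k) * (pd i (hess H i j) x * hess H i k x
    + hess H i j x * pd i (hess H i k) x) =
  hess H j k x * ((L k - L i) * pd j (hess H i j) x
    + (L i - L j) * pd k (hess H i k) x).
Proof.
move=> ij ik jk Ux; have ji : j != i by rewrite eq_sym.
have ki : k != i by rewrite eq_sym.
have := itg_top ij ik jk Ux.
rewrite (dratio_top jk ji ki Ux) (hess_sym oU sH j i Ux) (hess_sym oU sH k i Ux).
rewrite (dhess_sym oU sH j i i Ux) (dhess_sym oU sH k i i Ux) => <-.
have := itg_neq0 iH jk Ux.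
move: (hess H j k x) (hess H i j x) (hess H i k x) (pd i (hess H i j) x)
  (pd i (hess H i k) x) => a b c d e a0.
by field.
Qed.

Lemma itg_prod_j i j k x : i != j -> i != k -> j != k -> U x ->
  (L k - L i) * (pd j (hess H i j) x * hess H j k x
    + hess H i j x * pd j (hess H j k) x) =
  hess H i k x * ((L i - L j) * pd k (hess H j k) x
    + (L j - L k) * pd i (hess H i j) x).
Proof.
move=> ij ik jk Ux; have ji : j != i by rewrite eq_sym.
have ki : k != i by rewrite eq_sym. have kj : k != j by rewrite eq_sym.
have := itg_top jk ji ki Ux.
rewrite (dratio_top ki kj ij Ux) (hess_sym oU sH k j Ux) (hess_sym oU sH k i Ux).
rewrite (dhess_sym oU sH k j j Ux) (dhess_sym oU sH j i i Ux) => <-.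
have := itg_neq0 iH ik Ux.
move: (hess H j k x) (hess H i j x) (hess H i k x) (pd j (hess H i j) x)
  (pd j (hess H j k) x) => a b c d e c0.
by field.
Qed.

(** Differentiate the formula for H_iii in u_j, and [itg_top] for the index j in u_i. The fourth
    derivative H_iiij and the mixed derivative of [ratio H k i j] occur in both and cancel. *)
Lemma itg_mixed i j k x : i != j -> i != k -> j != k -> L i != L j -> U x ->
  pd j (pd i (ratio H i j k)) x = 0.
Proof.
move=> ij ik jk Lij Ux.
have ki : k != i by rewrite eq_sym.
have kj : k != j by rewrite eq_sym.
have ji : j != i by rewrite eq_sym.
have Lij0 : L i - L j != 0 by rewrite subr_eq0.
have sh a b c := pd_smooth c (hess_smooth sH a b).
have sr a b c m (ab : a != b) := pd_smooth m (ratio_smooth c ab).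
have E1 : pd j (fun y => (L j - L k) * pd i (hess H i i) y) x =
    pd j (fun y => (L k - L i) * pd i (ratio H k i j) y
      + (L i - L j) * pd i (ratio H i j k) y) x.
  by apply: pd_eq_on oU Ux _ => y; exact: (itg_iii iH).
rewrite (pd_val (is_derive_cmul _ (pd_is_derive j (sh _ _ _) Ux))) in E1.
rewrite (pd_val (is_derive_add
  (is_derive_cmul _ (pd_is_derive j (sr _ _ j i ki) Ux))
  (is_derive_cmul _ (pd_is_derive j (sr _ _ k i ij) Ux)))) in E1.
have E2 : pd i (fun y => (L k - L i) * pd j (ratio H k i j) y) x =
    pd i (fun y => (L i - L j) * pd k (hess H j k) y
      + (L j - L k) * pd i (hess H j i) y) x.
  by apply: pd_eq_on oU Ux _ => y; exact: itg_top.
rewrite (pd_val (is_derive_cmul _ (pd_is_derive i (sr _ _ j j ki) Ux))) in E2.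
rewrite (pd_val (is_derive_add
  (is_derive_cmul _ (pd_is_derive i (sh _ _ _) Ux))
  (is_derive_cmul _ (pd_is_derive i (sh _ _ _) Ux)))) in E2.
have Z : pd i (pd k (hess H j k)) x = 0.
  rewrite (pd_comm i k oU (hess_smooth sH j k) Ux).
  rewrite (@pd_eq_on _ _ U _ (fun=> 0) x k oU Ux); last first.
    by move=> y; exact: (itg_123 iH).
  by rewrite (pd_val (is_derive_const _ _ _)).
rewrite (pd_comm i j oU (ratio_smooth j ki) Ux) Z in E2.
have E3 : pd j (pd i (hess H i i)) x = pd i (pd i (hess H j i)) x.
  rewrite (pd_comm j i oU (hess_smooth sH i i) Ux).
  by apply: pd_eq_on oU Ux _ => y Uy; exact: (dhess_comm oU sH).
rewrite E3 in E1; apply: (mulfI Lij0); rewrite mulr0.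
move: E1 E2; move: (pd j (pd i (ratio H i j k)) x)
  (pd j (pd i (ratio H k i j)) x) (pd i (pd i (hess H j i)) x).
clear=> a b c E1 E2; lra.
Qed.

End Consequences.
End Integrability.

(** * Solutions on the conic *)

Lemma is_derive_invM {R : realType} {V : normedModType R} (F G : V -> R) x v f g :
  F x != 0 -> G x != 0 -> is_derive x v F f -> is_derive x v G g ->
  is_derive x v (fun y => (F y * G y)^-1) (- (f * G x + F x * g) / (F x * G x) ^+ 2).
Proof.
move=> F0 G0 dF dG; apply: (is_derive_inv _ (is_derive_mul dF dG)).
exact: mulf_neq0.
Qed.

(** Modulo J = 0 the weighted sum of the speeds is minus the product of the line x h2 h3 + y h1 h3 +
    z h1 h2 and the conic: the splitting of the cubic. *)
Lemma conic_speed_sum {R : realType} (al be ga h1 h2 h3 x y z H1 H2 H3 : R) :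
  h1 != 0 -> h2 != 0 -> h3 != 0 -> x != 0 -> y != 0 -> z != 0 ->
  al / (h1 * x) + be / (h2 * y) + ga / (h3 * z) = 0 ->
  al * H1 + be * H2 + ga * H3 =
    al * (h3 * h2 / h1) + be * (h1 * h3 / h2) + ga * (h2 * h1 / h3) ->
  al * (- H1 - (y * h3 + z * h2) / x) + be * (- H2 - (z * h1 + x * h3) / y)
    + ga * (- H3 - (x * h2 + y * h1) / z) = 0.
Proof.
move=> h10 h20 h30 x0 y0 z0 C J.
have E : al * (h3 * h2 / h1) + be * (h1 * h3 / h2) + ga * (h2 * h1 / h3)
   + al * ((y * h3 + z * h2) / x) + be * ((z * h1 + x * h3) / y)
   + ga * ((x * h2 + y * h1) / z) =
   (x * h2 * h3 + y * h1 * h3 + z * h1 * h2) *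
   (al / (h1 * x) + be / (h2 * y) + ga / (h3 * z)).
  by field; rewrite h10 h20 h30 x0 y0 z0.
rewrite C mulr0 -J in E; rewrite -[RHS]oppr0 -E; ring.
Qed.

(** The derivative of the speed is a combination of the formula for H_iii, the conic and the
    u_i-derivative of the conic; the middle expression of the proof displays the multipliers. *)
Lemma conic_speed_diag {R : realType} (al be ga h1 h2 h3 h21 h31 x y z x1 D : R) :
  al != 0 -> h1 != 0 -> h2 != 0 -> h3 != 0 -> x != 0 -> y != 0 -> z != 0 ->
  al / (h1 * x) + be / (h2 * y) + ga / (h3 * z) = 0 ->
  0 = al * (- (0 * x + h1 * x1) / (h1 * x) ^+ 2)
    + be * (- (h21 * y + h2 * 0) / (h2 * y) ^+ 2)
    + ga * (- (h31 * z + h3 * 0) / (h3 * z) ^+ 2) ->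
  al * D = be * (h1 * (h31 * h2 - h3 * h21) / h2 ^+ 2)
    + ga * (h1 * (h21 * h3 - h2 * h31) / h3 ^+ 2) ->
  - D + - ((0 * h3 + y * h31 + (0 * h2 + z * h21)) * x^-1
    + (y * h3 + z * h2) * (- x1 / x ^+ 2)) = 0.
Proof.
move=> al0 h10 h20 h30 x0 y0 z0 C C1 ED; apply: (mulfI al0).
transitivity (- (al * D) + (be * (h1 * (h31 * h2 - h3 * h21) / h2 ^+ 2)
    + ga * (h1 * (h21 * h3 - h2 * h31) / h3 ^+ 2))
  - h1 * (y * h31 + z * h21) * (al / (h1 * x) + be / (h2 * y) + ga / (h3 * z))
  - h1 * (y * h3 + z * h2) * (al * (- (0 * x + h1 * x1) / (h1 * x) ^+ 2)
    + be * (- (h21 * y + h2 * 0) / (h2 * y) ^+ 2)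
    + ga * (- (h31 * z + h3 * 0) / (h3 * z) ^+ 2))).
  by field; rewrite h10 h20 h30 x0 y0 z0.
by rewrite C -C1 ED !mulr0 !subr0 addNr.
Qed.

Section Conic.
Context {R : realType}.
Variables (L : 'I_3 -> R) (H : 'rV[R]_3 -> R) (U : set 'rV[R]_3).
Hypothesis iH : integrable L H U.
Hypothesis Linj : injective L.
Variables (B : set 'rV[R]_4) (a : 'I_3 -> 'rV[R]_4 -> R).
Hypotheses (oB : open B) (BU : forall z, B z -> U (ufst z)).
Hypothesis sa : forall i, smooth_on B (a i).
Hypothesis a0 : forall i z, B z -> a i z != 0.
Hypothesis aij : forall i j z, i != j -> B z -> pd (uix i) (a j) z = 0.

Let oU : open U := itg_open iH.
Let sH : smooth_on U H := itg_smooth iH.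
Let hs i j z := hess H i j (ufst z).

Definition conic i j k z := (L j - L k) / (hs j k z * a i z)
  + (L k - L i) / (hs i k z * a j z) + (L i - L j) / (hs i j z * a k z).

Let L0 i j : i != j -> L i - L j != 0.
Proof. by move=> ij; rewrite subr_eq0 (inj_eq Linj). Qed.

Let hs0 i j z : i != j -> B z -> hs i j z != 0.
Proof. by move=> ij Bz; exact: (itg_neq0 iH ij (BU Bz)). Qed.

Let hs_sym i j z : B z -> hs i j z = hs j i z.
Proof. by move=> Bz; exact: (hess_sym oU sH i j (BU Bz)). Qed.

Lemma conic_perm i j k : i != j -> i != k -> j != k ->
  (forall z, B z -> conic i j k z = 0) ->
  forall i' j' k', i' != j' -> i' != k' -> j' != k' ->
  forall z, B z -> conic i' j' k' z = 0.
Proof.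
move=> ij ik jk C; apply: (@distinct3_perm
  (fun i j k => forall z, B z -> conic i j k z = 0) _ _ _ _ _ ij ik jk C).
- move=> i' j' k' C' z Bz; rewrite -(C' z Bz) /conic.
  rewrite (hs_sym k' i' Bz) (hs_sym j' i' Bz).
  move: (hs j' k' z * a i' z) (hs i' k' z * a j' z) (hs i' j' z * a k' z).
  by move=> x y t; ring.
- move=> i' j' k' C' z Bz; rewrite -[RHS]oppr0 -(C' z Bz) /conic.
  rewrite (hs_sym k' j' Bz).
  move: (hs j' k' z * a i' z) (hs i' k' z * a j' z) (hs i' j' z * a k' z).
  by move=> x y t; ring.
Qed.

Lemma speedE i j k z : i != j -> i != k -> j != k -> B z ->
  speed H a i z = - hs i i z - (a j z * hs i j z + a k z * hs i k z) / a i z.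
Proof.
move=> ij ik jk Bz; rewrite /speed (sum3 _ ij ik jk).
have hE m : pdiff m (pdiff i H) (ufst z) = hs m i z by rewrite /hs /hess !pd.unlock.
rewrite !hE (hs_sym i j Bz) (hs_sym i k Bz).
move: (a0 i Bz); move: (a i z) (a j z) (a k z) (hs i i z) (hs j i z) (hs k i z).
by move=> x y t p q s x0; field.
Qed.

Hypothesis conic0 : forall i j k z, i != j -> i != k -> j != k -> B z ->
  conic i j k z = 0.

Lemma speed_sum0 i j k z : i != j -> i != k -> j != k -> B z ->
  (L j - L k) * speed H a i z + (L k - L i) * speed H a j z
    + (L i - L j) * speed H a k z = 0.
Proof.
move=> ij ik jk Bz.
have ji : j != i by rewrite eq_sym. have ki : k != i by rewrite eq_sym.
have kj : k != j by rewrite eq_sym.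
rewrite (speedE ij ik jk Bz) (speedE jk ji ki Bz) (speedE ki kj ij Bz).
rewrite (hs_sym j i Bz) (hs_sym k i Bz) (hs_sym k j Bz).
apply: conic_speed_sum; rewrite ?a0 ?hs0//; first exact: conic0.
have := itg_J iH ij ik jk (BU Bz); rewrite /ratio -!/(hs _ _ z) => ->.
by rewrite (hs_sym j i Bz) (hs_sym k i Bz) (hs_sym k j Bz).
Qed.

Let dhs i j m z : B z ->
  is_derive z (ebase (uix m)) (hs i j) (pd m (hess H i j) (ufst z)).
Proof. by move=> Bz; exact: (is_derive_ufst_u (hess_d sH i j m (BU Bz))). Qed.

Let da i j z : i != j -> B z -> is_derive z (ebase (uix i)) (a j) 0.
Proof.
by move=> ij Bz; rewrite -(aij ij Bz); exact: (pd_is_derive _ (sa j) Bz).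
Qed.

Lemma speed_d_diag i j k z : i != j -> i != k -> j != k -> B z ->
  is_derive z (ebase (uix i)) (speed H a i) 0.
Proof.
move=> ij ik jk Bz.
have ji : j != i by rewrite eq_sym. have ki : k != i by rewrite eq_sym.
have kj : k != j by rewrite eq_sym.
have dai := pd_is_derive (uix i) (sa i) Bz.
have hjk : is_derive z (ebase (uix i)) (hs j k) 0.
  by have := dhs j k i Bz; rewrite (itg_123 iH ij ik jk (BU Bz)).
have C1 : is_derive z (ebase (uix i)) (conic i j k) 0.
  apply: (is_derive_eq_on oB Bz _ (is_derive_const z _ 0)) => y By.
  by rewrite conic0.
have C1' := is_derive_unique C1 (is_derive_add (is_derive_add
  (is_derive_cmul (L j - L k) (is_derive_invM (hs0 jk Bz) (a0 i Bz)
    hjk dai))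
  (is_derive_cmul (L k - L i) (is_derive_invM (hs0 ik Bz) (a0 j Bz)
    (dhs i k i Bz) (da ij Bz))))
  (is_derive_cmul (L i - L j) (is_derive_invM (hs0 ij Bz) (a0 k Bz)
    (dhs i j i Bz) (da ik Bz)))).
have D := is_derive_add (is_derive_opp (dhs i i i Bz))
  (is_derive_opp (is_derive_mul (is_derive_add
  (is_derive_mul (da ij Bz) (dhs i j i Bz)) (is_derive_mul (da ik Bz) (dhs i k i Bz)))
    (is_derive_inv (a0 i Bz) dai))).
apply: (is_derive_eq_on oB Bz (F := fun y => - hs i i y +
   - ((a j y * hs i j y + a k y * hs i k y) * (a i y)^-1))).
  by move=> y By; rewrite (speedE ij ik jk By).
apply: (is_derive_eq D).
have ED := itg_iii iH ij ik jk (BU Bz).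
rewrite (dratio_sym oU sH _ _ _ i (BU Bz)) (dratio_side iH ik ij kj (BU Bz)) in ED.
rewrite (dratio_side iH ij ik jk (BU Bz)) in ED.
rewrite (hess_sym oU sH k j (BU Bz)) -!/(hs _ _ z) in ED.
exact: (conic_speed_diag (L0 jk) (hs0 jk Bz) (hs0 ik Bz) (hs0 ij Bz) (a0 i Bz)
  (a0 j Bz) (a0 k Bz) (conic0 ij ik jk Bz) C1' ED).
Qed.

Hypothesis rel : forall i, exists2 j, j != i & forall z, B z ->
  is_derive z (ebase (uix i)) (speed H a j) ((L j - L i) * pd ip (a i) z).

(** For fixed i the equation j = i is [speed_d_diag], one of the others is [rel], and the last one
    results from differentiating [speed_sum0] along u_i. *)
Lemma speed_d i j z : B z ->
  is_derive z (ebase (uix i)) (speed H a j) ((L j - L i) * pd ip (a i) z).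
Proof.
move=> Bz; have [m mi dm] := rel i.
have [k [ki km]] : exists k, k != i /\ k != m.
  have /andP[] : (i1 != i2) && (i1 != i3) by [].
  by move: (i) (m) => [[|[|[|?]]] //= ?] [[|[|[|?]]] //= ?];
    [exists i2|exists i3|exists i2|exists i3|exists i3|exists i1|exists i2|exists i1
     |exists i1].
have im : i != m by rewrite eq_sym. have ik : i != k by rewrite eq_sym.
have mk : m != k by rewrite eq_sym.
have /or3P[] := ord3_distinct j im ik mk => /eqP->.
- by rewrite subrr mul0r; exact: (speed_d_diag im ik mk Bz).
- exact: dm.
have dk := smooth_is_derive (uix i) (speed_smooth k oB sH BU sa a0) Bz.
apply: (is_derive_eq dk).
have Z : is_derive z (ebase (uix i)) (fun y => (L m - L k) * speed H a i y
    + (L k - L i) * speed H a m y + (L i - L m) * speed H a k y) 0.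
  apply: (is_derive_eq_on oB Bz _ (is_derive_const z _ 0)) => y By.
  by rewrite speed_sum0.
have := is_derive_unique Z (is_derive_add (is_derive_add
  (is_derive_cmul _ (speed_d_diag im ik mk Bz)) (is_derive_cmul _ (dm z Bz)))
  (is_derive_cmul _ dk)).
rewrite mulr0 add0r => E; apply: (mulfI (L0 im)).
move: E; move: (pdiff (uix i) (speed H a k) z) (pd ip (a i) z) (L i) (L m) (L k).
by move=> s p x y t E; apply/eqP; rewrite -subr_eq0; apply/eqP; rewrite [RHS]E; ring.
Qed.

End Conic.

Lemma lam_inj {R : realType} (l1 l2 l3 : R) : l1 != l2 -> l1 != l3 -> l2 != l3 ->
  injective (lam l1 l2 l3).
Proof.
move=> l12 l13 l23 i j.
case: i => [[|[|[|i]]] // hi]; case: j => [[|[|[|j]]] // hj]; rewrite /lam /= => E;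
  try exact/val_inj.
- by rewrite E eqxx in l12.
- by rewrite E eqxx in l13.
- by rewrite E eqxx in l12.
- by rewrite E eqxx in l23.
- by rewrite E eqxx in l13.
- by rewrite E eqxx in l23.
Qed.

Lemma lax_pair_of_conic {R : realType} (l1 l2 l3 : R) H U z0 (r : R)
    (a : 'I_3 -> 'rV[R]_4 -> R) : let L := lam l1 l2 l3 in let B := ball z0 r in
  integrable L H U -> injective L -> 0 < r ->
  (forall z, B z -> U (ufst z)) ->
  (forall i, smooth_on B (a i)) ->
  (forall i z, B z -> a i z != 0) ->
  (forall i j z, i != j -> B z -> pd (uix i) (a j) z = 0) ->
  (forall i j k z, i != j -> i != k -> j != k -> B z -> conic L H a i j k z = 0) ->
  (forall i, exists2 j, j != i & forall z, B z -> is_derive z (ebase (uix i))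
     (speed H a j) ((L j - L i) * pd ip (a i) z)) ->
  has_dispersionless_Lax_pair l1 l2 l3 H U.
Proof.
move=> L B iH Linj r0 BU sa a0 aij C rel; have oB : open B by exact: ball_open.
apply: (@lax_pair_of_speeds _ _ _ _ _ _ z0 r a) => //.
- by have := Linj i1 i2; rewrite /L /lam /=; case: eqP => // -> /(_ erefl).
- exact: (itg_smooth iH).
- by move=> i j z ij Bz; rewrite -pdE aij.
- by move=> i j z Bz; rewrite -pdE; exact: (speed_d iH Linj oB BU sa a0 aij C rel).
- move=> z Bz; exact: (speed_sum0 iH BU a0 C (i := i1) (j := i2) (k := i3)).
Qed.

(** * Non-constant ratios of mixed derivatives *)

(** The left side of the conclusion is the u_i-derivative of the component a_k of [chord]. The
    hypothesis compares the derivative of one ratio at both ends of the chord; solved for [s21] it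
    makes the quotient stationary. *)
Lemma chord_indep_algebra {R : realType} (ga h1 h2 h3 s1 s2 h31 h21 s21 : R) :
  h1 != 0 -> h2 != 0 -> h3 != 0 -> s1 != 0 -> s2 != 0 -> h1 * s2 - h2 * s1 != 0 ->
  h1 * (h31 * h2 - h3 * h21) / h2 ^+ 2 = s1 * (h31 * s2 - h3 * s21) / s2 ^+ 2 ->
  ga * (h1 * h21 * (s1 * s2) + h1 * h2 * (s1 * s21)) / (h3 * (h1 * s2 - h2 * s1))
  - ga * (h1 * h2 * (s1 * s2)) * (h31 * (h1 * s2 - h2 * s1)
      + h3 * (h1 * s21 - h21 * s1)) / (h3 * (h1 * s2 - h2 * s1)) ^+ 2 = 0.
Proof.
move=> h10 h20 h30 s10 s20 w0 M.
have -> : s21 = (h31 * s2 - h1 * (h31 * h2 - h3 * h21) / h2 ^+ 2 * s2 ^+ 2 / s1) / h3.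
  by rewrite M; field; rewrite ?h30 ?s10 ?s20.
by field; rewrite ?h10 ?h20 ?h30 ?s10 ?s20 ?w0.
Qed.

(* The only relation of the first case that is not immediate: the derivatives
   [s21], [s12], [h23], [h13], [s23], [s13] are eliminated. *)
Lemma chord_top_algebra {R : realType} (al be ga h1 h2 h3 s1 s2 h31 h32 h21 h23
    h12 h13 s21 s23 s12 s13 x : R) :
  al != 0 -> be != 0 -> ga != 0 -> al + be + ga = 0 ->
  h1 != 0 -> h2 != 0 -> h3 != 0 -> s1 != 0 -> s2 != 0 -> h1 * s2 - h2 * s1 != 0 ->
  al * (h31 * h2 + h3 * h21) = h1 * (be * h32 + ga * h23) ->
  be * (h32 * h1 + h3 * h12) = h2 * (ga * h13 + al * h31) ->
  al * (h31 * s2 + h3 * s21) = s1 * (be * h32 + ga * s23) ->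
  be * (h32 * s1 + h3 * s12) = s2 * (ga * s13 + al * h31) ->
  h1 * (h31 * h2 - h3 * h21) / h2 ^+ 2 = s1 * (h31 * s2 - h3 * s21) / s2 ^+ 2 ->
  h2 * (h32 * h1 - h3 * h12) / h1 ^+ 2 = s2 * (h32 * s1 - h3 * s12) / s1 ^+ 2 ->
  let n := h1 * h2 * (s1 * s2) in let d := h3 * (h1 * s2 - h2 * s1) in
  let D d1 d2 d3 e1 e2 :=
    ga * ((d1 * h2 + h1 * d2) * (s1 * s2) + h1 * h2 * (e1 * s2 + s1 * e2)) * d^-1
    + ga * n * (- (d3 * (h1 * s2 - h2 * s1)
        + h3 * (d1 * s2 + h1 * e2 + - (d2 * s1 + h2 * e1))) / d ^+ 2) in
  - h21 + - ((0 * h3 + x * 0 + (D h13 h23 0 0 0 * h2 + ga * n * d^-1 * h23))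
      * (al * s2)^-1 + (x * h3 + ga * n * d^-1 * h2) * (- 0 / (al * s2) ^+ 2)) =
  - be * D 0 0 0 (- (al * be)^-1 * s13) (- (al * be)^-1 * s23).
Proof.
move=> al0 be0 ga0 sum0 h10 h20 h30 s10 s20 w0 I1 I2 J1 J2 M1 M2 n d D.
have Es21 : s21 = (h31 * s2 - h1 * (h31 * h2 - h3 * h21) / h2 ^+ 2 * s2 ^+ 2 / s1) / h3.
  by rewrite M1; field; rewrite ?h30 ?s10 ?s20.
have Es12 : s12 = (h32 * s1 - h2 * (h32 * h1 - h3 * h12) / h1 ^+ 2 * s1 ^+ 2 / s2) / h3.
  by rewrite M2; field; rewrite ?h30 ?s10 ?s20.
have Eh23 : h23 = (al * (h31 * h2 + h3 * h21) / h1 - be * h32) / ga.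
  by rewrite I1; field; rewrite ?ga0 ?h10.
have Eh13 : h13 = (be * (h32 * h1 + h3 * h12) / h2 - al * h31) / ga.
  by rewrite I2; field; rewrite ?ga0 ?h20.
have Es23 : s23 = (al * (h31 * s2 + h3 * s21) / s1 - be * h32) / ga.
  by rewrite J1; field; rewrite ?ga0 ?s10.
have Es13 : s13 = (be * (h32 * s1 + h3 * s12) / s2 - al * h31) / ga.
  by rewrite J2; field; rewrite ?ga0 ?s20.
rewrite /D /n /d Eh23 Eh13 Es23 Es13 Es21 Es12.
have Ega : ga = - al - be by rewrite -[LHS]subr0 -sum0; ring.
rewrite Ega in ga0 *.
by field; rewrite ?al0 ?be0 ?h10 ?h20 ?h30 ?s10 ?s20 ?w0 ?ga0.
Qed.

(** The hypothesis is [itg_prod_i] at the shifted point. It reduces the left side to ga s23 / be,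
    which equals the right side precisely because p is scaled by - 1 / (al be). *)
Lemma chord_side_algebra_i {R : realType} (al be ga h1 h3 s1 s2 h31 h32 s21 s23 x : R) :
  al != 0 -> be != 0 -> s1 != 0 ->
  al * (h31 * s2 + h3 * s21) = s1 * (be * h32 + ga * s23) ->
  - h32 + - ((0 * h1 + x * 0 + (al * s21 * h3 + al * s2 * h31)) * (- be * s1)^-1
    + (x * h1 + al * s2 * h3) * (- 0 / (- be * s1) ^+ 2)) =
  - ga * (al * (- (al * be)^-1 * s23)).
Proof.
move=> al0 be0 s10 T.
transitivity (- h32 + (al * (h31 * s2 + h3 * s21)) / (be * s1)).
  by field; rewrite ?be0 ?s10.
by rewrite T; field; rewrite ?al0 ?be0 ?s10.
Qed.

Lemma chord_side_algebra_j {R : realType} (al be ga h2 h3 s1 s2 h31 h32 s12 s13 x : R) :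
  al != 0 -> be != 0 -> s2 != 0 ->
  be * (h32 * s1 + h3 * s12) = s2 * (ga * s13 + al * h31) ->
  - h31 + - ((- be * s12 * h3 + - be * s1 * h32 + (0 * h2 + x * 0)) * (al * s2)^-1
    + (- be * s1 * h3 + x * h2) * (- 0 / (al * s2) ^+ 2)) =
  ga * (- be * (- (al * be)^-1 * s13)).
Proof.
move=> al0 be0 s20 T.
transitivity (- h31 + (be * (h32 * s1 + h3 * s12)) / (al * s2)).
  by field; rewrite ?al0 ?s20.
by rewrite T; field; rewrite ?al0 ?be0 ?s20.
Qed.

Section Chord.
Context {R : realType}.
Variables (L : 'I_3 -> R) (H : 'rV[R]_3 -> R) (V : set 'rV[R]_3).
Hypothesis iH : integrable L H V.
Hypothesis Linj : injective L.
Variables (x0 : 'rV[R]_3) (rho : R).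
Hypothesis VE : V = ball x0 rho.
Variables (i j k : 'I_3).
Hypotheses (ij : i != j) (ik : i != k) (jk : j != k).

Let ji : j != i. Proof. by rewrite eq_sym. Qed.
Let ki : k != i. Proof. by rewrite eq_sym. Qed.
Let kj : k != j. Proof. by rewrite eq_sym. Qed.
Let oV : open V := itg_open iH.
Let sH : smooth_on V H := itg_smooth iH.
Let al := L j - L k.
Let be := L k - L i.
Let ga := L i - L j.
Let L0 m n : m != n -> L m - L n != 0.
Proof. by move=> mn; rewrite subr_eq0 (inj_eq Linj). Qed.
Let al0 : al != 0 := L0 jk.
Let be0 : be != 0 := L0 ki.
Let ga0 : ga != 0 := L0 ij.
Let sig := - (al * be)^-1.

(** The far end of a chord in direction k, at a height linear in p; the factor [sig] is the one that
    [chord_side_algebra_i] and [chord_side_algebra_j] call for. *)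
Definition chord_pt (z : 'rV[R]_4) := set_coord k (sig * z 0 ip) (ufst z).

Lemma chord_pt_map : coord_map chord_pt
  (fun m => if unlift ip m is Some n then (n != k)%:R else sig)
  (fun m => if unlift ip m is Some n then n else k).
Proof.
move=> z t m; rewrite /chord_pt; case: unliftP => [n ->|->].
  rewrite -uixE ufst_line_u addebaseE [ip == _]eq_sym.
  have -> : (uix n == ip) = false.
    by rewrite uixE eq_sym; apply/negbTE; exact: neq_lift.
  rewrite mulr0 addr0; have [->|nk] := eqVneq n k.
    by rewrite set_coord_line mulr0 scale0r addr0.
  by rewrite set_coord_line_neq// mulr1.
rewrite ufst_line_p addebaseE eqxx mulr1.
apply/rowP => n; rewrite [RHS]addebaseE !set_coordE; case: eqP => _.
  by rewrite mulr1; ring.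
by rewrite mulr0 addr0.
Qed.

Lemma chord_pt_continuous : continuous chord_pt.
Proof.
apply: continuous_rowP => n.
have -> : (fun z => chord_pt z 0 n) =
    (fun z : 'rV[R]_4 => if n == k then sig * z 0 ip else z 0 (uix n)).
  by apply/funext => z; rewrite set_coordE mxE.
case: eqP => _; last exact: coord_continuous.
move=> z; apply: (@continuous_comp _ _ _ (fun y : 'rV[R]_4 => y 0 ip)
  (fun t : R => sig * t)); first exact: coord_continuous.
exact: mulrl_continuous.
Qed.

Variable B : set 'rV[R]_4.
Hypothesis oB : open B.
Hypothesis BV : forall z, B z -> V (ufst z).
Hypothesis BV' : forall z, B z -> V (chord_pt z).

Let h1 z := hess H j k (ufst z).
Let h2 z := hess H i k (ufst z).
Let h3 z := hess H i j (ufst z).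
Let s1 z := hess H j k (chord_pt z).
Let s2 z := hess H i k (chord_pt z).
Hypothesis w0 : forall z, B z -> h1 z * s2 z - h2 z * s1 z != 0.

Let h10 z : B z -> h1 z != 0.
Proof. by move=> Bz; exact: (itg_neq0 iH jk (BV Bz)). Qed.
Let h20 z : B z -> h2 z != 0.
Proof. by move=> Bz; exact: (itg_neq0 iH ik (BV Bz)). Qed.
Let h30 z : B z -> h3 z != 0.
Proof. by move=> Bz; exact: (itg_neq0 iH ij (BV Bz)). Qed.
Let s10 z : B z -> s1 z != 0.
Proof. by move=> Bz; exact: (itg_neq0 iH jk (BV' Bz)). Qed.
Let s20 z : B z -> s2 z != 0.
Proof. by move=> Bz; exact: (itg_neq0 iH ik (BV' Bz)). Qed.

(** The two ends differ only in u_k; by [VE] the segment between them stays in [V]. *)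
Lemma const_chord (F : 'rV[R]_3 -> R) z : smooth_on V F ->
  (forall y, V y -> pd k F y = 0) -> B z -> F (chord_pt z) = F (ufst z).
Proof.
move=> sF F0 Bz; have := BV' Bz; have := BV Bz; rewrite /chord_pt VE => Vu Vc.
apply: constant_along Vu Vc => y yV; rewrite -VE in yV.
by rewrite -(F0 y yV); exact: (pd_is_derive k sF yV).
Qed.

Definition chord_den z := h3 z * (h1 z * s2 z - h2 z * s1 z).

(** For the components al s2 and - be s1 the first two terms of the conic add up to (h2 s1 - h1 s2)
    / (h1 h2 s1 s2), which forces the component a_k. *)
Definition chord m z :=
  if m == i then al * s2 z else if m == j then - be * s1 z
  else ga * (h1 z * h2 z * (s1 z * s2 z)) * (chord_den z)^-1.

Let chord_i : chord i = fun z => al * s2 z.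
Proof. by apply/funext => z; rewrite /chord eqxx. Qed.
Let chord_j : chord j = fun z => - be * s1 z.
Proof. by apply/funext => z; rewrite /chord eqxx (negbTE ji). Qed.
Let chord_k : chord k =
  fun z => ga * (h1 z * h2 z * (s1 z * s2 z)) * (chord_den z)^-1.
Proof. by apply/funext => z; rewrite /chord (negbTE ki) (negbTE kj). Qed.

Let den0 z : B z -> chord_den z != 0.
Proof. by move=> Bz; apply: mulf_neq0; [exact: h30|exact: w0]. Qed.

Lemma chord_neq0 m z : B z -> chord m z != 0.
Proof.
move=> Bz; rewrite /chord; case: (m == i).
  by apply: mulf_neq0; [exact: al0|exact: s20].
case: (m == j); first by apply: mulf_neq0; [rewrite oppr_eq0; exact: be0|exact: s10].
apply: mulf_neq0; last by rewrite invr_eq0; exact: den0.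
apply: mulf_neq0; first exact: ga0.
by apply: mulf_neq0; apply: mulf_neq0; [exact: h10|exact: h20|exact: s10|exact: s20].
Qed.

Let smu m n : smooth_on B (fun z => hess H m n (ufst z)).
Proof. exact: (smooth_ufst oB BV (hess_smooth sH m n)). Qed.
Let smc m n : smooth_on B (fun z => hess H m n (chord_pt z)).
Proof.
exact: (smooth_pullback oB chord_pt_map chord_pt_continuous BV' (hess_smooth sH m n)).
Qed.

Lemma chord_smooth m : smooth_on B (chord m).
Proof.
have sc c : smooth_on B (fun=> c) by exact: smooth_cst.
have /or3P[] := ord3_distinct m ij ik jk => /eqP->.
- by rewrite chord_i; exact: (smoothM oB (sc al) (smc i k)).
- by rewrite chord_j; exact: (smoothM oB (sc (- be)) (smc j k)).
rewrite chord_k; apply: (smoothM oB).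
  apply: (smoothM oB (sc ga)); apply: (smoothM oB (smoothM oB (smu j k) (smu i k))).
  exact: (smoothM oB (smc j k) (smc i k)).
apply: (smoothV oB _ den0); apply: (smoothM oB (smu i j)); apply: (smoothD oB).
  exact: (smoothM oB (smu j k) (smc i k)).
exact: (smoothN oB (smoothM oB (smu i k) (smc j k))).
Qed.

Let du m n l z : B z -> is_derive z (ebase (uix l))
  (fun y => hess H m n (ufst y)) (pd l (hess H m n) (ufst z)).
Proof. by move=> Bz; exact: (is_derive_ufst_u (hess_d sH m n l (BV Bz))). Qed.

Let du0 m n l z : l != m -> l != n -> m != n -> B z ->
  is_derive z (ebase (uix l)) (fun y => hess H m n (ufst y)) 0.
Proof.
by move=> lm ln mn Bz; have := du m n l Bz; rewrite (itg_123 iH lm ln mn (BV Bz)).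
Qed.

Let dc m n l z : l != k -> B z -> is_derive z (ebase (uix l))
  (fun y => hess H m n (chord_pt y)) (pd l (hess H m n) (chord_pt z)).
Proof.
move=> lk Bz; have := @is_derive_pullback _ _ _ chord_pt (hess H m n) z
  (ebase (uix l)) (ebase l) 1 _ _ (hess_d sH m n l (BV' Bz)).
rewrite mul1r; apply=> t; rewrite chord_pt_map uixE liftK lk.
by [].
Qed.

Let dc0 m n l z : l != m -> l != n -> m != n -> l != k -> B z ->
  is_derive z (ebase (uix l)) (fun y => hess H m n (chord_pt y)) 0.
Proof.
by move=> lm ln mn lk Bz; have := dc m n lk Bz;
  rewrite (itg_123 iH lm ln mn (BV' Bz)).
Qed.

Let dck m n z : is_derive z (ebase (uix k)) (fun y => hess H m n (chord_pt y)) 0.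
Proof.
apply/is_derive_line0; rewrite (_ : (fun s : R => _) = fun=> hess H m n (chord_pt z)).
  exact: is_derive_const.
by apply/funext => s; rewrite chord_pt_map uixE liftK eqxx mulr0 scale0r addr0.
Qed.

Let dcp m n z : B z -> is_derive z (ebase ip)
  (fun y => hess H m n (chord_pt y)) (sig * pd k (hess H m n) (chord_pt z)).
Proof.
move=> Bz; apply: (@is_derive_pullback _ _ _ chord_pt (hess H m n) z
  (ebase ip) (ebase k) sig _ _ (hess_d sH m n k (BV' Bz))) => t.
by rewrite chord_pt_map unlift_none.
Qed.

Let dk v z d1 d2 d3 e1 e2 : B z ->
  is_derive z v h1 d1 -> is_derive z v h2 d2 -> is_derive z v h3 d3 ->
  is_derive z v s1 e1 -> is_derive z v s2 e2 ->
  let D' := d3 * (h1 z * s2 z - h2 z * s1 z)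
    + h3 z * (d1 * s2 z + h1 z * e2 + - (d2 * s1 z + h2 z * e1)) in
  let N' := ga * ((d1 * h2 z + h1 z * d2) * (s1 z * s2 z)
    + h1 z * h2 z * (e1 * s2 z + s1 z * e2)) in
  is_derive z v (chord k) (N' * (chord_den z)^-1
    + ga * (h1 z * h2 z * (s1 z * s2 z)) * (- D' / chord_den z ^+ 2)).
Proof.
move=> Bz dh1 dh2 dh3 ds1 ds2 D' N'; rewrite chord_k; apply: is_derive_mul.
  apply: is_derive_cmul.
  exact: (is_derive_mul (is_derive_mul dh1 dh2) (is_derive_mul ds1 ds2)).
apply: (is_derive_inv (den0 Bz)); apply: (is_derive_mul dh3).
exact: (is_derive_add (is_derive_mul dh1 ds2) (is_derive_opp (is_derive_mul dh2 ds1))).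
Qed.

Let h31 z := pd i (hess H i j) (ufst z).
Let h32 z := pd j (hess H i j) (ufst z).
Let h21 z := pd i (hess H i k) (ufst z).
Let h12 z := pd j (hess H j k) (ufst z).
Let s21 z := pd i (hess H i k) (chord_pt z).
Let s12 z := pd j (hess H j k) (chord_pt z).

Let h3c z : B z -> hess H i j (chord_pt z) = h3 z.
Proof.
move=> Bz; apply: (const_chord (hess_smooth sH i j)) => // y Vy.
exact: (itg_123 iH ki kj ij Vy).
Qed.

Let h3mc m z : B z -> pd m (hess H i j) (chord_pt z) = pd m (hess H i j) (ufst z).
Proof.
move=> Bz; apply: (const_chord (pd_smooth m (hess_smooth sH i j))) => // y Vy.
rewrite (pd_comm _ _ oV (hess_smooth sH i j) Vy).
rewrite (pd_eq_on m oV Vy (G := fun=> 0)); last first.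
  by move=> {}y {}Vy; exact: (itg_123 iH ki kj ij Vy).
by rewrite (pd_val (is_derive_const _ _ _)).
Qed.

(** By [itg_mixed] the u_i-derivative of [ratio H i k j] does not depend on u_k, so it has the same
    value at both ends of the chord. *)
Let mix_i z : B z -> h1 z * (h31 z * h2 z - h3 z * h21 z) / h2 z ^+ 2 =
  s1 z * (h31 z * s2 z - h3 z * s21 z) / s2 z ^+ 2.
Proof.
move=> Bz; have E : pd i (ratio H i k j) (chord_pt z) = pd i (ratio H i k j) (ufst z).
  apply: (const_chord (pd_smooth i (ratio_smooth iH j ik)) _ Bz) => y Vy.
  apply: (itg_mixed iH ik ij kj _ Vy).
  by rewrite (inj_eq Linj).
move: E; rewrite (dratio_side iH ik ij kj (BV Bz)) (dratio_side iH ik ij kj (BV' Bz)).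
rewrite (hess_sym oV sH k j (BV Bz)) (hess_sym oV sH k j (BV' Bz)).
by rewrite (h3c Bz) (h3mc i Bz) => <-.
Qed.

Let mix_j z : B z -> h2 z * (h32 z * h1 z - h3 z * h12 z) / h1 z ^+ 2 =
  s2 z * (h32 z * s1 z - h3 z * s12 z) / s1 z ^+ 2.
Proof.
move=> Bz; have E : pd j (ratio H j k i) (chord_pt z) = pd j (ratio H j k i) (ufst z).
  apply: (const_chord (pd_smooth j (ratio_smooth iH i jk)) _ Bz) => y Vy.
  apply: (itg_mixed iH jk ji ki _ Vy).
  by rewrite (inj_eq Linj).
move: E; rewrite (dratio_side iH jk ji ki (BV Bz)) (dratio_side iH jk ji ki (BV' Bz)).
rewrite (hess_sym oV sH k i (BV Bz)) (hess_sym oV sH k i (BV' Bz)).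
rewrite (hess_sym oV sH j i (BV Bz)) (hess_sym oV sH j i (BV' Bz)).
rewrite (dhess_sym oV sH j i j (BV Bz)) (dhess_sym oV sH j i j (BV' Bz)).
by rewrite (h3c Bz) (h3mc j Bz) => <-.
Qed.

Lemma chord_indep m n z : m != n -> B z -> pd (uix m) (chord n) z = 0.
Proof.
move=> mn Bz; apply: pd_val.
have /or3P[] := ord3_distinct n ij ik jk => /eqP En; rewrite En in mn *.
- rewrite chord_i -(mulr0 al); apply: is_derive_cmul.
  have [->|mk] := eqVneq m k; first exact: dck.
  exact: (dc0 mn mk ik mk Bz).
- rewrite chord_j -(mulr0 (- be)); apply: is_derive_cmul.
  have [->|mk] := eqVneq m k; first exact: dck.
  exact: (dc0 mn mk jk mk Bz).
have /or3P[] := ord3_distinct m ij ik jk => /eqP Em; rewrite Em in mn *.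
- apply: (is_derive_eq (dk Bz (du0 ij ik jk Bz) (du i k i Bz) (du i j i Bz)
    (dc0 ij ik jk ik Bz) (dc i k ik Bz))).
  apply: etrans (chord_indep_algebra ga (h10 Bz) (h20 Bz) (h30 Bz) (s10 Bz) (s20 Bz)
    (w0 Bz) (mix_i Bz)).
  rewrite /chord_den -/(h31 z) -/(h21 z) -/(s21 z).
  move: (h1 z) (h2 z) (h3 z) (s1 z) (s2 z) (h31 z) (h21 z) (s21 z) => *; ring.
(* For u_j the indices 1 and 2 trade places, which reverses the sign of the determinant. *)
- have w1 : h2 z * s1 z - h1 z * s2 z != 0.
    by rewrite -oppr_eq0 opprB; exact: w0.
  apply: (is_derive_eq (dk Bz (du j k j Bz) (du0 ji jk ik Bz) (du i j j Bz)
    (dc j k jk Bz) (dc0 ji jk ik jk Bz))).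
  apply: oppr_inj; rewrite oppr0.
  apply: etrans (chord_indep_algebra ga (h20 Bz) (h10 Bz) (h30 Bz) (s20 Bz) (s10 Bz)
    w1 (mix_j Bz)).
  rewrite /chord_den -/(h32 z) -/(h12 z) -/(s12 z).
  move: (h10 Bz) (h20 Bz) (h30 Bz) (s10 Bz) (s20 Bz) (w0 Bz) w1.
  move: (h1 z) (h2 z) (h3 z) (s1 z) (s2 z) (h32 z) (h12 z) (s12 z).
  move=> a b c d e f g h a0 b0 c0 d0 e0 w w'.
  by field; rewrite ?c0 ?w ?w'.
by rewrite eqxx in mn.
Qed.

Lemma chord_conic m n l z : m != n -> m != l -> n != l -> B z ->
  conic L H chord m n l z = 0.
Proof.
move=> mn ml nl Bz.
apply: (conic_perm iH BV ij ik jk _ mn ml nl Bz) => {mn ml nl Bz}y By.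
rewrite /conic chord_i chord_j chord_k -/al -/be -/ga -/(h1 y) -/(h2 y) -/(h3 y).
rewrite /chord_den.
move: (h10 By) (h20 By) (h30 By) (s10 By) (s20 By) (w0 By) al0 be0 ga0.
move: (h1 y) (h2 y) (h3 y) (s1 y) (s2 y) al be ga => a b c d e f g h.
by move=> a0 b0 c0 d0 e0 w f0 g0 h0; field; rewrite ?a0 ?b0 ?c0 ?d0 ?e0 ?w ?f0 ?g0 ?h0.
Qed.

(** For m = i and m = j the equation is a product identity at the far end of the chord alone; for m
    = k those at both ends enter, together with [mix_i] and [mix_j]. *)
Lemma chord_rel m : exists2 n, n != m & forall z, B z ->
  is_derive z (ebase (uix m)) (speed H chord n) ((L n - L m) * pd ip (chord m) z).
Proof.
have dl m' z n : n != m' -> B z -> is_derive z (ebase (uix n)) (chord m') 0.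
  move=> nm Bz; rewrite -(chord_indep nm Bz).
  exact: (pd_is_derive _ (chord_smooth m') Bz).
have /or3P[] := ord3_distinct m ij ik jk => /eqP->.
- exists j => // z Bz.
  apply: (is_derive_eq_on oB Bz (F := fun y => - hess H j j (ufst y) +
     - ((chord k y * hess H j k (ufst y) + (al * s2 y) * hess H i j (ufst y))
      * (chord j y)^-1))).
    move=> y By; rewrite (speedE iH BV chord_neq0 jk ji ki By) chord_i.
    by rewrite (hess_sym oV sH j i (BV By)).
  have dcj := is_derive_inv (chord_neq0 j Bz) (dl j z i ij Bz).
  apply: (is_derive_eq (is_derive_add (is_derive_opp (du j j i Bz))
    (is_derive_opp (is_derive_mul (is_derive_add
      (is_derive_mul (dl k z i ik Bz) (du0 ij ik jk Bz))
      (is_derive_mul (is_derive_cmul al (dc i k ik Bz)) (du i j i Bz))) dcj)))).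
  rewrite chord_i (pd_val (is_derive_cmul al (dcp i k Bz))) chord_j.
  rewrite (dhess_comm oV sH j j i (BV Bz)).
  have := itg_prod_i iH ij ik jk (BV' Bz); rewrite (h3c Bz) !(h3mc _ Bz) -/(s1 z) -/(s2 z).
  rewrite -[L j - L i]opprB -/al -/be -/ga -/(h3 z) => T.
  exact: (chord_side_algebra_i _ _ al0 be0 (s10 Bz) T).
- exists i => // z Bz.
  apply: (is_derive_eq_on oB Bz (F := fun y => - hess H i i (ufst y) +
     - (((- be * s1 y) * hess H i j (ufst y) + chord k y * hess H i k (ufst y))
      * (chord i y)^-1))).
    by move=> y By; rewrite (speedE iH BV chord_neq0 ij ik jk By) chord_j.
  have dci := is_derive_inv (chord_neq0 i Bz) (dl i z j ji Bz).
  apply: (is_derive_eq (is_derive_add (is_derive_opp (du i i j Bz))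
    (is_derive_opp (is_derive_mul (is_derive_add
      (is_derive_mul (is_derive_cmul (- be) (dc j k jk Bz)) (du i j j Bz))
      (is_derive_mul (dl k z j jk Bz) (du0 ji jk ik Bz))) dci)))).
  rewrite chord_j (pd_val (is_derive_cmul (- be) (dcp j k Bz))) chord_i.
  rewrite (dhess_comm oV sH i i j (BV Bz)) (dhess_sym oV sH j i i (BV Bz)).
  have := itg_prod_j iH ij ik jk (BV' Bz); rewrite (h3c Bz) !(h3mc _ Bz) -/(s1 z) -/(s2 z).
  rewrite -/al -/be -/ga -/(h3 z) => T.
  exact: (chord_side_algebra_j _ _ al0 be0 (s20 Bz) T).
- exists i => // z Bz.
  apply: (is_derive_eq_on oB Bz (F := fun y => - hess H i i (ufst y) +
     - ((chord j y * hess H i j (ufst y) + chord k y * hess H i k (ufst y))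
      * (chord i y)^-1))).
    by move=> y By; rewrite (speedE iH BV chord_neq0 ij ik jk By).
  have dci := is_derive_inv (chord_neq0 i Bz) (dl i z k ki Bz).
  have dckk := dk Bz (du j k k Bz) (du i k k Bz) (du0 ki kj ij Bz)
    (dck j k z) (dck i k z).
  have dckp := dk Bz (is_derive_ufst_p _ z) (is_derive_ufst_p _ z)
    (is_derive_ufst_p _ z) (dcp j k Bz) (dcp i k Bz).
  apply: (is_derive_eq (is_derive_add (is_derive_opp (du i i k Bz))
    (is_derive_opp (is_derive_mul (is_derive_add
      (is_derive_mul (dl j z k kj Bz) (du0 ki kj ij Bz))
      (is_derive_mul dckk (du i k k Bz))) dci)))).
  rewrite (pd_val dckp) chord_i.
  rewrite (dhess_comm oV sH i i k (BV Bz)) (dhess_sym oV sH k i i (BV Bz)).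
  rewrite -[L i - L k]opprB -/be chord_k.
  have sum0 : al + be + ga = 0 by rewrite /al /be /ga; ring.
  have T1 := itg_prod_i iH ij ik jk (BV Bz); have T2 := itg_prod_j iH ij ik jk (BV Bz).
  have T3 := itg_prod_i iH ij ik jk (BV' Bz); have T4 := itg_prod_j iH ij ik jk (BV' Bz).
  rewrite (h3c Bz) !(h3mc _ Bz) in T3 T4.
  exact: (chord_top_algebra _ al0 be0 ga0 sum0 (h10 Bz) (h20 Bz) (h30 Bz) (s10 Bz)
    (s20 Bz) (w0 Bz) T1 T2 T3 T4 (mix_i Bz) (mix_j Bz)).
Qed.

End Chord.

(** A Lax pair only has to live on some open set over the u-domain, so the domain may be shrunk to a
    ball on which segments and signs are under control. *)
Lemma lax_pair_subset {R : realType} (l1 l2 l3 : R) H (U V : set 'rV[R]_3) :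
  V `<=` U -> has_dispersionless_Lax_pair l1 l2 l3 H V ->
  has_dispersionless_Lax_pair l1 l2 l3 H U.
Proof.
move=> VU [W [f [g [oW [W0 [WV rest]]]]]]; exists W, f, g; split=> //; split=> //.
by split=> // z /WV/VU.
Qed.

Definition up_pair {R : realType} (x : 'rV[R]_3) (p : R) : 'rV[R]_4 :=
  \row_m (if unlift ip m is Some n then x 0 n else p).

Lemma ufst_up {R : realType} (x : 'rV[R]_3) p : ufst (up_pair x p) = x.
Proof.
by apply/rowP => n; rewrite !mxE -[widen_ord _ n]/(uix n) uixE liftK.
Qed.

Lemma up_pair_p {R : realType} (x : 'rV[R]_3) p : up_pair x p 0 ip = p.
Proof. by rewrite mxE unlift_none. Qed.

Lemma smooth_near_neq0 {R : realType} {n : nat} (W : set 'rV[R]_n) F x :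
  open W -> W x -> smooth_on W F -> F x != 0 ->
  exists2 r : R, 0 < r & forall y, ball x r y -> W y /\ F y != 0.
Proof.
move=> oW Wx sF F0; have cF := smooth_continuous sF Wx.
have F0' : 0 < `|F x| by rewrite normr_gt0.
have N : \forall y \near x, `|F x - F y| < `|F x|.
  by move/cvgrPdist_lt : cF; apply.
have /nbhs_ballP[r /= r0 xr] : \forall y \near x, W y /\ F y != 0.
  apply: filterS2 (open_nbhs_nbhs (conj oW Wx)) N => y Wy Fy; split=> //.
  by apply: contraTneq Fy => ->; rewrite subr0 ltxx.
by exists r.
Qed.

Lemma lax_pair_chord {R : realType} (l1 l2 l3 : R) H (x0 : 'rV[R]_3) (rho c : R)
    i j k x :
  let V := ball x0 rho in
  integrable (lam l1 l2 l3) H V -> injective (lam l1 l2 l3) ->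
  i != j -> i != k -> j != k -> V x -> V (set_coord k c x) ->
  hess H j k x * hess H i k (set_coord k c x)
    - hess H i k x * hess H j k (set_coord k c x) != 0 ->
  has_dispersionless_Lax_pair l1 l2 l3 H V.
Proof.
move=> V iH Linj ij ik jk Vx Vc w0; set L := lam l1 l2 l3 in iH Linj.
have L0 m n : m != n -> L m - L n != 0.
  by move=> mn; rewrite subr_eq0 (inj_eq Linj).
have ki : k != i by rewrite eq_sym.
pose sig := - ((L j - L k) * (L k - L i))^-1.
have sig0 : sig != 0.
  by rewrite oppr_eq0 invr_eq0; apply: mulf_neq0; exact: L0.
(* This value of p places the far end of the chord at height [c]. *)
pose z0 := up_pair x (c / sig).
have uz0 : ufst z0 = x by exact: ufst_up.
have cz0 : chord_pt L i j k z0 = set_coord k c x.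
  by rewrite /chord_pt uz0 up_pair_p -/sig mulrC divfK.
pose W := [set z | V (ufst z)] `&` [set z | V (chord_pt L i j k z)].
have oV : open V := itg_open iH.
have oW : open W.
  apply: openI; apply: open_comp => // z _.
    exact: ufst_continuous.
  exact: chord_pt_continuous.
pose w z := hess H j k (ufst z) * hess H i k (chord_pt L i j k z)
  - hess H i k (ufst z) * hess H j k (chord_pt L i j k z).
have sW m n : smooth_on W (fun z => hess H m n (ufst z)).
  by apply: (smooth_ufst oW _ (hess_smooth (itg_smooth iH) m n)) => z [].
have sWc m n : smooth_on W (fun z => hess H m n (chord_pt L i j k z)).
  apply: (smooth_pullback oW (@chord_pt_map _ L i j k) (@chord_pt_continuous _ L i j k)
    _ (hess_smooth (itg_smooth iH) m n)) => z.
  by case.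
have sw : smooth_on W w.
  exact: (smoothD oW (smoothM oW (sW j k) (sWc i k))
    (smoothN oW (smoothM oW (sW i k) (sWc j k)))).
have Wz0 : W z0 by split; rewrite /= ?uz0 ?cz0.
have wz0 : w z0 != 0 by rewrite /w uz0 cz0.
have [r r0 rP] := smooth_near_neq0 oW Wz0 sw wz0.
have oB : open (ball z0 r) by exact: ball_open.
have BV z : ball z0 r z -> V (ufst z) by move=> /rP[[]].
have BV' z : ball z0 r z -> V (chord_pt L i j k z) by move=> /rP[[]].
have Bw z : ball z0 r z -> w z != 0 by move=> /rP[].
apply: (@lax_pair_of_conic _ _ _ _ _ _ z0 r (chord L H i j k)) => //.
- move=> m; exact: (chord_smooth iH ij ik jk oB BV BV' Bw).
- move=> m z; exact: (chord_neq0 iH Linj ij ik jk BV BV' Bw).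
- move=> m n z; exact: (chord_indep iH Linj erefl ij ik jk BV BV' Bw).
- move=> m n l z; exact: (chord_conic iH Linj ij ik jk BV BV' Bw).
- move=> m; exact: (chord_rel iH Linj erefl ij ik jk oB BV BV' Bw).
Qed.

(** * The quartic case *)

(* For nonzero [kappa] the solution is elliptic: with [z' = kappa * sqrt (1 - z^3)]
   one takes [c1 = 1 / z], [c2, c3 = (- 1 -/+ sqrt (1 - z^3)) / (2 z)]. *)
Lemma cyclic_system {R : realType} (kappa : R) :
  exists (c1 c2 c3 : R -> R) (d : R), 0 < d /\ forall p, `|p| < d ->
    [/\ [/\ c1 p != 0, c2 p != 0, c3 p != 0 & c1 p + c2 p + c3 p = 0],
      is_derive p (1 : R) c1 (kappa * c1 p * (c2 p - c3 p)),
      is_derive p (1 : R) c2 (kappa * c2 p * (c3 p - c1 p)) &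
      is_derive p (1 : R) c3 (kappa * c3 p * (c1 p - c2 p))].
Proof.
have [->|k0] := eqVneq kappa 0.
  exists (fun=> 1), (fun=> 1), (fun=> - 2%:R), 1; split=> // p _.
  split; first split.
  - exact: oner_neq0.
  - exact: oner_neq0.
  - by rewrite oppr_eq0 pnatr_eq0.
  - by rewrite -[2%:R]/(1 + 1 : R) subrr.
  - by rewrite !mul0r; exact: (is_derive_const (V := R^o)).
  - by rewrite !mul0r; exact: (is_derive_const (V := R^o)).
  - by rewrite !mul0r; exact: (is_derive_const (V := R^o)).
(* The product c1 c2 c3 is a first integral, normalised to 1/4. With c1 + c2 + c3 = 0 it gives (c2 -
   c3)^2 = c1^2 - 1 / c1, that is (1 - z^3) / z^2 for z = 1 / c1. *)
pose phi (z : R) := Num.sqrt (1 - z ^+ 3).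
(* The interval of radius 1/4 around 1/2 keeps 0 < z < 1; then 0 < phi z < 1, and none of the three
   functions vanishes. *)
have phiP (z : R) : `|z - 2^-1| < 4^-1 -> [/\ 0 < z, 0 < 1 - z ^+ 3, 0 < phi z & phi z < 1].
  rewrite ltr_norml => /andP[z1 z2]; have z0 : 0 < z by lra.
  have zl1 : z < 1 by lra.
  have z3 : z ^+ 3 < 1 by rewrite exprn_ilt1// ltW.
  split=> //; first by rewrite subr_gt0.
    by rewrite sqrtr_gt0 subr_gt0.
  rewrite -[X in _ < X]sqrtr1 ltr_sqrt// gtrBl; exact: exprn_gt0.
have dphi (z : R) : `|z - 2^-1| < 4^-1 ->
    is_derive z (1 : R) phi (- (3%:R * z ^+ 2) / (2 * phi z)).
  move=> /phiP[z0 z3 _ _].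
  have dg : is_derive z (1 : R) (fun z : R => 1 - z ^+ 3) (- (3%:R * z ^+ 2)).
    apply: (is_derive_eq (is_derive_add (is_derive_const (z : R^o) 1 1)
      (is_derive_opp (is_deriveX 3 (is_derive_id (z : R^o) 1))))).
    by rewrite /= add0r [_ *: _]mulr1.
  apply: (is_derive_eq (@is_derive1_comp R Num.sqrt (fun z : R => 1 - z ^+ 3) z _ _
    (is_derive1_sqrt z3) dg)).
  by rewrite mulrC.
have q4 : 0 < 4^-1 :> R by rewrite invr_gt0.
have [|y [d [d0 yP]]] := @autonomous_ode R phi 2^-1 4^-1 q4.
  move=> z zr; have [_ _ p0 _] := phiP z zr; split=> //.
  by have [D _] := dphi z zr; exact/differentiable_continuous/derivable1_diffP.
(* [kappa] may be negative while [autonomous_ode] wants a positive right side, so it goes into the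
   argument. *)
pose Z p := y (kappa * p); pose f p := phi (Z p).
have kd : 0 < d / `|kappa| by rewrite divr_gt0// normr_gt0.
exists (fun p => (Z p)^-1), (fun p => (Z p)^-1 * (2^-1 * (- 1 - f p))),
  (fun p => (Z p)^-1 * (2^-1 * (- 1 + f p))), (d / `|kappa|).
split=> // p pd; have kp : `|kappa * p| < d.
  by rewrite normrM mulrC -ltr_pdivlMr// normr_gt0.
have [Zr dy] := yP _ kp; rewrite -/(Z p) in Zr dy.
have [z0 z3 f0 f1] := phiP _ Zr; rewrite -/(f p) in f0 f1.
have dZ : is_derive p (1 : R) Z (kappa * f p).
  have dk : is_derive p (1 : R) (fun p : R => kappa * p) kappa.
    apply: (is_derive_eq (is_derive_cmul kappa (is_derive_id (p : R^o) 1))).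
    by rewrite mulr1.
  by rewrite mulrC; exact: (@is_derive1_comp R y (fun p : R => kappa * p) p _ _ dy dk).
have df : is_derive p (1 : R) f (- (3%:R / 2 * kappa * Z p ^+ 2)).
  apply: (is_derive_eq (@is_derive1_comp R phi Z p _ _ (dphi _ Zr) dZ)).
  rewrite -/(f p); have : f p != 0 by rewrite gt_eqF.
  move: (f p) (Z p) => a b a0; by field.
have f2 : f p ^+ 2 = 1 - Z p ^+ 3 by rewrite sqr_sqrtr// ltW.
have Z0 : Z p != 0 by rewrite gt_eqF.
have dc1 : is_derive p (1 : R) (fun p => (Z p)^-1) (- (kappa * f p) / Z p ^+ 2).
  exact: (is_derive_inv (V := R^o) Z0 dZ).
(* The sign [s] treats c2 (s = -1) and c3 (s = 1) together. *)
have dc (s : R) : s ^+ 2 = 1 -> is_derive p (1 : R)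
    (fun p => (Z p)^-1 * (2^-1 * (- 1 + s * f p)))
    (kappa * ((Z p)^-1 * (2^-1 * (- 1 + s * f p))) *
      (s * ((Z p)^-1 - (Z p)^-1 * (2^-1 * (- 1 - s * f p))))).
  move=> s2.
  apply: (is_derive_eq (is_derive_mul (V := R^o) dc1 (is_derive_cmul (V := R^o) 2^-1
    (is_derive_add (V := R^o) (is_derive_const (V := R^o) p 1 (- 1))
      (is_derive_cmul (V := R^o) s df))))).
  move: f2 Z0; move: (f p) (Z p) => a b E b0.
  have s2' : s * s = 1 by rewrite -expr2.
  have Eb : b ^+ 3 = 1 - a ^+ 2 by rewrite E; ring.
  transitivity (kappa / (4%:R * b ^+ 2) *
    (2%:R * a - 2%:R * s * a ^+ 2 - 3%:R * s * b ^+ 3)); first by field.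
  transitivity (kappa / (4%:R * b ^+ 2) *
    (- (3%:R * s) + (s * s) * (2%:R * a) + (s * s) * (s * a ^+ 2))); last by field.
  by rewrite Eb s2'; congr (_ * _); ring.
split.
- split.
  + by rewrite invr_eq0.
  + apply: mulf_neq0; first by rewrite invr_eq0.
    by apply: mulf_neq0; [rewrite invr_eq0 pnatr_eq0|rewrite lt_eqF//; lra].
  + apply: mulf_neq0; first by rewrite invr_eq0.
    by apply: mulf_neq0; [rewrite invr_eq0 pnatr_eq0|rewrite lt_eqF//; lra].
  + by move: (f p) (Z p) Z0 => a b b0; field.
- apply: (is_derive_eq dc1); move: (f p) (Z p) Z0 => a b b0; by field.
- have := dc (- 1); rewrite sqrrN expr1n => /(_ erefl).
  rewrite (_ : (fun p => _) = (fun p => (Z p)^-1 * (2^-1 * (- 1 - f p)))); last first.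
    by apply/funext => t; rewrite mulN1r.
  move=> D; apply: (is_derive_eq D); move: (f p) (Z p) Z0 => a b b0; by field.
- have := dc 1; rewrite expr1n => /(_ erefl).
  rewrite (_ : (fun p => _) = (fun p => (Z p)^-1 * (2^-1 * (- 1 + f p)))); last first.
    by apply/funext => t; rewrite mul1r.
  move=> D; apply: (is_derive_eq D); move: (f p) (Z p) Z0 => a b b0; by field.
Qed.

(** By c1 + c2 + c3 = 0 and q^2 = K h1 h2 h3 both sides are multiples of (q / h1) (c1 + 2 c2) / c1;
    equating the coefficients is what fixes [kap]. *)
Lemma quartic_rel_algebra {R : realType} (al be ga K X kap h1 h2 h3 q c1 c2 c3 w y
    f e : R) :
  al != 0 -> be != 0 -> ga != 0 -> h1 != 0 -> h2 != 0 -> h3 != 0 -> q != 0 ->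
  c1 != 0 -> c2 != 0 -> c1 + c2 + c3 = 0 -> K * K = 1 ->
  q ^+ 2 = K * (h1 * h2 * h3) -> kap * (al * be * ga) = - (X * K) ->
  f = X * h3 * h1 / (al * q) -> e = X * h3 * h2 / (be * q) ->
  - e + - ((0 * y + w * 0 + (X * c1^-1 * h3 + al * (q * h1^-1) * c1^-1 * f))
      * (be * (q * h2^-1) * c2^-1)^-1
    + (w * y + al * (q * h1^-1) * c1^-1 * h3)
      * (- 0 / (be * (q * h2^-1) * c2^-1) ^+ 2)) =
  - ga * (al * (q * h1^-1) * (- (kap * c1 * (c2 - c3)) / c1 ^+ 2)).
Proof.
move=> al0 be0 ga0 h10 h20 h30 q0 c10 c20 Ec K2 q2 Ek -> ->.
have Ekap : kap = - (X * K) / (al * be * ga).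
  by rewrite -Ek; field; rewrite ?al0 ?be0 ?ga0.
have -> : c3 = - c1 - c2 by rewrite -[RHS]addr0 -Ec; ring.
transitivity (- (X / be) * (h2 * h3 / q) * (c1 + 2%:R * c2) / c1).
  by field; rewrite ?al0 ?be0 ?h10 ?h20 ?q0 ?c10 ?c20.
have -> : h2 * h3 / q = K * q / h1.
  have -> : K * q / h1 = K * q ^+ 2 / (h1 * q) by field; rewrite ?h10 ?q0.
  rewrite q2 mulrA K2; by field; rewrite ?h10 ?q0.
by rewrite Ekap; field; rewrite ?al0 ?be0 ?ga0 ?h10 ?c10.
Qed.

Lemma is_derive_real_comp {R : realType} {V : normedModType R} (f : R -> R)
    (F : V -> R) x v a b :
  is_derive (F x) (1 : R) f a -> is_derive x v F b ->
  is_derive x v (fun y => f (F y)) (a * b).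
Proof.
move=> df /is_derive_line0 dF; apply/is_derive_line0.
apply: (@is_derive1_comp R f (fun s => F (x + s *: v))) => //.
by rewrite scale0r addr0.
Qed.

Section Quartic.
Context {R : realType}.
Variables (L : 'I_3 -> R) (H : 'rV[R]_3 -> R) (V : set 'rV[R]_3).
Hypothesis iH : integrable L H V.
Hypothesis Linj : injective L.
Variables (x0 : 'rV[R]_3) (rho : R).
Hypothesis VE : V = ball x0 rho.
Hypothesis Vx0 : V x0.
Variables (i j k : 'I_3).
Hypotheses (ij : i != j) (ik : i != k) (jk : j != k).
Hypothesis deg : forall a b c x, a != b -> a != c -> b != c -> V x ->
  pd c (hess H a c) x * hess H b c x = hess H a c x * pd c (hess H b c) x.

Let ji : j != i. Proof. by rewrite eq_sym. Qed.
Let ki : k != i. Proof. by rewrite eq_sym. Qed.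
Let kj : k != j. Proof. by rewrite eq_sym. Qed.
Let oV : open V := itg_open iH.
Let sH : smooth_on V H := itg_smooth iH.
Let al := L j - L k.
Let be := L k - L i.
Let ga := L i - L j.
Let L0 m n : m != n -> L m - L n != 0.
Proof. by move=> mn; rewrite subr_eq0 (inj_eq Linj). Qed.
Let al0 : al != 0 := L0 jk.
Let be0 : be != 0 := L0 ki.
Let ga0 : ga != 0 := L0 ij.

Let h1 := hess H j k.
Let h2 := hess H i k.
Let h3 := hess H i j.
Let h31 := pd i h3.
Let h32 := pd j h3.
Let h21 := pd i h2.
Let h23 := pd k h2.
Let h12 := pd j h1.
Let h13 := pd k h1.
Variable K : R.
Hypothesis K2 : K * K = 1.
Hypothesis Kpos : forall x, V x -> 0 < K * (h1 x * h2 x * h3 x).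

Let h10 x : V x -> h1 x != 0. Proof. exact: (itg_neq0 iH jk). Qed.
Let h20 x : V x -> h2 x != 0. Proof. exact: (itg_neq0 iH ik). Qed.
Let h30 x : V x -> h3 x != 0. Proof. exact: (itg_neq0 iH ij). Qed.

(** Degeneracy says that H_ij and H_ik have the same logarithmic derivative in u_i; likewise for the
    other two variables. *)
Let E21 x : V x -> h21 x = h2 x * h31 x / h3 x.
Proof.
move=> Vx; have := deg kj ki ji Vx.
rewrite (hess_sym oV sH k i Vx) (hess_sym oV sH j i Vx).
rewrite (dhess_sym oV sH k i i Vx) (dhess_sym oV sH j i i Vx) => <-.
by rewrite mulfK ?h30.
Qed.

Let E12 x : V x -> h12 x = h1 x * h32 x / h3 x.
Proof.
move=> Vx; have := deg ki kj ij Vx.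
rewrite (hess_sym oV sH k j Vx) (dhess_sym oV sH k j j Vx) => <-.
by rewrite mulfK ?h30.
Qed.

Let E13 x : V x -> h13 x = h1 x * h23 x / h2 x.
Proof. by move=> Vx; rewrite -(deg ji jk ik Vx) mulfK ?h20. Qed.

(** The sign [K] stands for an absolute value, so that the radicand is a smooth positive
    function. *)
Definition root_prod x := Num.sqrt (K * (h1 x * h2 x * h3 x)).
Let q := root_prod.

Let q0 x : V x -> q x != 0.
Proof. by move=> Vx; rewrite gt_eqF// sqrtr_gt0; exact: Kpos. Qed.

Let q2 x : V x -> q x ^+ 2 = K * (h1 x * h2 x * h3 x).
Proof. by move=> Vx; rewrite sqr_sqrtr// ltW// Kpos. Qed.

Let dh m n l x : V x -> is_derive x (ebase l) (hess H m n) (pd l (hess H m n) x).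
Proof. exact: (hess_d sH). Qed.

Let dh0 m n l x : l != m -> l != n -> m != n -> V x ->
  is_derive x (ebase l) (hess H m n) 0.
Proof. by move=> lm ln mn Vx; have := dh m n l Vx; rewrite (itg_123 iH lm ln mn Vx). Qed.

Let dq v x d1 d2 d3 : V x -> is_derive x v h1 d1 -> is_derive x v h2 d2 ->
  is_derive x v h3 d3 -> is_derive x v q
  ((2 * q x)^-1 * (K * ((d1 * h2 x + h1 x * d2) * h3 x + h1 x * h2 x * d3))).
Proof.
move=> Vx dh1 dh2 dh3; apply: is_derive_real_comp.
  by apply: is_derive1_sqrt; exact: Kpos.
apply: is_derive_cmul.
exact: (is_derive_mul (is_derive_mul dh1 dh2) dh3).
Qed.

(** Of the three factors under the root only h2 and h3 depend on u_i; their logarithmic derivatives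
    agree by [E21], and the root halves their sum. *)
Let dq_i x : V x -> is_derive x (ebase i) q (h31 x / h3 x * q x).
Proof.
move=> Vx; apply: (is_derive_eq (dq Vx (dh0 ij ik jk Vx) (dh i k i Vx) (dh i j i Vx))).
rewrite -/h31 -/(h21 x) (E21 Vx) -/h2 -/h3 -/(h31 x).
transitivity ((2 * q x)^-1 * (2%:R * (K * (h1 x * h2 x * h3 x)) * (h31 x / h3 x))).
  by congr (_ * _); move: (h30 Vx) => ?; field.
rewrite -q2//; move: (q0 Vx) (h30 Vx) => ? ?; field.
by apply/andP.
Qed.

Let dq_j x : V x -> is_derive x (ebase j) q (h32 x / h3 x * q x).
Proof.
move=> Vx; apply: (is_derive_eq (dq Vx (dh j k j Vx) (dh0 ji jk ik Vx) (dh i j j Vx))).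
rewrite -/h32 -/(h12 x) (E12 Vx) -/h1 -/h3 -/(h32 x).
transitivity ((2 * q x)^-1 * (2%:R * (K * (h1 x * h2 x * h3 x)) * (h32 x / h3 x))).
  by congr (_ * _); move: (h30 Vx) => ?; field.
rewrite -q2//; move: (q0 Vx) (h30 Vx) => ? ?; field.
by apply/andP.
Qed.

Let dq_k x : V x -> is_derive x (ebase k) q (h23 x / h2 x * q x).
Proof.
move=> Vx; apply: (is_derive_eq (dq Vx (dh j k k Vx) (dh i k k Vx) (dh0 ki kj ij Vx))).
rewrite -/h23 -/(h13 x) (E13 Vx) -/h1 -/h2 -/(h23 x).
transitivity ((2 * q x)^-1 * (2%:R * (K * (h1 x * h2 x * h3 x)) * (h23 x / h2 x))).
  by congr (_ * _); move: (h20 Vx) => ?; field.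
rewrite -q2//; move: (q0 Vx) (h20 Vx) => ? ?; field.
by apply/andP.
Qed.

(** Each partial derivative of [q] is [q] times a smooth logarithmic derivative, so [q] and the
    smooth functions form a family closed under derivatives. *)
Let root_smooth : smooth_on V q.
Proof.
apply: (@smooth_ratfun _ _ _ (fun F => F = q \/ smooth_on V F)) => //; last first.
  by apply: ratfun_gen; left.
move=> F [->|sF]; last first.
  split=> [y Vy|m]; first exact: (smooth_continuous sF Vy).
  exists (pd m F); split; last by move=> y Vy; exact: (pd_is_derive m sF Vy).
  by apply: ratfun_gen; right; exact: (pd_smooth m sF).
have D m : exists2 G, smooth_on V G & forall y, V y ->
    is_derive y (ebase m) q (G y * q y).
  have /or3P[] := ord3_distinct m ij ik jk => /eqP->.
  - exists (fun y => h31 y * (h3 y)^-1) => [|y Vy]; last exact: dq_i.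
    by apply: (smoothM oV (pd_smooth i (hess_smooth sH i j)));
      exact: (smoothV oV (hess_smooth sH i j) h30).
  - exists (fun y => h32 y * (h3 y)^-1) => [|y Vy]; last exact: dq_j.
    by apply: (smoothM oV (pd_smooth j (hess_smooth sH i j)));
      exact: (smoothV oV (hess_smooth sH i j) h30).
  - exists (fun y => h23 y * (h2 y)^-1) => [|y Vy]; last exact: dq_k.
    by apply: (smoothM oV (pd_smooth k (hess_smooth sH i k)));
      exact: (smoothV oV (hess_smooth sH i k) h20).
split=> [y Vy|m]; last first.
  have [G sG dG] := D m; exists (fun y => G y * q y); split=> //.
  by apply: ratfunM; apply: ratfun_gen; [right|left].
have sP : smooth_on V (fun x => K * (h1 x * h2 x * h3 x)).
  apply: (smoothM oV (smooth_cst K oV)).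
  apply: (smoothM oV _ (hess_smooth sH i j)).
  exact: (smoothM oV (hess_smooth sH j k) (hess_smooth sH i k)).
apply: (@continuous_comp _ _ _ (fun x => K * (h1 x * h2 x * h3 x)) Num.sqrt).
  exact: (smooth_continuous sP Vy).
exact: sqrt_continuous.
Qed.

(** By [dA1_i] this is al times the u_i-derivative of q / h1. Its constancy, and its equality with
    the analogous quantities for h2 and h3, make each q / h an affine function of one variable. *)
Definition quartic_rate x := al * (h31 x / h3 x * (q x / h1 x)).

(** In the degenerate case the product identities become 2 u = v + w and 2 v = w + u for three
    quantities, which are therefore equal. *)
Let rates x : V x -> al * (h2 x * h31 x) = be * (h1 x * h32 x) /\
  al * (h2 x * h31 x) = ga * (h1 x * h23 x).
Proof.
move=> Vx; have := itg_prod_i iH ij ik jk Vx; have := itg_prod_j iH ij ik jk Vx.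
rewrite -/al -/be -/ga -/h1 -/h2 -/h3 -/h12 -/h32 -/h31 -/h21 -/h23 -/h13.
rewrite (E21 Vx) (E12 Vx) (E13 Vx).
have Ec a b c : c != 0 -> c * (a * b / c) = a * b :> R by move=> c0; field.
rewrite !(Ec _ _ _ (h30 Vx)) => T2 T1.
have E : h2 x * (ga * (h1 x * h23 x / h2 x)) = ga * (h1 x * h23 x).
  by rewrite mulrCA (Ec _ _ _ (h20 Vx)).
rewrite [h2 x * (_ + _)]mulrDr E in T2; move: T1 T2.
move: (h1 x) (h2 x) (h31 x) (h32 x) (h23 x) => a b c d e T1 T2.
have T1' : 2%:R * (al * (b * c)) = be * (a * d) + ga * (a * e).
  transitivity (al * (c * b + b * c)); first by ring.
  by rewrite T1; ring.
have T2' : 2%:R * (be * (a * d)) = ga * (a * e) + al * (b * c).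
  transitivity (be * (d * a + a * d)); first by ring.
  by rewrite T2; ring.
by move: T1' T2'; move: (al * (b * c)) (be * (a * d)) (ga * (a * e)) => u v w ? ?;
  split; lra.
Qed.

Let rate_j x : V x -> quartic_rate x = be * (h32 x / h3 x * (q x / h2 x)).
Proof.
move=> Vx; have [E _] := rates Vx; rewrite /quartic_rate.
move: E (h10 Vx) (h20 Vx) (h30 Vx).
move: (h1 x) (h2 x) (h3 x) (h31 x) (h32 x) (q x) => a b c d e g E a0 b0 c0.
transitivity (al * (b * d) * g / (a * b * c)); first by field; rewrite ?a0 ?b0 ?c0.
by rewrite E; field; rewrite ?a0 ?b0 ?c0.
Qed.

Let rate_k x : V x -> quartic_rate x = ga * (h23 x / h2 x * (q x / h3 x)).
Proof.
move=> Vx; have [_ E] := rates Vx; rewrite /quartic_rate.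
move: E (h10 Vx) (h20 Vx) (h30 Vx).
move: (h1 x) (h2 x) (h3 x) (h31 x) (h23 x) (q x) => a b c d e g E a0 b0 c0.
transitivity (al * (b * d) * g / (a * b * c)); first by field; rewrite ?a0 ?b0 ?c0.
by rewrite E; field; rewrite ?a0 ?b0 ?c0.
Qed.

Let dA1_j x : V x -> is_derive x (ebase j) (fun x => q x * (h1 x)^-1) 0.
Proof.
move=> Vx; apply: (is_derive_eq (is_derive_mul (dq_j Vx)
  (is_derive_inv (h10 Vx) (dh j k j Vx)))).
rewrite -/(h12 x) (E12 Vx); move: (h10 Vx) (h30 Vx).
by move: (h1 x) (h3 x) (h32 x) (q x) => a b c e a0 b0; field; rewrite ?a0 ?b0.
Qed.

Let dA1_k x : V x -> is_derive x (ebase k) (fun x => q x * (h1 x)^-1) 0.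
Proof.
move=> Vx; apply: (is_derive_eq (is_derive_mul (dq_k Vx)
  (is_derive_inv (h10 Vx) (dh j k k Vx)))).
rewrite -/(h13 x) (E13 Vx); move: (h10 Vx) (h20 Vx).
by move: (h1 x) (h2 x) (h23 x) (q x) => a b c e a0 b0; field; rewrite ?a0 ?b0.
Qed.

Let dA2_i x : V x -> is_derive x (ebase i) (fun x => q x * (h2 x)^-1) 0.
Proof.
move=> Vx; apply: (is_derive_eq (is_derive_mul (dq_i Vx)
  (is_derive_inv (h20 Vx) (dh i k i Vx)))).
rewrite -/(h21 x) (E21 Vx); move: (h20 Vx) (h30 Vx).
by move: (h2 x) (h3 x) (h31 x) (q x) => a b c e a0 b0; field; rewrite ?a0 ?b0.
Qed.

Let dA2_k x : V x -> is_derive x (ebase k) (fun x => q x * (h2 x)^-1) 0.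
Proof.
move=> Vx; apply: (is_derive_eq (is_derive_mul (dq_k Vx)
  (is_derive_inv (h20 Vx) (dh i k k Vx)))).
rewrite -/(h23 x); move: (h20 Vx).
by move: (h2 x) (h23 x) (q x) => a b c a0; field.
Qed.

Let dA3_i x : V x -> is_derive x (ebase i) (fun x => q x * (h3 x)^-1) 0.
Proof.
move=> Vx; apply: (is_derive_eq (is_derive_mul (dq_i Vx)
  (is_derive_inv (h30 Vx) (dh i j i Vx)))).
rewrite -/(h31 x); move: (h30 Vx).
by move: (h3 x) (h31 x) (q x) => a b c a0; field.
Qed.

Let dA3_j x : V x -> is_derive x (ebase j) (fun x => q x * (h3 x)^-1) 0.
Proof.
move=> Vx; apply: (is_derive_eq (is_derive_mul (dq_j Vx)
  (is_derive_inv (h30 Vx) (dh i j j Vx)))).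
rewrite -/(h32 x); move: (h30 Vx).
by move: (h3 x) (h32 x) (q x) => a b c a0; field.
Qed.

Let dA1_i x : V x -> is_derive x (ebase i) (fun x => q x * (h1 x)^-1)
  (h31 x / h3 x * (q x / h1 x)).
Proof.
move=> Vx; apply: (is_derive_eq (is_derive_mul (dq_i Vx)
  (is_derive_inv (h10 Vx) (dh0 ij ik jk Vx)))).
by rewrite oppr0 mul0r mulr0 addr0 -mulrA.
Qed.

Let dA2_j x : V x -> is_derive x (ebase j) (fun x => q x * (h2 x)^-1)
  (h32 x / h3 x * (q x / h2 x)).
Proof.
move=> Vx; apply: (is_derive_eq (is_derive_mul (dq_j Vx)
  (is_derive_inv (h20 Vx) (dh0 ji jk ik Vx)))).
by rewrite oppr0 mul0r mulr0 addr0 -mulrA.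
Qed.

Let dA3_k x : V x -> is_derive x (ebase k) (fun x => q x * (h3 x)^-1)
  (h23 x / h2 x * (q x / h3 x)).
Proof.
move=> Vx; apply: (is_derive_eq (is_derive_mul (dq_k Vx)
  (is_derive_inv (h30 Vx) (dh0 ki kj ij Vx)))).
by rewrite oppr0 mul0r mulr0 addr0 -mulrA.
Qed.

(** For each variable one of the expressions of the rate has both factors independent of it: that of
    [rate_j] for u_i, the definition for u_j and u_k. As [V] is a cube, [x] is reached from [x0] by
    three moves along the axes. *)
Lemma quartic_rate_const x : V x -> quartic_rate x = quartic_rate x0.
Proof.
have dV F l : smooth_on V F -> forall y, V y -> is_derive y (ebase l) F (pd l F y).
  by move=> sF y Vy; exact: (pd_is_derive l sF Vy).
have dd m n l l' y : l' != m -> l' != n -> m != n -> V y ->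
    is_derive y (ebase l') (pd l (hess H m n)) 0.
  move=> lm ln mn Vy; have := dV _ l' (pd_smooth l (hess_smooth sH m n)) _ Vy.
  rewrite (pd_comm _ _ oV (hess_smooth sH m n) Vy).
  rewrite (pd_eq_on l oV Vy (G := fun=> 0)); last first.
    by move=> {}y {}Vy; exact: (itg_123 iH lm ln mn Vy).
  by rewrite (pd_val (is_derive_const _ _ _)).
have quot0 (F G : 'rV[R]_3 -> R) y v : G y != 0 -> is_derive y v F 0 ->
    is_derive y v G 0 -> is_derive y v (fun x => F x * (G x)^-1) 0.
  move=> G0 dF dG; apply: (is_derive_eq (is_derive_mul dF (is_derive_inv G0 dG))).
  by rewrite mul0r oppr0 mul0r mulr0 addr0.
have prod0 (c : R) (F G : 'rV[R]_3 -> R) y v : is_derive y v F 0 ->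
    is_derive y v G 0 -> is_derive y v (fun x => c * (F x * G x)) 0.
  move=> dF dG; apply: (is_derive_eq (is_derive_cmul c (is_derive_mul dF dG))).
  by rewrite mul0r mulr0 addr0 mulr0.
have rate0 m y : V y -> is_derive y (ebase m) quartic_rate 0.
  move=> Vy; have /or3P[] := ord3_distinct m ij ik jk => /eqP->.
  - apply: (is_derive_eq_on oV Vy (fun z Vz => esym (rate_j Vz))).
    apply: (prod0 be (fun x => h32 x / h3 x) (fun x => q x / h2 x)); last exact: dA2_i.
    apply: (is_derive_eq_on oV Vy (F := fun z => h12 z * (h1 z)^-1)).
      move=> z Vz; rewrite (E12 Vz); move: (h10 Vz) (h30 Vz).
      by move: (h1 z) (h3 z) (h32 z) => a b c a0 b0; field; rewrite ?a0 ?b0.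
    exact: (quot0 _ _ _ _ (h10 Vy) (dd j k j i y ij ik jk Vy) (dh0 ij ik jk Vy)).
  - apply: (prod0 al (fun x => h31 x / h3 x) (fun x => q x / h1 x)); last exact: dA1_j.
    apply: (is_derive_eq_on oV Vy (F := fun z => h21 z * (h2 z)^-1)).
      move=> z Vz; rewrite (E21 Vz); move: (h20 Vz) (h30 Vz).
      by move: (h2 z) (h3 z) (h31 z) => a b c a0 b0; field; rewrite ?a0 ?b0.
    exact: (quot0 _ _ _ _ (h20 Vy) (dd i k i j y ji jk ik Vy) (dh0 ji jk ik Vy)).
  - apply: (prod0 al (fun x => h31 x / h3 x) (fun x => q x / h1 x)); last exact: dA1_k.
    exact: (quot0 _ _ _ _ (h30 Vy) (dd i j i k y ki kj ij Vy) (dh0 ki kj ij Vy)).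
have step m c y : V y -> `|x0 0 m - c| < rho ->
    V (set_coord m c y) /\ quartic_rate (set_coord m c y) = quartic_rate y.
  rewrite VE => Vy cr; have Vc := ball_set_coord cr Vy; split=> //.
  by apply: constant_along Vy Vc => z; rewrite -VE => Vz; exact: rate0.
move=> Vx; have xr m : `|x0 0 m - x 0 m| < rho.
  by move: Vx; rewrite VE => /ball_rowP[_]; apply.
have [V1 E1] := step i _ x0 Vx0 (xr i).
have [V2 E2] := step j _ _ V1 (xr j).
have [V3 E3] := step k _ _ V2 (xr k).
rewrite -E1 -E2 -E3; congr quartic_rate; apply/rowP => m; rewrite !set_coordE.
have /or3P[] := ord3_distinct m ij ik jk => /eqP->.
- by rewrite (negbTE ik) (negbTE ij) eqxx.
- by rewrite (negbTE jk) eqxx.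
- by rewrite eqxx.
Qed.

Let X := quartic_rate x0.
Variables (kap d : R) (c1 c2 c3 : R -> R).
Hypothesis kapE : kap * (al * be * ga) = - (X * K).
Hypothesis cP : forall p, `|p| < d ->
  [/\ [/\ c1 p != 0, c2 p != 0, c3 p != 0 & c1 p + c2 p + c3 p = 0],
      is_derive p (1 : R) c1 (kap * c1 p * (c2 p - c3 p)),
      is_derive p (1 : R) c2 (kap * c2 p * (c3 p - c1 p)) &
      is_derive p (1 : R) c3 (kap * c3 p * (c1 p - c2 p))].
Variable B : set 'rV[R]_4.
Hypothesis oB : open B.
Hypothesis BV : forall z, B z -> V (ufst z).
Hypothesis Bd : forall z, B z -> `|z 0 ip| < d.

Definition quartic m (z : 'rV[R]_4) :=
  if m == i then al * (q (ufst z) * (h1 (ufst z))^-1) * (c1 (z 0 ip))^-1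
  else if m == j then be * (q (ufst z) * (h2 (ufst z))^-1) * (c2 (z 0 ip))^-1
  else ga * (q (ufst z) * (h3 (ufst z))^-1) * (c3 (z 0 ip))^-1.

Let quartic_i : quartic i =
  fun z => al * (q (ufst z) * (h1 (ufst z))^-1) * (c1 (z 0 ip))^-1.
Proof. by apply/funext => z; rewrite /quartic eqxx. Qed.
Let quartic_j : quartic j =
  fun z => be * (q (ufst z) * (h2 (ufst z))^-1) * (c2 (z 0 ip))^-1.
Proof. by apply/funext => z; rewrite /quartic eqxx (negbTE ji). Qed.
Let quartic_k : quartic k =
  fun z => ga * (q (ufst z) * (h3 (ufst z))^-1) * (c3 (z 0 ip))^-1.
Proof. by apply/funext => z; rewrite /quartic (negbTE ki) (negbTE kj). Qed.

Let c10 z : B z -> c1 (z 0 ip) != 0. Proof. by move=> /Bd/cP[[]]. Qed.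
Let c20 z : B z -> c2 (z 0 ip) != 0. Proof. by move=> /Bd/cP[[]]. Qed.
Let c30 z : B z -> c3 (z 0 ip) != 0. Proof. by move=> /Bd/cP[[]]. Qed.
Let csum z : B z -> c1 (z 0 ip) + c2 (z 0 ip) + c3 (z 0 ip) = 0.
Proof. by move=> /Bd/cP[[]]. Qed.

Let dip (f : R -> R) (z : 'rV[R]_4) a : is_derive (z 0 ip) (1 : R) f a ->
  is_derive z (ebase ip) (fun y : 'rV[R]_4 => f (y 0 ip)) a.
Proof.
move=> df; rewrite -[a]mul1r; apply: (@is_derive_pullback R _ R^o
  (fun y : 'rV[R]_4 => y 0 ip) f z (ebase ip) (1 : R) 1 a _ df) => t.
by rewrite addebaseE eqxx [RHS]/(_ + t * 1 * 1) !mulr1.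
Qed.

Let dip0 (f : R -> R) (z : 'rV[R]_4) m : is_derive z (ebase (uix m))
  (fun y : 'rV[R]_4 => f (y 0 ip)) 0.
Proof.
apply/is_derive_line0; rewrite (_ : (fun s : R => _) = fun=> f (z 0 ip)).
  exact: is_derive_const.
apply/funext => s; rewrite addebaseE uixE.
by rewrite (negbTE (neq_lift ip m)) mulr0 addr0.
Qed.

(** The differential system expresses the derivatives polynomially in the three functions, so these
    generate a family closed under derivatives. *)
Let c_smooth : [/\ smooth_on B (fun z => c1 (z 0 ip)),
  smooth_on B (fun z => c2 (z 0 ip)) & smooth_on B (fun z => c3 (z 0 ip))].
Proof.
pose gen (F : 'rV[R]_4 -> R) := exists2 c, [\/ c = c1, c = c2 | c = c3] &
  F = fun z => c (z 0 ip).
have g1 : gen (fun z => c1 (z 0 ip)) by exists c1 => //; exact: Or31.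
have g2 : gen (fun z => c2 (z 0 ip)) by exists c2 => //; exact: Or32.
have g3 : gen (fun z => c3 (z 0 ip)) by exists c3 => //; exact: Or33.
have rat e a b : gen (fun z => e (z 0 ip)) -> gen (fun z => a (z 0 ip)) ->
    gen (fun z => b (z 0 ip)) -> ratfun B gen
      (fun z => kap * e (z 0 ip) * (a (z 0 ip) + -1 * b (z 0 ip))).
  move=> ge ga' gb; apply: ratfunM; first apply: ratfunM.
  - exact: ratfun_cst.
  - exact: ratfun_gen.
  - apply: ratfunD; first exact: ratfun_gen.
    by apply: ratfunM; [exact: ratfun_cst|exact: ratfun_gen].
suff S F : gen F -> smooth_on B F by split; exact: S.
move=> gF; apply: (@smooth_ratfun _ _ B gen oB _ F (ratfun_gen _ gF)) => {F gF} F gF.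
have [a [b [c [ga' gb cab]]]] : exists a b c, [/\ gen (fun z => a (z 0 ip)),
    gen (fun z => b (z 0 ip)) & F = (fun z => c (z 0 ip)) /\ forall p, `|p| < d ->
     is_derive p (1 : R) c (kap * c p * (a p - b p))].
  case: gF => c [->|->|->] ->.
  - by exists c2, c3, c1; split=> //; split=> // p /cP[].
  - by exists c3, c1, c2; split=> //; split=> // p /cP[].
  - by exists c1, c2, c3; split=> //; split=> // p /cP[].
case: cab => EF dc; rewrite EF in gF *; split=> [y By|m].
  have [D _] := dc _ (Bd By).
  apply: (@continuous_comp _ _ _ (fun z : 'rV[R]_4 => z 0 ip) c).
    exact: coord_continuous.
  exact/differentiable_continuous/derivable1_diffP.
case: (unliftP ip m) => [n ->|->].
  exists (fun=> 0); split; first exact: ratfun_cst.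
  by move=> y By; rewrite -uixE; exact: dip0.
exists (fun z => kap * c (z 0 ip) * (a (z 0 ip) + -1 * b (z 0 ip))); split.
  exact: rat.
by move=> y By; rewrite mulN1r; apply: dip; exact: dc (Bd By).
Qed.

Lemma quartic_neq0 m z : B z -> quartic m z != 0.
Proof.
move=> Bz; rewrite /quartic; case: (m == i); last case: (m == j).
- apply: mulf_neq0; last by rewrite invr_eq0; exact: c10.
  apply: mulf_neq0; first exact: al0.
  by apply: mulf_neq0; [exact: q0 (BV Bz)|rewrite invr_eq0; exact: h10 (BV Bz)].
- apply: mulf_neq0; last by rewrite invr_eq0; exact: c20.
  apply: mulf_neq0; first exact: be0.
  by apply: mulf_neq0; [exact: q0 (BV Bz)|rewrite invr_eq0; exact: h20 (BV Bz)].
- apply: mulf_neq0; last by rewrite invr_eq0; exact: c30.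
  apply: mulf_neq0; first exact: ga0.
  by apply: mulf_neq0; [exact: q0 (BV Bz)|rewrite invr_eq0; exact: h30 (BV Bz)].
Qed.

Lemma quartic_smooth m : smooth_on B (quartic m).
Proof.
have sc c : smooth_on B (fun=> c) by exact: smooth_cst.
have [s1 s2 s3] := c_smooth.
have sq : smooth_on B (fun z => q (ufst z)) by exact: (smooth_ufst oB BV root_smooth).
have sh a b : smooth_on B (fun z => hess H a b (ufst z)).
  exact: (smooth_ufst oB BV (hess_smooth sH a b)).
have /or3P[] := ord3_distinct m ij ik jk => /eqP->.
- rewrite quartic_i; apply: (smoothM oB _ (smoothV oB s1 c10)).
  apply: (smoothM oB (sc al)); apply: (smoothM oB sq).
  by apply: (smoothV oB (sh j k)) => z Bz; exact: h10 (BV Bz).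
- rewrite quartic_j; apply: (smoothM oB _ (smoothV oB s2 c20)).
  apply: (smoothM oB (sc be)); apply: (smoothM oB sq).
  by apply: (smoothV oB (sh i k)) => z Bz; exact: h20 (BV Bz).
- rewrite quartic_k; apply: (smoothM oB _ (smoothV oB s3 c30)).
  apply: (smoothM oB (sc ga)); apply: (smoothM oB sq).
  by apply: (smoothV oB (sh i j)) => z Bz; exact: h30 (BV Bz).
Qed.

(** The conic becomes (c1 + c2 + c3) / q, which is the origin of the linear constraint on the
    c's. *)
Lemma quartic_conic m n l z : m != n -> m != l -> n != l -> B z ->
  conic L H quartic m n l z = 0.
Proof.
move=> mn ml nl Bz.
apply: (conic_perm iH BV ij ik jk _ mn ml nl Bz) => {mn ml nl Bz}y By.
rewrite /conic quartic_i quartic_j quartic_k -/al -/be -/ga -/h1 -/h2 -/h3.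
transitivity ((c1 (y 0 ip) + c2 (y 0 ip) + c3 (y 0 ip)) / q (ufst y)); last first.
  by rewrite csum// mul0r.
move: (h10 (BV By)) (h20 (BV By)) (h30 (BV By)) (q0 (BV By)) (c10 By) (c20 By) (c30 By).
move: al0 be0 ga0.
move: (h1 (ufst y)) (h2 (ufst y)) (h3 (ufst y)) (q (ufst y)) (c1 (y 0 ip))
  (c2 (y 0 ip)) (c3 (y 0 ip)) al be ga.
move=> a b c e f g h r s t r0 s0 t0 a0 b0 c0 e0 f0 g0 h0.
by field; rewrite ?a0 ?b0 ?c0 ?e0 ?f0 ?g0 ?h0 ?r0 ?s0 ?t0.
Qed.

Let dterm (e : R) (A : 'rV[R]_3 -> R) (c : R -> R) z m a :
  is_derive (ufst z) (ebase m) A a -> is_derive z (ebase (uix m))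
    (fun y => e * A (ufst y) * (c (y 0 ip))^-1) (e * a * (c (z 0 ip))^-1).
Proof.
move=> dA; apply: (is_derive_eq (is_derive_mul
  (is_derive_cmul e (is_derive_ufst_u dA)) (dip0 (fun p => (c p)^-1) z m))).
by rewrite mulr0 addr0.
Qed.

Let dterm0 (e : R) (A : 'rV[R]_3 -> R) (c : R -> R) z m :
  is_derive (ufst z) (ebase m) A 0 -> is_derive z (ebase (uix m))
    (fun y => e * A (ufst y) * (c (y 0 ip))^-1) 0.
Proof. by move=> dA; apply: (is_derive_eq (dterm e c dA)); rewrite mulr0 mul0r. Qed.

Let dtermX (e : R) (A : 'rV[R]_3 -> R) (c : R -> R) z m a :
  e * a = X -> is_derive (ufst z) (ebase m) A a -> is_derive z (ebase (uix m))
    (fun y => e * A (ufst y) * (c (y 0 ip))^-1) (X * (c (z 0 ip))^-1).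
Proof. by move=> <- dA; exact: dterm. Qed.

Let dterm_p (e : R) (A : 'rV[R]_3 -> R) (c : R -> R) (z : 'rV[R]_4) c' :
  c (z 0 ip) != 0 -> is_derive (z 0 ip) (1 : R) c c' -> is_derive z (ebase ip)
    (fun y => e * A (ufst y) * (c (y 0 ip))^-1)
    (e * A (ufst z) * (- c' / c (z 0 ip) ^+ 2)).
Proof.
move=> c0 dc; apply: (is_derive_eq (is_derive_mul
  (is_derive_cmul e (is_derive_ufst_p A z)) (is_derive_inv c0 (dip dc)))).
by rewrite mulr0 mul0r add0r.
Qed.

Lemma quartic_indep m n z : m != n -> B z -> pd (uix m) (quartic n) z = 0.
Proof.
move=> mn Bz; apply: pd_val; have Vz := BV Bz.
have /or3P[] := ord3_distinct n ij ik jk => /eqP En; rewrite En in mn *;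
  have /or3P[] := ord3_distinct m ij ik jk => /eqP Em; rewrite Em ?eqxx // in mn *.
- by rewrite quartic_i; apply: (dterm0 al c1 (dA1_j Vz)).
- by rewrite quartic_i; apply: (dterm0 al c1 (dA1_k Vz)).
- by rewrite quartic_j; apply: (dterm0 be c2 (dA2_i Vz)).
- by rewrite quartic_j; apply: (dterm0 be c2 (dA2_k Vz)).
- by rewrite quartic_k; apply: (dterm0 ga c3 (dA3_i Vz)).
- by rewrite quartic_k; apply: (dterm0 ga c3 (dA3_j Vz)).
Qed.

Let du m n l z : B z -> is_derive z (ebase (uix l))
  (fun y => hess H m n (ufst y)) (pd l (hess H m n) (ufst z)).
Proof. by move=> Bz; exact: (is_derive_ufst_u (dh m n l (BV Bz))). Qed.

Let du0 m n l z : l != m -> l != n -> m != n -> B z ->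
  is_derive z (ebase (uix l)) (fun y => hess H m n (ufst y)) 0.
Proof. by move=> lm ln mn Bz; exact: (is_derive_ufst_u (dh0 lm ln mn (BV Bz))). Qed.

Let rateX x : V x -> [/\ al * (h31 x / h3 x * (q x / h1 x)) = X,
  be * (h32 x / h3 x * (q x / h2 x)) = X & ga * (h23 x / h2 x * (q x / h3 x)) = X].
Proof.
by move=> Vx; rewrite -rate_j// -rate_k// -/(quartic_rate x) quartic_rate_const.
Qed.

(** Expressed through the constant [X], the third derivatives keep their shape when (i, j, k) is
    rotated, so one algebraic identity serves the three equations with [kapE], [csum] and [q2]
    rotated accordingly. *)
Lemma quartic_rel m : exists2 n, n != m & forall z, B z ->
  is_derive z (ebase (uix m)) (speed H quartic n) ((L n - L m) * pd ip (quartic m) z).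
Proof.
have dl m' z n : n != m' -> B z -> is_derive z (ebase (uix n)) (quartic m') 0.
  move=> nm Bz; rewrite -(quartic_indep nm Bz).
  exact: (pd_is_derive _ (quartic_smooth m') Bz).
have F31 x : V x -> h31 x = X * h3 x * h1 x / (al * q x).
  move=> Vx; have [<- _ _] := rateX Vx.
  move: al0 (q0 Vx) (h10 Vx) (h30 Vx); move: al (q x) (h1 x) (h3 x) (h31 x).
  by move=> a b c e f a0 b0 c0 e0; field; rewrite ?a0 ?b0 ?c0 ?e0.
have F32 x : V x -> h32 x = X * h3 x * h2 x / (be * q x).
  move=> Vx; have [_ <- _] := rateX Vx.
  move: be0 (q0 Vx) (h20 Vx) (h30 Vx); move: be (q x) (h2 x) (h3 x) (h32 x).
  by move=> a b c e f a0 b0 c0 e0; field; rewrite ?a0 ?b0 ?c0 ?e0.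
have F23 x : V x -> h23 x = X * h2 x * h3 x / (ga * q x).
  move=> Vx; have [_ _ <-] := rateX Vx.
  move: ga0 (q0 Vx) (h20 Vx) (h30 Vx); move: ga (q x) (h2 x) (h3 x) (h23 x).
  by move=> a b c e f a0 b0 c0 e0; field; rewrite ?a0 ?b0 ?c0 ?e0.
have F21 x : V x -> h21 x = X * h2 x * h1 x / (al * q x).
  move=> Vx; rewrite (E21 Vx) (F31 _ Vx).
  move: al0 (q0 Vx) (h30 Vx); move: al (q x) (h1 x) (h2 x) (h3 x) X.
  by move=> a b c e f g a0 b0 f0; field; rewrite ?a0 ?b0 ?f0.
have F12 x : V x -> h12 x = X * h1 x * h2 x / (be * q x).
  move=> Vx; rewrite (E12 Vx) (F32 _ Vx).
  move: be0 (q0 Vx) (h30 Vx); move: be (q x) (h1 x) (h2 x) (h3 x) X.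
  by move=> a b c e f g a0 b0 f0; field; rewrite ?a0 ?b0 ?f0.
have F13 x : V x -> h13 x = X * h1 x * h3 x / (ga * q x).
  move=> Vx; rewrite (E13 Vx) (F23 _ Vx).
  move: ga0 (q0 Vx) (h20 Vx); move: ga (q x) (h1 x) (h2 x) (h3 x) X.
  by move=> a b c e f g a0 b0 f0; field; rewrite ?a0 ?b0 ?f0.
have kapE2 : kap * (be * ga * al) = - (X * K) by rewrite -kapE; congr (_ * _); ring.
have kapE3 : kap * (ga * al * be) = - (X * K) by rewrite -kapE; congr (_ * _); ring.
have csum2 z : B z -> c2 (z 0 ip) + c3 (z 0 ip) + c1 (z 0 ip) = 0.
  by move=> Bz; apply: etrans (csum Bz); rewrite addrC addrA.
have csum3 z : B z -> c3 (z 0 ip) + c1 (z 0 ip) + c2 (z 0 ip) = 0.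
  by move=> Bz; apply: etrans (csum Bz); rewrite -addrA addrC.
have q22 x : V x -> q x ^+ 2 = K * (h2 x * h3 x * h1 x).
  by move=> Vx; rewrite q2//; congr (_ * _); ring.
have q23 x : V x -> q x ^+ 2 = K * (h3 x * h1 x * h2 x).
  by move=> Vx; rewrite q2//; congr (_ * _); ring.
have /or3P[] := ord3_distinct m ij ik jk => /eqP->.
- exists j => // z Bz; have Vz := BV Bz; have [X1 X2 X3] := rateX Vz.
  have [_ dc1 dc2 dc3] := cP (Bd Bz).
  apply: (is_derive_eq_on oB Bz (F := fun y => - hess H j j (ufst y) +
     - ((quartic k y * hess H j k (ufst y) + quartic i y * hess H i j (ufst y))
      * (quartic j y)^-1))).
    move=> y By; rewrite (speedE iH BV quartic_neq0 jk ji ki By).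
    by rewrite (hess_sym oV sH j i (BV By)).
  have dii := dtermX c1 X1 (dA1_i Vz); rewrite -quartic_i in dii.
  have dpi : is_derive z (ebase ip) (quartic i) (al * (q (ufst z) * (h1 (ufst z))^-1)
      * (- (kap * c1 (z 0 ip) * (c2 (z 0 ip) - c3 (z 0 ip))) / c1 (z 0 ip) ^+ 2)).
    by rewrite quartic_i; exact: (dterm_p al (fun x => q x * (h1 x)^-1) (c10 Bz) dc1).
  apply: (is_derive_eq (is_derive_add (is_derive_opp (du j j i Bz))
    (is_derive_opp (is_derive_mul (is_derive_add
      (is_derive_mul (dl k z i ik Bz) (du0 ij ik jk Bz))
      (is_derive_mul dii (du i j i Bz)))
      (is_derive_inv (quartic_neq0 j Bz) (dl j z i ij Bz)))))).
  rewrite (dhess_comm oV sH j j i Vz) (pd_val dpi) quartic_i quartic_j.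
  rewrite -[L j - L i]opprB.
  exact: (quartic_rel_algebra _ _ al0 be0 ga0 (h10 Vz) (h20 Vz) (h30 Vz) (q0 Vz)
    (c10 Bz) (c20 Bz) (csum Bz) K2 (q2 Vz) kapE (F31 _ Vz) (F32 _ Vz)).
- exists k => // z Bz; have Vz := BV Bz; have [X1 X2 X3] := rateX Vz.
  have [_ dc1 dc2 dc3] := cP (Bd Bz).
  apply: (is_derive_eq_on oB Bz (F := fun y => - hess H k k (ufst y) +
     - ((quartic i y * hess H i k (ufst y) + quartic j y * hess H j k (ufst y))
      * (quartic k y)^-1))).
    move=> y By; rewrite (speedE iH BV quartic_neq0 ki kj ij By).
    by rewrite (hess_sym oV sH k i (BV By)) (hess_sym oV sH k j (BV By)).
  have dii := dtermX c2 X2 (dA2_j Vz); rewrite -quartic_j in dii.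
  have dpi : is_derive z (ebase ip) (quartic j) (be * (q (ufst z) * (h2 (ufst z))^-1)
      * (- (kap * c2 (z 0 ip) * (c3 (z 0 ip) - c1 (z 0 ip))) / c2 (z 0 ip) ^+ 2)).
    by rewrite quartic_j; exact: (dterm_p be (fun x => q x * (h2 x)^-1) (c20 Bz) dc2).
  apply: (is_derive_eq (is_derive_add (is_derive_opp (du k k j Bz))
    (is_derive_opp (is_derive_mul (is_derive_add
      (is_derive_mul (dl i z j ji Bz) (du0 ji jk ik Bz))
      (is_derive_mul dii (du j k j Bz)))
      (is_derive_inv (quartic_neq0 k Bz) (dl k z j jk Bz)))))).
  rewrite (dhess_comm oV sH k k j Vz) (pd_val dpi) quartic_j quartic_k.
  rewrite -[L k - L j]opprB.
  exact: (quartic_rel_algebra _ _ be0 ga0 al0 (h20 Vz) (h30 Vz) (h10 Vz) (q0 Vz)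
    (c20 Bz) (c30 Bz) (csum2 _ Bz) K2 (q22 _ Vz) kapE2 (F12 _ Vz) (F13 _ Vz)).
- exists i => // z Bz; have Vz := BV Bz; have [X1 X2 X3] := rateX Vz.
  have [_ dc1 dc2 dc3] := cP (Bd Bz).
  apply: (is_derive_eq_on oB Bz (F := fun y => - hess H i i (ufst y) +
     - ((quartic j y * hess H i j (ufst y) + quartic k y * hess H i k (ufst y))
      * (quartic i y)^-1))).
    by move=> y By; rewrite (speedE iH BV quartic_neq0 ij ik jk By).
  have dii := dtermX c3 X3 (dA3_k Vz); rewrite -quartic_k in dii.
  have dpi : is_derive z (ebase ip) (quartic k) (ga * (q (ufst z) * (h3 (ufst z))^-1)
      * (- (kap * c3 (z 0 ip) * (c1 (z 0 ip) - c2 (z 0 ip))) / c3 (z 0 ip) ^+ 2)).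
    by rewrite quartic_k; exact: (dterm_p ga (fun x => q x * (h3 x)^-1) (c30 Bz) dc3).
  apply: (is_derive_eq (is_derive_add (is_derive_opp (du i i k Bz))
    (is_derive_opp (is_derive_mul (is_derive_add
      (is_derive_mul (dl j z k kj Bz) (du0 ki kj ij Bz))
      (is_derive_mul dii (du i k k Bz)))
      (is_derive_inv (quartic_neq0 i Bz) (dl i z k ki Bz)))))).
  rewrite (dhess_comm oV sH i i k Vz) (dhess_sym oV sH k i i Vz).
  rewrite (pd_val dpi) quartic_k quartic_i.
  rewrite -[L i - L k]opprB.
  exact: (quartic_rel_algebra _ _ ga0 al0 be0 (h30 Vz) (h10 Vz) (h20 Vz) (q0 Vz)
    (c30 Bz) (c10 Bz) (csum3 _ Bz) K2 (q23 _ Vz) kapE3 (F23 _ Vz) (F21 _ Vz)).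
Qed.

End Quartic.

Lemma integrable_subset {R : realType} (L : 'I_3 -> R) H U V :
  open V -> V `<=` U -> integrable L H U -> integrable L H V.
Proof.
move=> oV VU [oU sH h0 h123 hJ hiii]; split => //.
- exact: smooth_subset sH.
- by move=> i j x ij /VU; exact: h0.
- by move=> i j k x ij ik jk /VU; exact: h123.
- by move=> i j k x ij ik jk /VU; exact: hJ.
- by move=> i j k x ij ik jk /VU; exact: hiii.
Qed.

Lemma lax_pair_quartic {R : realType} (l1 l2 l3 : R) H (x0 : 'rV[R]_3) (rho : R) :
  let V := ball x0 rho in
  integrable (lam l1 l2 l3) H V -> injective (lam l1 l2 l3) -> 0 < rho ->
  (forall a b c x, a != b -> a != c -> b != c -> V x ->
    pd c (hess H a c) x * hess H b c x = hess H a c x * pd c (hess H b c) x) ->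
  has_dispersionless_Lax_pair l1 l2 l3 H V.
Proof.
move=> V iH Linj rho0 deg; set L := lam l1 l2 l3 in iH Linj.
have [n12 n13 n23] : [/\ i1 != i2, i1 != i3 & i2 != i3] by [].
have n31 : i3 != i1 by [].
have oV : open V := itg_open iH.
have Vx0 : V x0 by exact: ballxx.
pose P x := hess H i2 i3 x * hess H i1 i3 x * hess H i1 i2 x.
have sH := itg_smooth iH.
have sP : smooth_on V P.
  exact: (smoothM oV (smoothM oV (hess_smooth sH i2 i3) (hess_smooth sH i1 i3))
    (hess_smooth sH i1 i2)).
have P0 : P x0 != 0.
  by apply: mulf_neq0; first apply: mulf_neq0; apply: (itg_neq0 iH).
(* The product of the mixed derivatives keeps its sign at the centre on a smaller ball, where the
   square root is then differentiable. *)
pose K := Num.sg (P x0).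
have K2 : K * K = 1 by rewrite -expr2 sqr_sg P0.
have KP0 : 0 < K * P x0 by rewrite -normrEsg normr_gt0.
have [r r0 rP] : exists2 r : R, 0 < r & forall x, ball x0 r x -> V x /\ 0 < K * P x.
  have cK := smooth_continuous (smoothM oV (smooth_cst K oV) sP) Vx0.
  have N : \forall y \near x0, `|K * P x0 - K * P y| < K * P x0.
    by move/cvgrPdist_lt : cK; apply.
  have /nbhs_ballP[r /= r0 xr] : \forall y \near x0, V y /\ 0 < K * P y.
    apply: filterS2 (open_nbhs_nbhs (conj oV Vx0)) N => y Vy Py; split=> //.
    by move: Py; rewrite ltr_norml => /andP[_]; rewrite ltrBlDr ltrDl.
  by exists r.
pose V' := ball x0 r.
have V'V : V' `<=` V by move=> x /rP[].
have oV' : open V' by exact: ball_open.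
have iH' := integrable_subset oV' V'V iH.
have deg' a b c x : a != b -> a != c -> b != c -> V' x ->
    pd c (hess H a c) x * hess H b c x = hess H a c x * pd c (hess H b c) x.
  by move=> ab ac bc /V'V; exact: deg.
have Kpos x : V' x -> 0 < K * (hess H i2 i3 x * hess H i1 i3 x * hess H i1 i2 x).
  by move=> /rP[].
apply: (lax_pair_subset V'V).
pose X := quartic_rate L H i1 i2 i3 K x0.
pose al := L i2 - L i3. pose be := L i3 - L i1. pose ga := L i1 - L i2.
have abg0 : al * be * ga != 0.
  by apply: mulf_neq0; first apply: mulf_neq0; rewrite subr_eq0 (inj_eq Linj).
pose kap := - (X * K) / (al * be * ga).
have kapE : kap * (al * be * ga) = - (X * K) by rewrite divfK.
have [c1 [c2 [c3 [d [d0 cP]]]]] := cyclic_system kap.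
pose s := Num.min r d.
have s0 : 0 < s by rewrite lt_min r0.
pose z0 := up_pair x0 0.
have oB : open (ball z0 s) by exact: ball_open.
have BV z : ball z0 s z -> V' (ufst z).
  move=> /ball_rowP[_ zs]; apply/ball_rowP; split=> // m.
  have := zs (uix m); rewrite !mxE -[widen_ord _ m]/(uix m) uixE liftK => h.
  by apply: lt_le_trans h _; rewrite ge_min lexx.
have Bd z : ball z0 s z -> `|z 0 ip| < d.
  move=> /ball_rowP[_ zs]; have := zs ip; rewrite up_pair_p sub0r normrN => h.
  by apply: lt_le_trans h _; rewrite ge_min lexx orbT.
apply: (@lax_pair_of_conic _ _ _ _ _ _ z0 s (quartic L H i1 i2 i3 K c1 c2 c3)) => //.
- move=> m; exact: (quartic_smooth iH' n12 n13 n23 deg' Kpos cP oB BV Bd).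
- move=> m z; exact: (quartic_neq0 iH' Linj n12 n13 n23 Kpos cP BV Bd).
- move=> m n z; exact: (quartic_indep iH' n12 n13 n23 deg' Kpos c1 c2 c3 BV).
- move=> m n l z; exact: (quartic_conic iH' Linj n12 n13 n23 Kpos cP BV Bd).
- move=> m; have Vx0' : V' x0 by exact: ballxx.
  exact: (quartic_rel iH' Linj erefl Vx0' n12 n13 n23 deg' K2 Kpos kapE cP oB BV Bd).
Qed.

(* Either the ratio of two mixed derivatives varies along their common direction,
   and the Lax pair is given by a translate of [H] itself, or all these ratios are
   constant and [H] is a quartic. *)
Lemma lax_pair_of_integrable {R : realType} (l1 l2 l3 : R) H (x0 : 'rV[R]_3) (rho : R) :
  let V := ball x0 rho in
  integrable (lam l1 l2 l3) H V -> injective (lam l1 l2 l3) -> 0 < rho ->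
  has_dispersionless_Lax_pair l1 l2 l3 H V.
Proof.
move=> V iH Linj rho0.
have [[a [b [c [x [t [ab ac bc [Vx Vt w0]]]]]]]|N] := pselect (exists a b c x t,
  [/\ a != b, a != c, b != c & [/\ V x, V (set_coord c t x) &
    hess H b c x * hess H a c (set_coord c t x)
    - hess H a c x * hess H b c (set_coord c t x) != 0]]).
  exact: (lax_pair_chord iH Linj ab ac bc Vx Vt w0).
apply: (lax_pair_quartic iH Linj rho0) => a b c x ab ac bc Vx.
have oV : open V := itg_open iH.
have sH := itg_smooth iH.
(* The determinant with its first point frozen at [x]. By [N] it vanishes along the line through [x]
   in direction c, and its derivative there is the degenerate identity. *)
pose F y := hess H b c x * hess H a c y + - (hess H a c x * hess H b c y).
have D : is_derive x (ebase c) F (hess H b c x * pd c (hess H a c) x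
    + - (hess H a c x * pd c (hess H b c) x)).
  apply: is_derive_add; first exact: (is_derive_cmul _ (hess_d sH a c c Vx)).
  exact: (is_derive_opp (is_derive_cmul _ (hess_d sH b c c Vx))).
have Z : is_derive x (ebase c) F 0.
  apply/is_derive_line0.
  have cl : {for 0, continuous (fun s : R => x + s *: ebase c)}.
    apply: (@continuousD R _ _ (fun=> x) (fun s : R => s *: ebase c)).
      exact: cst_continuous.
    exact: scalel_continuous.
  have nV : \forall s \near (0 : R), V (x + s *: ebase c).
    by apply: cl; rewrite /= scale0r addr0; exact: open_nbhs_nbhs.
  have D0 : is_derive (0 : R) (1 : R) (fun _ : R => 0 : R) 0.
    exact: (@is_derive_const R R^o 0 1 0).
  apply: near_eq_is_derive D0; apply: filterS nV => s Vs; apply: contrapT => /eqP w0; apply: N.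
  exists a, b, c, x, (x 0 c + s); split=> //; split=> //.
    by rewrite /set_coord addrAC subrr add0r.
  by rewrite /set_coord addrAC subrr add0r; move: w0; rewrite eq_sym.
have := is_derive_unique D Z.
move: (hess H b c x) (hess H a c x) (pd c (hess H a c) x) (pd c (hess H b c) x).
move=> p q r s E; apply/eqP; rewrite -subr_eq0; apply/eqP.
by rewrite -[RHS]E; ring.
Qed.

(** * The integrability conditions of the theorem *)

Section Conditions.
Context {R : realType}.
Variables (l1 l2 l3 : R) (U : set 'rV[R]_3) (H : 'rV[R]_3 -> R).
Hypotheses (oU : open U) (sH : smooth_on U H).
Hypothesis mixed_neq0 :
  forall x, U x -> [/\ H12 H x != 0, H13 H x != 0 & H23 H x != 0].
Hypothesis J0 : forall x, U x -> Jinv l1 l2 l3 H x = 0.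
Hypothesis H123_0 : forall x, U x -> H123 H x = 0.
Hypothesis cond1 : forall x, U x ->
  pdiff i1 (fun y => (l3 - l2) * H11 H y + R2 l1 l3 H y + R3 l1 l2 H y) x = 0.
Hypothesis cond2 : forall x, U x ->
  pdiff i2 (fun y => (l1 - l3) * H22 H y + R1 l2 l3 H y + R3 l1 l2 H y) x = 0.
Hypothesis cond3 : forall x, U x ->
  pdiff i3 (fun y => (l2 - l1) * H33 H y + R1 l2 l3 H y + R2 l1 l3 H y) x = 0.

Let L := lam l1 l2 l3.

Let hessE i j : pdiff i (pdiff j H) = hess H i j.
Proof. by rewrite /hess !pd.unlock. Qed.

Let E11 : H11 H = hess H i1 i1. Proof. exact: hessE. Qed.
Let E22 : H22 H = hess H i2 i2. Proof. exact: hessE. Qed.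
Let E33 : H33 H = hess H i3 i3. Proof. exact: hessE. Qed.
Let E12 : H12 H = hess H i1 i2. Proof. exact: hessE. Qed.
Let E13 : H13 H = hess H i1 i3. Proof. exact: hessE. Qed.
Let E23 : H23 H = hess H i2 i3. Proof. exact: hessE. Qed.

Let hsym i j x : U x -> hess H i j x = hess H j i x.
Proof. exact: (hess_sym oU sH). Qed.

Let cond_neq0 i j x : i != j -> U x -> hess H i j x != 0.
Proof.
move=> ij Ux; have := mixed_neq0 Ux; rewrite E12 E13 E23 => -[n12 n13 n23].
have /or3P[] := @ord3_distinct i1 i2 i3 i isT isT isT => /eqP Ei;
  have /or3P[] := @ord3_distinct i1 i2 i3 j isT isT isT => /eqP Ej;
  rewrite Ei Ej ?eqxx // in ij *.
- by rewrite hsym.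
- by rewrite hsym.
- by rewrite hsym.
Qed.

Let ratio_123 x : U x -> [/\ ratio H i2 i3 i1 x = hess H i1 i2 x * hess H i1 i3 x / hess H i2 i3 x,
  ratio H i3 i1 i2 x = hess H i1 i2 x * hess H i2 i3 x / hess H i1 i3 x &
  ratio H i1 i2 i3 x = hess H i1 i3 x * hess H i2 i3 x / hess H i1 i2 x].
Proof.
move=> Ux; rewrite /ratio (hsym i2 i1 Ux) (hsym i3 i1 Ux) (hsym i3 i2 Ux).
by split=> //; move: (hess H i2 i3 x) (hess H i1 i2 x) (hess H i1 i3 x) => a b c;
  rewrite (mulrC a).
Qed.

Let cond_iii i j k : i != j -> k != i -> (forall x, U x -> pd i (fun y =>
    (L k - L j) * hess H i i y + (L k - L i) * ratio H k i j y
      + (L i - L j) * ratio H i j k y) x = 0) ->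
  forall x, U x -> (L j - L k) * pd i (hess H i i) x =
    (L k - L i) * pd i (ratio H k i j) x + (L i - L j) * pd i (ratio H i j k) x.
Proof.
move=> ij ki E x Ux; have := E x Ux.
have sr a b c : a != b -> smooth_on U (ratio H a b c).
  move=> ab; apply: (smoothM oU).
    exact: (smoothM oU (hess_smooth sH a c) (hess_smooth sH b c)).
  by apply: (smoothV oU (hess_smooth sH a b)) => y; exact: cond_neq0.
rewrite (pd_val (is_derive_add (is_derive_add
  (is_derive_cmul (L k - L j) (hess_d sH i i i Ux))
  (is_derive_cmul (L k - L i) (pd_is_derive i (sr k i j ki) Ux)))
  (is_derive_cmul (L i - L j) (pd_is_derive i (sr i j k ij) Ux)))).
move: (pd i (hess H i i) x) (pd i (ratio H k i j) x) (pd i (ratio H i j k) x).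
move=> a b c E0; apply/eqP; rewrite -subr_eq0; apply/eqP.
by rewrite -[RHS]oppr0 -E0; ring.
Qed.

Lemma integrable_conditions : integrable L H U.
Proof.
have n12 : i1 != i2 by []. have n13 : i1 != i3 by []. have n23 : i2 != i3 by [].
split=> //.
- move=> i j k x ij ik jk; move: x.
  apply: (@distinct3_perm (fun i j k => forall x, U x -> pd i (hess H j k) x = 0)
    _ _ i1 i2 i3) => // {i j k ij ik jk} [i j k E x Ux|i j k E x Ux|x Ux].
  + by rewrite (dhess_sym oU sH k i j Ux) (dhess_comm oU sH i k j Ux) E.
  + by rewrite (dhess_sym oU sH k j i Ux) E.
  + by rewrite -hessE pdE; exact: H123_0.
- move=> i j k x ij ik jk; move: x.
  apply: (@distinct3_perm (fun i j k => forall x, U x ->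
    (L j - L k) * hess H i i x + (L k - L i) * hess H j j x
      + (L i - L j) * hess H k k x =
    (L j - L k) * ratio H j k i x + (L k - L i) * ratio H k i j x
      + (L i - L j) * ratio H i j k x) _ _ i1 i2 i3) =>
    // {i j k ij ik jk} [i j k E x Ux|i j k E x Ux|x Ux].
  + rewrite addrC addrA E//.
    by rewrite [RHS]addrC addrA.
  + rewrite (ratio_sym oU sH k j i Ux) (ratio_sym oU sH j i k Ux)
      (ratio_sym oU sH i k j Ux).
    apply: oppr_inj; move: (E x Ux).
    move: (hess H i i x) (hess H j j x) (hess H k k x) (ratio H j k i x)
      (ratio H k i j x) (ratio H i j k x) => a b c d e f E0.
    by apply: etrans (etrans _ E0) _; ring.
  + have [-> -> ->] := ratio_123 Ux; rewrite /L /lam /=.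
    have := J0 Ux; rewrite /Jinv /Delta E11 E22 E33 E12 E13 E23.
    move: (cond_neq0 n12 Ux) (cond_neq0 n13 Ux) (cond_neq0 n23 Ux).
    move: (hess H i1 i2 x) (hess H i1 i3 x) (hess H i2 i3 x) (hess H i1 i1 x)
      (hess H i2 i2 x) (hess H i3 i3 x) => a b c d e f a0 b0 c0 E0.
    have abc0 : a * c * b != 0 by apply: mulf_neq0 => //; exact: mulf_neq0.
    apply: (mulfI abc0); apply/esym/eqP; rewrite -subr_eq0; apply/eqP.
    by apply: etrans (_ : _ = _) E0; field; rewrite ?a0 ?b0 ?c0.
- have B1 := cond_iii n12 (k := i3) isT.
  have B2 := cond_iii n23 (k := i1) isT.
  have B3 := @cond_iii i3 i1 i2 isT isT.
  have {}B1 := B1 _; have {}B2 := B2 _; have {}B3 := B3 _.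
  (* Exchanging j and k reverses the sign of both sides, so the three cyclic instances yield all six
     orderings. *)
  have S i j k : (forall x, U x -> (L j - L k) * pd i (hess H i i) x =
      (L k - L i) * pd i (ratio H k i j) x + (L i - L j) * pd i (ratio H i j k) x) ->
    forall x, U x -> (L k - L j) * pd i (hess H i i) x =
      (L j - L i) * pd i (ratio H j i k) x + (L i - L k) * pd i (ratio H i k j) x.
    move=> E x Ux; move: (E x Ux).
    rewrite (dratio_sym oU sH j i k i Ux) (dratio_sym oU sH i k j i Ux).
    move: (pd i (hess H i i) x) (pd i (ratio H k i j) x) (pd i (ratio H i j k) x).
    by move=> a b c E0; apply: oppr_inj; apply: etrans (etrans _ E0) _; ring.
  have {}B1 : forall x, U x -> (L i2 - L i3) * pd i1 (hess H i1 i1) x =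
      (L i3 - L i1) * pd i1 (ratio H i3 i1 i2) x
      + (L i1 - L i2) * pd i1 (ratio H i1 i2 i3) x.
    apply: B1 => x Ux; rewrite -(cond1 Ux) -pdE; apply: (pd_eq_on i1 oU Ux) => y Uy.
    have [_ -> ->] := ratio_123 Uy; rewrite /R2 /R3 E11 E12 E13 E23 /L /lam /=.
    move: (hess H i1 i2 y * hess H i2 i3 y / hess H i1 i3 y)
      (hess H i1 i3 y * hess H i2 i3 y / hess H i1 i2 y) (hess H i1 i1 y) => a b c.
    by ring.
  have {}B2 : forall x, U x -> (L i3 - L i1) * pd i2 (hess H i2 i2) x =
      (L i1 - L i2) * pd i2 (ratio H i1 i2 i3) x
      + (L i2 - L i3) * pd i2 (ratio H i2 i3 i1) x.
    apply: B2 => x Ux; rewrite -(cond2 Ux) -pdE; apply: (pd_eq_on i2 oU Ux) => y Uy.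
    have [-> _ ->] := ratio_123 Uy; rewrite /R1 /R3 E22 E12 E13 E23 /L /lam /=.
    move: (hess H i1 i2 y * hess H i1 i3 y / hess H i2 i3 y)
      (hess H i1 i3 y * hess H i2 i3 y / hess H i1 i2 y) (hess H i2 i2 y) => a b c.
    by ring.
  have {}B3 : forall x, U x -> (L i1 - L i2) * pd i3 (hess H i3 i3) x =
      (L i2 - L i3) * pd i3 (ratio H i2 i3 i1) x
      + (L i3 - L i1) * pd i3 (ratio H i3 i1 i2) x.
    apply: B3 => x Ux; rewrite -(cond3 Ux) -pdE; apply: (pd_eq_on i3 oU Ux) => y Uy.
    have [-> -> _] := ratio_123 Uy; rewrite /R1 /R2 E33 E12 E13 E23 /L /lam /=.
    move: (hess H i1 i2 y * hess H i1 i3 y / hess H i2 i3 y)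
      (hess H i1 i2 y * hess H i2 i3 y / hess H i1 i3 y) (hess H i3 i3 y) => a b c.
    by ring.
  move=> i j k x ij ik jk.
  have /or3P[] := @ord3_distinct i1 i2 i3 i isT isT isT => /eqP Ei;
    have /or3P[] := @ord3_distinct i1 i2 i3 j isT isT isT => /eqP Ej;
    have /or3P[] := @ord3_distinct i1 i2 i3 k isT isT isT => /eqP Ek;
    rewrite Ei Ej Ek ?eqxx // in ij ik jk *.
  + exact: B1.
  + exact: S B1 x.
  + exact: S B2 x.
  + exact: B2.
  + exact: B3.
  + exact: S B3 x.
Qed.

End Conditions.

Theorem theorem4 (R : realType) (l1 l2 l3 : R) (U : set 'rV[R]_3)
  (H : 'rV[R]_3 -> R) :
  l1 != l2 -> l1 != l3 -> l2 != l3 ->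
  open U -> U !=set0 -> smooth_on U H ->
  (forall x, U x -> [/\ H12 H x != 0, H13 H x != 0 & H23 H x != 0]) ->
  (forall x, U x -> Jinv l1 l2 l3 H x = 0) ->
  (forall x, U x -> H123 H x = 0) ->
  (forall x, U x ->
     pdiff i1 (fun y => (l3 - l2) * H11 H y + R2 l1 l3 H y + R3 l1 l2 H y) x = 0) ->
  (forall x, U x ->
     pdiff i2 (fun y => (l1 - l3) * H22 H y + R1 l2 l3 H y + R3 l1 l2 H y) x = 0) ->
  (forall x, U x ->
     pdiff i3 (fun y => (l2 - l1) * H33 H y + R1 l2 l3 H y + R2 l1 l3 H y) x = 0) ->
  has_dispersionless_Lax_pair l1 l2 l3 H U.
Proof.
move=> l12 l13 l23 oU [x0 Ux0] sH n0 J0 H0 C1 C2 C3.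
have iH := integrable_conditions oU sH n0 J0 H0 C1 C2 C3.
have /nbhs_ballP[r /= r0 rU] : nbhs x0 U by exact: open_nbhs_nbhs.
apply: (lax_pair_subset rU); apply: lax_pair_of_integrable => //.
  by apply: integrable_subset iH => //; exact: ball_open.
exact: lam_inj.
Qed.
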